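(* Let $\Gamma \subset \mathbb{C}$ be a piecewise smooth, simple, closed, positively oriented curve with interior component $\Omega^-$, containing $0$, and exterior component $\Omega^+$. Let $f^+$ be the exterior Riemann map of $\Gamma$, extended continuously to $\Gamma$. Let $m > 0$ be an integer and let $p_m$ be the $m$th Faber polynomial. Then for all $z \in \Omega^-$, $$p_m(z) = \frac{1}{\pi} \int_\Gamma \left(f^+(y)\right)^m \, \hat{n}\cdot\nabla_y \log|y - z| \, ds(y).$$
   Context: $\mathbb{C}$ is identified with $\mathbb{R}^2$. $\Omega^-$ and $\Omega^+$ denote the bounded (inner) and unbounded (outer) components of $\mathbb{C}\setminus\Gamma$. It is a standing assumption that $0 \in \Omega^-$. Exterior Riemann map: $f^+$ is the complex analytic bijection of $\Omega^+$ onto $\{z : |z|>1\}$ with $\lim_{z\to\infty} f^+(z) = \infty$ and $\lim_{z\to\infty}(f^+)'(z)$ a positive real number. By Carathéodory's theorem it extends continuously to $\Gamma$, giving a one-to-one correspondence between $\Gamma$ and the unit circle; the values of $f^+$ on $\Gamma$ are those of this extension. Faber polynomials: for $R>0$ large enough that $\Omega^-$ is contained in the disk of radius $R$ centered at $0$, one has $f^+(z) = \alpha_1 z + \alpha_0 + \alpha_{-1}z^{-1} + \alpha_{-2}z^{-2} + \cdots$ for $|z|>R$. The $m$th Faber polynomial $p_m$ is the sum of the terms of nonnegative power of $z$ in the Laurent series of $f^+(z)^m$ in $|z|>R$; it is a polynomial of degree $m$. $\hat{n}\cdot\nabla_y$ denotes the derivative with respect to $y$ along the outward-facing unit normal $\hat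 n$ to $\Gamma$ at $y$ (defined at all but finitely many points of $\Gamma$), and $ds$ is arc length. *)

(* Defs.v *)
(* Stdlib reals; the plane is Coquelicot's C = R * R. *)
From Stdlib Require Import Reals.
From Coquelicot Require Import Coquelicot.
Open Scope R_scope.

Definition bounded_set (E : C -> Prop) : Prop :=
  exists M : R, forall z, E z -> Cmod z <= M.

Definition connected_set (E : C -> Prop) : Prop :=
  forall U V : C -> Prop,
    open (T := C_UniformSpace) U -> open (T := C_UniformSpace) V ->
    (forall z, E z -> U z \/ V z) ->
    (exists z, E z /\ U z) -> (exists z, E z /\ V z) ->
    exists z, E z /\ U z /\ V z.

Definition component (E : C -> Prop) (z w : C) : Prop :=
  exists A : C -> Prop,
    connected_set A /\ (forall x, A x -> E x) /\ A z /\ A w.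

Definition C_infty (P : C -> Prop) : Prop :=
  exists M : R, forall z, M < Cmod z -> P z.

Definition bij_between (A B : C -> Prop) (f : C -> C) : Prop :=
  (forall z, A z -> B (f z)) /\
  (forall w, B w -> exists! z, A z /\ f z = w).

Definition Icc (a b t : R) : Prop := a <= t <= b.

(** Continuously differentiable up to the end points with nonvanishing
    derivative.  As [gamma] and [d] are continuous on the closed interval, the
    values of [d] at [a] and [b] are the one-sided derivatives of [gamma]. *)
Definition smooth_arc (gamma : R -> C) (a b : R) : Prop :=
  continuous_on (U := C_UniformSpace) (Icc a b) gamma /\
  exists d : R -> C,
    (forall t, a < t < b -> is_derive (V := C_R_NormedModule) gamma t (d t)) /\
    continuous_on (U := C_UniformSpace) (Icc a b) d /\
    (forall t, Icc a b t -> d t <> RtoC 0).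

Definition piecewise_smooth (gamma : R -> C) (a b : R) : Prop :=
  exists (n : nat) (t : nat -> R),
    t O = a /\ t n = b /\
    forall i, (i < n)%nat ->
      t i < t (S i) /\ smooth_arc gamma (t i) (t (S i)).

Definition simple_closed (gamma : R -> C) (a b : R) : Prop :=
  a < b /\ gamma a = gamma b /\
  forall s t, a <= s < b -> a <= t < b -> gamma s = gamma t -> s = t.

Definition curve (gamma : R -> C) (a b : R) (z : C) : Prop :=
  exists t, a <= t <= b /\ gamma t = z.

Definition off_curve (gamma : R -> C) (a b : R) (z : C) : Prop :=
  ~ curve gamma a b z.

(** For a simple closed curve, the bounded component of the complement is the
    set of points whose component is bounded; likewise for the unbounded one. *)
Definition inner (gamma : R -> C) (a b : R) (z : C) : Prop :=
  off_curve gamma a b z /\ bounded_set (component (off_curve gamma a b) z).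

Definition outer (gamma : R -> C) (a b : R) (z : C) : Prop :=
  off_curve gamma a b z /\ ~ bounded_set (component (off_curve gamma a b) z).

Definition velocity (gamma : R -> C) (t : R) : C :=
  (Derive (fun s => Re (gamma s)) t, Derive (fun s => Im (gamma s)) t).

(** Winding number +1 about every interior point:
    the integral of dy / (y - z) along the curve is 2 pi i. *)
Definition positively_oriented (gamma : R -> C) (a b : R) : Prop :=
  forall z, inner gamma a b z ->
    is_RInt (V := C_R_NormedModule)
      (fun t => velocity gamma t / (gamma t - z))%C a b
      (RtoC (2 * PI) * Ci)%C.

Definition outward_unit_normal (gamma : R -> C) (a b : R) (y d nu : C) : Prop :=
  Cmod nu = 1 /\
  Re nu * Re d + Im nu * Im d = 0 /\
  exists delta, 0 < delta /\
    forall e, 0 < e < delta ->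
      outer gamma a b (y + RtoC e * nu)%C /\
      inner gamma a b (y - RtoC e * nu)%C.

(** The values of [nu] at corners, which are finitely many, are irrelevant. *)
Definition outward_normal_field (gamma : R -> C) (a b : R) (nu : C -> C) : Prop :=
  forall (t : R) (d : C), a < t < b ->
    is_derive (V := C_R_NormedModule) gamma t d ->
    outward_unit_normal gamma a b (gamma t) d (nu (gamma t)).

Definition normal_derivative (nu : C -> C) (u : C -> R) (y : C) : R :=
  Derive (fun s => u (y + RtoC s * nu y)%C) 0.

Definition arc_integrand (gamma : R -> C) (g : C -> C) (t : R) : C :=
  (g (gamma t) * RtoC (Cmod (velocity gamma t)))%C.

Definition ex_arc_integral (gamma : R -> C) (a b : R) (g : C -> C) : Prop :=
  ex_RInt (V := C_R_NormedModule) (arc_integrand gamma g) a b.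

Definition arc_integral (gamma : R -> C) (a b : R) (g : C -> C) : C :=
  RInt (V := C_R_CompleteNormedModule) (arc_integrand gamma g) a b.

(** [f] is the exterior Riemann map together with its Caratheodory extension to
    the curve; the values of [f] inside the curve are unconstrained. *)
Record exterior_riemann_map (gamma : R -> C) (a b : R) (f : C -> C) : Prop := {
  erm_analytic : forall z, outer gamma a b z ->
    ex_derive (K := C_AbsRing) (V := C_NormedModule) f z;
  erm_bij : bij_between (outer gamma a b) (fun w => 1 < Cmod w) f;
  erm_infty : filterlim f C_infty C_infty;
  erm_derive_infty : exists alpha : R, 0 < alpha /\
    filterlim (C_derive f) C_infty (locally (T := C_UniformSpace) (RtoC alpha));
  erm_continuous :
    continuous_on (T := C_UniformSpace) (U := C_UniformSpace)
      (fun z => outer gamma a b z \/ curve gamma a b z) f;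
  erm_boundary : bij_between (curve gamma a b) (fun w => Cmod w = 1) f
}.

(** [g z] is the sum of the [c k * z^k] and the [c' k * z^(-(k+1))], [k >= 0]. *)
Definition laurent_outside (R0 : R) (g : C -> C) (c c' : nat -> C) : Prop :=
  forall z, R0 < Cmod z ->
    exists s s' : C,
      is_series (K := C_AbsRing) (V := C_NormedModule)
        (fun k => c k * z ^ k)%C s /\
      is_series (K := C_AbsRing) (V := C_NormedModule)
        (fun k => c' k * (/ z) ^ S k)%C s' /\
      g z = (s + s')%C.

(** The part of nonnegative powers is a polynomial of degree [m] because [f]
    has a simple pole at infinity; this is a property, not a requirement. *)
Definition faber_polynomial (gamma : R -> C) (a b : R) (f : C -> C) (m : nat)
    (p : C -> C) : Prop :=
  exists (R0 : R) (c c' : nat -> C),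
    0 < R0 /\
    (forall z, inner gamma a b z -> Cmod z < R0) /\
    laurent_outside R0 (fun z => f z ^ m)%C c c' /\
    forall z, is_series (K := C_AbsRing) (V := C_NormedModule)
      (fun k => c k * z ^ k)%C (p z).

(* Main.v *)
(** The outward normal is [-i gamma' / |gamma'|]: the winding number jumps by 1
    across the curve, and its sign is seen on the Cauchy kernel near the crossing
    point.  Hence the integrand is [f^m Im (dy / (y - z))].  As [|f| = 1] on the
    curve, [conj (f^m) = f^(-m)], and the statement reduces to two Cauchy
    integrals: that of [f^m] against [dy / (y - z)] is [2 pi i p(z)], that of
    [f^(-m)] vanishes.  After subtracting the entire function [p] from [f^m], both
    say that [H(f(y)) dy / (y - z)] integrates to 0 for [H] continuous on
    [|w| >= 1], holomorphic on [|w| > 1] and vanishing at infinity.  With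
    [psi = f^(-1)] and [K(w) = H(w) / (psi(w) - z)], this integral is up to sign the
    limit, as [d -> 0], of the integrals of
    [K(e^(it)) (psi(e^(i(t+d))) - psi(e^(it))) / d] over the circle; each of them
    is 0 by the mean value property at infinity, so no regularity of [psi] on the
    circle beyond continuity is needed. *)
Require Import Defs.
From Stdlib Require Import Reals Lra Lia Psatz Classical ClassicalEpsilon.
From Coquelicot Require Import Coquelicot.
Open Scope R_scope.

(** The obstacle is that [psi] is merely continuous on the unit circle, so [dy] cannot be written as
    [psi'] times [dw]. What rescues the argument is that the curve itself is piecewise smooth and
    that the circle runs through it monotonically: the parameter [T] of the curve, as a function of
    the angle, is monotone, so its increments telescope and control the error of the difference
    quotients. Differences under a fixed rotation are taken because [psi (cis d * w) - psi w] is
    again holomorphic outside the disc; divided by [psi w - z] it stays bounded at infinity, since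
    [f] grows linearly there, and the factor that vanishes at infinity does the rest. The complex
    analysis behind this is Goursat's theorem on rectangles carried over by the exponential, which
    makes circular means independent of the radius. The same means show that the injective map [f]
    has nonzero derivative, hence that [psi] is holomorphic. The function [p] enters as an entire
    power series, handled by its partial sums. Inside and outside are told apart by the winding
    integral, which is 0 outside and fixed inside by the orientation. *)

(** * Elementary facts on the modulus *)

Lemma Re_plus (x y : C) : Re (x + y)%C = Re x + Re y.
Proof. reflexivity. Qed.
Lemma Im_plus (x y : C) : Im (x + y)%C = Im x + Im y.
Proof. reflexivity. Qed.

Lemma Cmod_minus_sym (x y : C) : Cmod (x - y) = Cmod (y - x).
Proof. rewrite <- Cmod_opp. f_equal. ring. Qed.

Lemma Cmod_sub_triangle (x y z : C) : Cmod (x - z) <= Cmod (x - y) + Cmod (y - z).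
Proof. replace (x - z)%C with ((x - y) + (y - z))%C by ring. apply Cmod_triangle. Qed.

Lemma Cmod_le_add_sub (x y : C) : Cmod x <= Cmod y + Cmod (x - y).
Proof. replace x with (y + (x - y))%C at 1 by ring. apply Cmod_triangle. Qed.

Lemma im_le_Cmod (c : C) : Rabs (Im c) <= Cmod c.
Proof. eapply Rle_trans; [ | apply (Rmax_Cmod c)]. apply Rmax_r. Qed.

Lemma Cmod_le_parts (c : C) : Cmod c <= Rabs (Re c) + Rabs (Im c).
Proof.
  replace c with (RtoC (Re c) + RtoC (Im c) * Ci)%C at 1.
  - eapply Rle_trans; [apply Cmod_triangle |].
    rewrite Cmod_mult, Cmod_Ci, !Cmod_R. lra.
  - destruct c as [x y]; unfold Cplus, Cmult, Ci, RtoC, Re, Im; simpl; f_equal; ring.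
Qed.

Lemma Cminus_neq0 (x y : C) : x <> y -> (x - y)%C <> RtoC 0.
Proof. intros H H0. apply H. replace x with (x - y + y)%C by ring. rewrite H0. ring. Qed.

Lemma Cminus_eq0 (x y : C) : (x - y)%C = RtoC 0 -> x = y.
Proof. intro H0. replace x with (x - y + y)%C by ring. rewrite H0. ring. Qed.

Lemma Cmod_small_eq0 (x : C) : (forall e, 0 < e -> Cmod x <= e) -> x = RtoC 0.
Proof.
  intro H. apply Cmod_eq_0. apply Rle_antisym; [ | apply Cmod_ge_0].
  apply le_epsilon. intros e He. rewrite Rplus_0_l. auto.
Qed.

Lemma Cminus_diag (x : C) : (x - x)%C = RtoC 0.
Proof. ring. Qed.

Lemma locally_R_iff (x : R) (P : R -> Prop) :
  locally x P <-> exists d, 0 < d /\ forall y, Rabs (y - x) < d -> P y.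
Proof.
  split.
  - intros [d Hd]. exists d. split; [apply cond_pos | exact Hd].
  - intros [d [H0 H]]. exists (mkposreal d H0). exact H.
Qed.

(** * Limits and derivatives of complex-valued functions *)

(** Stated for an arbitrary filter, so that one set of limit rules serves points of the plane, real
    parameters, relative neighbourhoods and sequences. *)
Definition tends {T : Type} (F : (T -> Prop) -> Prop) (g : T -> C) (l : C) : Prop :=
  forall e : R, 0 < e -> F (fun x => Cmod (g x - l) < e).

(** Neighbourhoods measured by [Cmod]. The product structure of [C] measures by boxes instead;
    [locally_C_nb] identifies the two filters. *)
Definition nb (w : C) (P : C -> Prop) : Prop :=
  exists d : R, 0 < d /\ forall w', Cmod (w' - w) < d -> P w'.

Global Instance nb_filter (w : C) : ProperFilter (nb w).
Proof.
  constructor.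
  - intros P [d [Hd H]]. exists w. apply H.
    replace (w - w)%C with (RtoC 0) by ring. rewrite Cmod_0. exact Hd.
  - constructor.
    + exists 1. split; [lra | auto].
    + intros P Q [d [Hd H]] [d' [Hd' H']].
      exists (Rmin d d'). split; [apply Rmin_glb_lt; auto |].
      intros w' Hw. split; [apply H | apply H'];
        eapply Rlt_le_trans; eauto; [apply Rmin_l | apply Rmin_r].
    + intros P Q HPQ [d [Hd H]]. exists d; split; auto.
Qed.

Global Instance C_infty_filter : Filter C_infty.
Proof.
  constructor.
  - exists 0. auto.
  - intros P Q [M H] [N K]. exists (Rmax M N). intros z Hz. split.
    + apply H. eapply Rle_lt_trans; [apply Rmax_l | eauto].
    + apply K. eapply Rle_lt_trans; [apply Rmax_r | eauto].
  - intros P Q HPQ [M H]. exists M. auto.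
Qed.

Section Tends.
Context {T : Type} {F : (T -> Prop) -> Prop} {FF : Filter F}.

Lemma tends_ext (g h : T -> C) l : F (fun x => g x = h x) -> tends F g l -> tends F h l.
Proof.
  intros He H e Hpe. generalize (filter_and _ _ He (H e Hpe)). apply filter_imp.
  intros x [E K]. rewrite <- E. exact K.
Qed.

Lemma tends_eq (g : T -> C) l m : l = m -> tends F g l -> tends F g m.
Proof. now intros ->. Qed.

Lemma tends_const (c : C) : tends F (fun _ => c) c.
Proof.
  intros e He. apply filter_forall. intros x.
  replace (c - c)%C with (RtoC 0) by ring. rewrite Cmod_0. exact He.
Qed.

Lemma tends_plus (g h : T -> C) l m :
  tends F g l -> tends F h m -> tends F (fun x => g x + h x)%C (l + m)%C.
Proof.
  intros Hg Hh e He. assert (He2 : 0 < e / 2) by lra.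
  generalize (filter_and _ _ (Hg _ He2) (Hh _ He2)).
  apply filter_imp. intros x [A B].
  replace (g x + h x - (l + m))%C with ((g x - l) + (h x - m))%C by ring.
  eapply Rle_lt_trans; [apply Cmod_triangle | lra].
Qed.

Lemma tends_mult (g h : T -> C) l m :
  tends F g l -> tends F h m -> tends F (fun x => g x * h x)%C (l * m)%C.
Proof.
  intros Hg Hh e He.
  set (B := Cmod l + Cmod m + 2).
  assert (HB : 2 <= B) by (unfold B; generalize (Cmod_ge_0 l) (Cmod_ge_0 m); lra).
  assert (Hd : 0 < Rmin 1 (e / (2 * B))).
  { apply Rmin_glb_lt; [lra |]. apply Rdiv_lt_0_compat; lra. }
  generalize (filter_and _ _ (Hg _ Hd) (Hh _ Hd)).
  apply filter_imp. intros x [A A'].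
  assert (A1 := Rlt_le_trans _ _ _ A (Rmin_l _ _)).
  assert (A2 := Rlt_le_trans _ _ _ A (Rmin_r _ _)).
  assert (A3 := Rlt_le_trans _ _ _ A' (Rmin_r _ _)).
  replace (g x * h x - l * m)%C with (g x * (h x - m) + (g x - l) * m)%C by ring.
  eapply Rle_lt_trans; [apply Cmod_triangle |]. rewrite !Cmod_mult.
  assert (Hgx : Cmod (g x) <= B).
  { generalize (Cmod_le_add_sub (g x) l). unfold B. generalize (Cmod_ge_0 m); lra. }
  assert (Hm : Cmod m <= B) by (unfold B; generalize (Cmod_ge_0 l); lra).
  assert (E : e = B * (e / (2 * B)) + (e / (2 * B)) * B) by (field; lra).
  set (d := e / (2 * B)) in *.
  apply Rle_lt_trans with (B * Cmod (h x - m) + Cmod (g x - l) * B).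
  - apply Rplus_le_compat.
    + apply Rmult_le_compat_r; [apply Cmod_ge_0 | auto].
    + apply Rmult_le_compat_l; [apply Cmod_ge_0 | auto].
  - rewrite E. apply Rplus_lt_compat.
    + apply Rmult_lt_compat_l; lra.
    + apply Rmult_lt_compat_r; lra.
Qed.

Lemma tends_opp (g : T -> C) l : tends F g l -> tends F (fun x => - g x)%C (- l)%C.
Proof.
  intros H e He. generalize (H e He). apply filter_imp. intros x.
  replace (- g x - - l)%C with (- (g x - l))%C by ring. rewrite Cmod_opp. auto.
Qed.

Lemma tends_minus (g h : T -> C) l m :
  tends F g l -> tends F h m -> tends F (fun x => g x - h x)%C (l - m)%C.
Proof. intros Hg Hh. apply (tends_plus _ _ _ _ Hg (tends_opp _ _ Hh)). Qed.

Lemma tends_away (g : T -> C) l : tends F g l -> l <> RtoC 0 ->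
  F (fun x => Cmod l / 2 < Cmod (g x)).
Proof.
  intros H Hl. apply Cmod_gt_0 in Hl. assert (Hl2 : 0 < Cmod l / 2) by lra.
  generalize (H _ Hl2). apply filter_imp. intros x Hx.
  generalize (Cmod_le_add_sub l (g x)). rewrite (Cmod_minus_sym l). lra.
Qed.

Lemma tends_inv (g : T -> C) l : l <> RtoC 0 -> tends F g l -> tends F (fun x => / g x)%C (/ l)%C.
Proof.
  intros Hl H e He. assert (Hl' := proj1 (Cmod_gt_0 l) Hl).
  set (m := Cmod l) in *.
  assert (Hd : 0 < e * (m * m / 2)) by (repeat apply Rmult_lt_0_compat; lra).
  generalize (filter_and _ _ (tends_away _ _ H Hl) (H _ Hd)). apply filter_imp.
  fold m. intros x [A B].
  assert (Hg : g x <> RtoC 0) by (apply Cmod_gt_0; lra).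
  replace (/ g x - / l)%C with ((l - g x) / (g x * l))%C by (field; auto).
  rewrite Cmod_div by (apply Cmult_neq_0; auto). rewrite Cmod_mult, Cmod_minus_sym. fold m.
  assert (0 < Cmod (g x) * m) by (apply Rmult_lt_0_compat; lra).
  apply Rlt_div_l; auto.
  eapply Rlt_le_trans; [apply B |]. apply Rmult_le_compat_l; [lra |].
  nra.
Qed.

Lemma tends_div (g h : T -> C) l m : m <> RtoC 0 ->
  tends F g l -> tends F h m -> tends F (fun x => g x / h x)%C (l / m)%C.
Proof. intros Hm Hg Hh. apply tends_mult; auto. apply tends_inv; auto. Qed.

Lemma tends_pow (g : T -> C) l n : tends F g l -> tends F (fun x => g x ^ n)%C (l ^ n)%C.
Proof. intro H. induction n; simpl. apply tends_const. apply tends_mult; auto. Qed.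

Lemma tends_comp_C (phi : T -> C) (g : C -> C) w l :
  tends F phi w -> tends (nb w) g l -> tends F (fun x => g (phi x)) l.
Proof.
  intros Hp H e He. destruct (H e He) as [d [Hd K]].
  generalize (Hp d Hd). apply filter_imp. intros x; apply K.
Qed.

(** The map [f] and its inverse are continuous only relative to closed sets beyond which their
    values are arbitrary, so the inner function has to stay in such a set. *)
Lemma tends_comp_within (E : C -> Prop) (phi : T -> C) (g : C -> C) w l :
  F (fun x => E (phi x)) ->
  tends F phi w -> tends (within E (nb w)) g l -> tends F (fun x => g (phi x)) l.
Proof.
  intros HE Hp H e He. destruct (H e He) as [d [Hd K]].
  generalize (filter_and _ _ HE (Hp d Hd)). apply filter_imp. intros x [A B]; auto.
Qed.

Lemma tends_le_filter {G : (T -> Prop) -> Prop} (g : T -> C) l :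
  filter_le G F -> tends F g l -> tends G g l.
Proof. intros Hl H e He. apply Hl, H, He. Qed.

Lemma tends_norm_le (g : T -> C) l B : ProperFilter F ->
  F (fun x => Cmod (g x) <= B) -> tends F g l -> Cmod l <= B.
Proof.
  intros PF HB H. apply Rnot_lt_le. intro K.
  assert (HlB : 0 < Cmod l - B) by lra.
  generalize (filter_and _ _ HB (H _ HlB)). intros A.
  destruct (filter_ex _ A) as [x [A1 A2]].
  generalize (Cmod_le_add_sub l (g x)). rewrite (Cmod_minus_sym l). lra.
Qed.
End Tends.

Lemma tends_id (w : C) : tends (nb w) (fun x => x) w.
Proof. intros e He. exists e; split; auto. Qed.

Lemma nb_within (E : C -> Prop) w : filter_le (within E (nb w)) (nb w).
Proof. intros P. apply filter_le_within. Qed.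

Lemma tends_RtoC (t : R) : tends (locally t) RtoC (RtoC t).
Proof.
  intros e He. exists (mkposreal e He). intros y Hy.
  rewrite <- RtoC_minus, Cmod_R. exact Hy.
Qed.

Lemma tends_continuous (G : R -> C) (t : R) :
  tends (locally t) G (G t) -> continuous (U := C_R_NormedModule) G t.
Proof.
  intros H P [e He]. unfold filtermap. generalize (H e (cond_pos e)).
  apply filter_imp. intros x Hx. apply He.
  split; simpl; unfold ball, AbsRing_ball; simpl; unfold abs, minus, plus, opp; simpl.
  - eapply Rle_lt_trans; [ | apply Hx]. apply (re_le_Cmod (G x - G t)).
  - eapply Rle_lt_trans; [ | apply Hx]. apply (im_le_Cmod (G x - G t)).
Qed.

Lemma locally_C_nb (w : C) (P : C -> Prop) : locally (T := C_UniformSpace) w P <-> nb w P.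
Proof.
  split.
  - intros [e He]. exists e. split; [apply cond_pos |]. intros w' Hw. apply He.
    split; simpl; unfold ball, AbsRing_ball; simpl; unfold abs, minus, plus, opp; simpl.
    + eapply Rle_lt_trans; [ | apply Hw]. apply (re_le_Cmod (w' - w)).
    + eapply Rle_lt_trans; [ | apply Hw]. apply (im_le_Cmod (w' - w)).
  - intros [d [Hd H]]. assert (Hd2 : 0 < d / 2) by lra. exists (mkposreal _ Hd2). intros w' [A B].
    unfold ball in A, B; simpl in A, B; unfold AbsRing_ball, abs, minus, plus, opp in A, B;
    simpl in A, B.
    apply H. eapply Rle_lt_trans; [apply Cmod_le_parts |].
    unfold Re, Im; simpl. unfold Rminus in *. lra.
Qed.

Lemma filterlim_tends {T} (F : (T -> Prop) -> Prop) (g : T -> C) l : Filter F ->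
  filterlim g F (locally (T := C_UniformSpace) l) -> tends F g l.
Proof.
  intros FF H e He. apply (H (fun z => Cmod (z - l) < e)). apply locally_C_nb.
  exists e; auto.
Qed.

Lemma continuous_on_tends (E : C -> Prop) (f : C -> C) w :
  continuous_on (T := C_UniformSpace) (U := C_UniformSpace) E f -> E w ->
  tends (within E (nb w)) f (f w).
Proof.
  intros H HE. specialize (H w HE). apply filterlim_tends in H; [ | typeclasses eauto].
  intros e He. generalize (H e He). unfold within. apply locally_C_nb.
Qed.

Lemma continuous_on_tends_R (E : R -> Prop) (f : R -> C) w :
  continuous_on (U := C_UniformSpace) E f -> E w ->
  tends (within E (locally w)) f (f w).
Proof. intros H HE. specialize (H w HE). apply filterlim_tends in H; [ exact H | typeclasses eauto]. Qed.

(** Caratheodory's form of differentiability: the difference quotient extends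
    continuously to the point. *)
Definition cder (u : C -> C) (w A : C) : Prop :=
  exists q : C -> C, tends (nb w) q A /\
    nb w (fun w' => u w' - u w = q w' * (w' - w))%C.

Definition rder (G : R -> C) (t : R) (A : C) : Prop :=
  exists q : R -> C, tends (locally t) q A /\
    locally t (fun s => G s - G t = q s * RtoC (s - t))%C.

Lemma cder_tends u w A : cder u w A -> tends (nb w) u (u w).
Proof.
  intros [q [Hq E]].
  apply tends_ext with (fun w' => u w + q w' * (w' - w))%C.
  - revert E. apply filter_imp. intros x E. rewrite <- E. ring.
  - apply tends_eq with (u w + A * (w - w))%C; [ring |].
    apply tends_plus; [apply tends_const |]. apply tends_mult; auto.
    apply tends_minus; [apply tends_id | apply tends_const].
Qed.

Lemma rder_tends u w A : rder u w A -> tends (locally w) u (u w).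
Proof.
  intros [q [Hq E]].
  apply tends_ext with (fun w' => u w + q w' * (RtoC (w' - w)))%C.
  - revert E. apply filter_imp. intros x E. rewrite <- E. ring.
  - apply tends_eq with (u w + A * (RtoC w - RtoC w))%C; [ring |].
    apply tends_plus; [apply tends_const |]. apply tends_mult; auto.
    apply tends_ext with (fun s => RtoC s - RtoC w)%C.
    { apply filter_forall. intros. now rewrite RtoC_minus. }
    apply tends_minus; [apply tends_RtoC | apply tends_const].
Qed.

Lemma cder_const (c w : C) : cder (fun _ => c) w 0.
Proof. exists (fun _ => RtoC 0). split. apply tends_const. apply filter_forall. intros; ring. Qed.

Lemma cder_id (w : C) : cder (fun x => x) w 1.
Proof. exists (fun _ => RtoC 1). split. apply tends_const. apply filter_forall. intros; ring. Qed.

Lemma cder_plus u v w A B : cder u w A -> cder v w B -> cder (fun x => u x + v x)%C w (A + B)%C.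
Proof.
  intros [q [Hq E]] [r [Hr K]]. exists (fun x => q x + r x)%C. split.
  - apply tends_plus; auto.
  - generalize (filter_and _ _ E K). apply filter_imp. intros x [E1 E2].
    transitivity ((u x - u w) + (v x - v w))%C; [ring | rewrite E1, E2; ring].
Qed.

Lemma cder_mult u v w A B : cder u w A -> cder v w B ->
  cder (fun x => u x * v x)%C w (A * v w + u w * B)%C.
Proof.
  intros Hu [r [Hr K]]. assert (Hut := cder_tends _ _ _ Hu).
  destruct Hu as [q [Hq E]]. exists (fun x => q x * v w + u x * r x)%C. split.
  - apply tends_plus; apply tends_mult; auto. apply tends_const.
  - generalize (filter_and _ _ E K). apply filter_imp. intros x [E1 E2].
    transitivity (u x * (v x - v w) + (u x - u w) * v w)%C; [ring | rewrite E1, E2; ring].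
Qed.

Lemma cder_opp u w A : cder u w A -> cder (fun x => - u x)%C w (- A)%C.
Proof.
  intros [q [Hq E]]. exists (fun x => - q x)%C. split. apply tends_opp; auto.
  revert E. apply filter_imp. intros x E. transitivity (- (u x - u w))%C; [ring | rewrite E; ring].
Qed.

Lemma cder_minus u v w A B : cder u w A -> cder v w B -> cder (fun x => u x - v x)%C w (A - B)%C.
Proof. intros Hu Hv. apply (cder_plus _ _ _ _ _ Hu (cder_opp _ _ _ Hv)). Qed.

Lemma cder_inv u w A : u w <> RtoC 0 -> cder u w A ->
  cder (fun x => / u x)%C w (- A / (u w * u w))%C.
Proof.
  intros Hn Hu. assert (Hut := cder_tends _ _ _ Hu). destruct Hu as [q [Hq E]].
  exists (fun x => - q x / (u x * u w))%C. split.
  - apply tends_div; [apply Cmult_neq_0; auto | apply tends_opp; auto |].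
    apply tends_mult; auto. apply tends_const.
  - generalize (filter_and _ _ E (tends_away _ _ Hut Hn)). apply filter_imp. intros x [E1 E2].
    assert (u x <> RtoC 0).
    { apply Cmod_gt_0. generalize (Cmod_ge_0 (u w)). lra. }
    transitivity (- (u x - u w) / (u x * u w))%C; [field; auto | rewrite E1; field; auto].
Qed.

Lemma cder_comp u v w A B : cder u w A -> cder v (u w) B -> cder (fun x => v (u x)) w (B * A)%C.
Proof.
  intros Hu [r [Hr K]]. assert (Hut := cder_tends _ _ _ Hu).
  destruct Hu as [q [Hq E]]. exists (fun x => r (u x) * q x)%C. split.
  - apply tends_mult; auto. apply tends_comp_C with (u w); auto.
  - destruct K as [d [Hd K]].
    generalize (filter_and _ _ E (Hut d Hd)). apply filter_imp. intros x [E1 E2].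
    rewrite K by auto. rewrite E1. ring.
Qed.

Lemma rder_comp G v t A B : rder G t A -> cder v (G t) B -> rder (fun s => v (G s)) t (B * A)%C.
Proof.
  intros Hu [r [Hr K]]. assert (Hut := rder_tends _ _ _ Hu).
  destruct Hu as [q [Hq E]]. exists (fun x => r (G x) * q x)%C. split.
  - apply tends_mult; auto. apply tends_comp_C with (G t); auto.
  - destruct K as [d [Hd K]].
    generalize (filter_and _ _ E (Hut d Hd)). apply filter_imp. intros x [E1 E2].
    rewrite K by auto. rewrite E1. ring.
Qed.

Lemma rder_affine (c d : C) t : rder (fun s => c + RtoC s * d)%C t d.
Proof.
  exists (fun _ => d). split. apply tends_const.
  apply filter_forall. intros s. rewrite RtoC_minus. ring.
Qed.

Lemma rder_minus u v w A B : rder u w A -> rder v w B -> rder (fun x => u x - v x)%C w (A - B)%C.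
Proof.
  intros [q [Hq E]] [r [Hr K]]. exists (fun x => q x - r x)%C. split.
  - apply tends_minus; auto.
  - generalize (filter_and _ _ E K). apply filter_imp. intros x [E1 E2].
    transitivity ((u x - u w) - (v x - v w))%C; [ring | rewrite E1, E2; ring].
Qed.

Lemma cder_ext u v w A : nb w (fun x => u x = v x) -> u w = v w -> cder u w A -> cder v w A.
Proof.
  intros He Hw [q [Hq E]]. exists q. split; auto.
  generalize (filter_and _ _ He E). apply filter_imp. intros x [E1 E2].
  rewrite <- E1, <- Hw. auto.
Qed.

Lemma cder_eq u w A B : A = B -> cder u w A -> cder u w B.
Proof. now intros ->. Qed.

Lemma rder_eq u w A B : A = B -> rder u w A -> rder u w B.
Proof. now intros ->. Qed.

Lemma cder_pow u n w A : cder u w A -> exists B, cder (fun x => u x ^ n)%C w B.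
Proof.
  intro H. induction n as [ | n [B IH]]; simpl.
  - eexists. apply cder_const.
  - eexists. apply (cder_mult _ _ _ _ _ H IH).
Qed.

(** Substituting [psi x] into the quotient form of [f] at [psi w] gives
    [x - w = q (psi x) * (psi x - psi w)], so [/ q (psi x)] is the difference quotient of [psi], and
    continuity of [psi] gives its limit. *)
Lemma cder_inverse (f psi : C -> C) w A :
  cder f (psi w) A -> A <> RtoC 0 -> tends (nb w) psi (psi w) ->
  nb w (fun x => f (psi x) = x) -> f (psi w) = w -> cder psi w (/ A)%C.
Proof.
  intros [q [Hq E]] HA Hpsi Hinv Hw.
  assert (Hqp := tends_comp_C _ _ _ _ Hpsi Hq).
  exists (fun x => / q (psi x))%C. split. apply tends_inv; auto.
  destruct E as [d [Hd E]].
  generalize (filter_and _ _ (filter_and _ _ Hinv (Hpsi d Hd)) (tends_away _ _ Hqp HA)).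
  apply filter_imp. intros x [[E1 E2] E3].
  assert (q (psi x) <> RtoC 0) by (apply Cmod_gt_0; generalize (Cmod_ge_0 A); lra).
  specialize (E _ E2). rewrite E1, Hw in E. rewrite E. field; auto.
Qed.

Lemma cder_domin u w A e : cder u w A -> 0 < e ->
  nb w (fun w' => Cmod (u w' - u w - A * (w' - w)) <= e * Cmod (w' - w)).
Proof.
  intros [q [Hq E]] He. generalize (filter_and _ _ E (Hq e He)). apply filter_imp.
  intros x [E1 E2]. rewrite E1.
  replace (q x * (x - w) - A * (x - w))%C with ((q x - A) * (x - w))%C by ring.
  rewrite Cmod_mult. apply Rmult_le_compat_r; [apply Cmod_ge_0 | lra].
Qed.

Lemma cder_of_small (u : C -> C) z A :
  (forall e, 0 < e -> nb z (fun x => Cmod (u x - u z - A * (x - z)) <= e * Cmod (x - z))) ->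
  cder u z A.
Proof.
  intro H.
  exists (fun x => match excluded_middle_informative (x = z) with
           | left _ => A | right _ => (u x - u z) / (x - z) end)%C. split.
  - intros e He. assert (He2 : 0 < e / 2) by lra.
    generalize (H _ He2). apply filter_imp. intros x Hx.
    destruct excluded_middle_informative as [-> | Hn].
    + now rewrite Cminus_diag, Cmod_0.
    + assert (Hz := Cminus_neq0 _ _ Hn).
      replace ((u x - u z) / (x - z) - A)%C with ((u x - u z - A * (x - z)) / (x - z))%C
        by (field; auto).
      rewrite Cmod_div by auto. apply Cmod_gt_0 in Hz.
      apply Rlt_div_l; auto. nra.
  - apply filter_forall. intros x. destruct excluded_middle_informative as [-> | Hn].
    + ring.
    + field. now apply Cminus_neq0.
Qed.

Lemma rder_of_small (G : R -> C) (t : R) (A : C) :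
  (forall e, 0 < e -> locally t (fun s => Cmod (G s - G t - RtoC (s - t) * A) <= e * Rabs (s - t))) ->
  rder G t A.
Proof.
  intro H.
  exists (fun s => match Req_dec_T s t with
           | left _ => A | right _ => (G s - G t) / RtoC (s - t) end)%C.
  assert (Hz : forall s : R, s <> t -> RtoC (s - t) <> RtoC 0).
  { intros s Hn K. apply RtoC_inj in K. lra. }
  split.
  - intros e He. assert (He2 : 0 < e / 2) by lra.
    generalize (H _ He2). apply filter_imp. intros s Hx.
    destruct Req_dec_T as [-> | Hn].
    + now rewrite Cminus_diag, Cmod_0.
    + replace ((G s - G t) / RtoC (s - t) - A)%C with
        ((G s - G t - RtoC (s - t) * A) / RtoC (s - t))%C by (field; auto).
      rewrite Cmod_div, Cmod_R by auto.
      assert (0 < Rabs (s - t)) by (apply Rabs_pos_lt; lra).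
      apply Rlt_div_l; auto. nra.
  - apply filter_forall. intros s. destruct Req_dec_T as [-> | Hn].
    + rewrite Rminus_diag. ring.
    + field. auto.
Qed.

Lemma is_derive_cder (f : C -> C) (z l : C) :
  is_derive (K := C_AbsRing) (V := C_NormedModule) f z l -> cder f z l.
Proof.
  intros [_ H]. specialize (H z (fun P HP => HP)). apply cder_of_small. intros e He.
  specialize (H (mkposreal _ He)).
  change (locally z) with (@locally (AbsRing_UniformSpace C_AbsRing) z) in H.
  destruct H as [d Hd]. exists d. split; [apply cond_pos |].
  intros w Hw. rewrite (Cmult_comm l). exact (Hd w Hw).
Qed.

Lemma minus_scal_C (x y l : C) (s t : R) :
  minus (minus x y) (scal (V := C_R_NormedModule) (minus s t) l) = (x - y - RtoC (s - t) * l)%C.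
Proof.
  unfold minus, plus, opp, scal; simpl. unfold prod_plus, prod_opp, prod_scal; simpl.
  unfold plus, opp, scal, mult; simpl. unfold mult; simpl.
  unfold Cminus, Cplus, Copp, Cmult, RtoC; simpl. f_equal; ring.
Qed.

Lemma is_derive_rder (G : R -> C) (t : R) (l : C) :
  is_derive (V := C_R_NormedModule) G t l -> rder G t l.
Proof.
  intros [_ H]. specialize (H t (fun P HP => HP)). apply rder_of_small. intros e He.
  generalize (H (mkposreal _ He)). apply filter_imp. intros s Hs.
  rewrite <- minus_scal_C, Cmod_norm. exact Hs.
Qed.

Lemma rder_is_derive_lin (G : R -> C) t A (c : C) : rder G t A ->
  is_derive (fun s => Re (c * G s)%C) t (Re (c * A)%C).
Proof.
  intros [q [Hq E]]. apply is_derive_Reals. intros e He.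
  set (m := Cmod c + 1). assert (Hm : 0 < m) by (unfold m; generalize (Cmod_ge_0 c); lra).
  assert (Hem : 0 < e / m) by (apply Rdiv_lt_0_compat; auto).
  destruct (filter_and _ _ E (Hq _ Hem)) as [d Hd].
  exists d. intros h Hh Hhd.
  assert (B : ball t d (t + h)).
  { change (Rabs (t + h - t) < d). replace (t + h - t) with h by ring. auto. }
  destruct (Hd _ B) as [E1 E2].
  replace (t + h - t) with h in E1 by ring.
  replace ((Re (c * G (t + h)%R) - Re (c * G t)) / h - Re (c * A)) with
    (Re (c * (q (t + h)%R - A))%C).
  - eapply Rle_lt_trans; [apply re_le_Cmod |]. rewrite Cmod_mult.
    apply Rle_lt_trans with (m * Cmod (q (t + h)%R - A)).
    + apply Rmult_le_compat_r; [apply Cmod_ge_0 | unfold m; lra].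
    + replace e with (m * (e / m)) by (field; lra). now apply Rmult_lt_compat_l.
  - replace (Re (c * G (t + h)%R) - Re (c * G t)) with (Re (c * (G (t + h)%R - G t))%C).
    + rewrite E1. unfold Re, Cmult, Cminus, Cplus, Copp, RtoC; simpl. field; auto.
    + unfold Re, Cmult, Cminus, Cplus, Copp, RtoC; simpl. ring.
Qed.

Lemma rder_Re (G : R -> C) t A : rder G t A -> is_derive (fun s => Re (G s)) t (Re A).
Proof.
  intro H. generalize (rder_is_derive_lin G t A 1 H). intro K.
  replace (Re A) with (Re (1 * A)%C) by (f_equal; ring).
  eapply is_derive_ext; [ | apply K]. intros s. cbv beta. now rewrite Cmult_1_l.
Qed.

Lemma rder_Im (G : R -> C) t A : rder G t A -> is_derive (fun s => Im (G s)) t (Im A).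
Proof.
  intro H. generalize (rder_is_derive_lin G t A (- Ci) H). intro K.
  replace (Im A) with (Re (- Ci * A)%C)
    by (destruct A; unfold Re, Im, Ci, Cmult, Copp; simpl; ring).
  eapply is_derive_ext; [ | apply K]. intros s; simpl.
  destruct (G s); unfold Re, Im, Ci, Cmult, Copp; simpl; ring.
Qed.

(** * Functions on a closed interval and the mean value inequality *)

(** Composing with [clamp a b] extends a function on the interval by its end values, so that results
    about two-sided continuity apply to functions continuous on the closed interval only. *)
Definition clamp (a b t : R) : R := Rmax a (Rmin b t).

Lemma clamp_in a b t : a <= b -> a <= clamp a b t <= b.
Proof.
  intro H. unfold clamp. split; [apply Rmax_l |].
  apply Rmax_lub; auto. apply Rmin_l.
Qed.

Lemma clamp_id a b t : a <= t <= b -> clamp a b t = t.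
Proof. intros [H K]. unfold clamp. rewrite Rmin_right, Rmax_right; auto. Qed.

Lemma clamp_lip a b s t : Rabs (clamp a b s - clamp a b t) <= Rabs (s - t).
Proof.
  unfold clamp, Rmax, Rmin.
  repeat destruct Rle_dec; unfold Rabs; repeat destruct Rcase_abs; lra.
Qed.

Lemma tends_clamp (G : R -> C) a b t : a <= b ->
  (forall s, a <= s <= b -> tends (within (fun x => a <= x <= b) (locally s)) G (G s)) ->
  tends (locally t) (fun s => G (clamp a b s)) (G (clamp a b t)).
Proof.
  intros Hab H e He. destruct (H (clamp a b t) (clamp_in _ _ _ Hab) e He) as [d Hd].
  exists d. intros s Hs. apply Hd; [ | now apply clamp_in].
  eapply Rle_lt_trans; [apply clamp_lip | exact Hs].
Qed.

Lemma clamp_near a b t : a < t < b -> locally t (fun s => clamp a b s = s).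
Proof.
  intros [H K]. apply locally_R_iff. exists (Rmin (t - a) (b - t)).
  split; [apply Rmin_glb_lt; lra |]. intros s Hs. apply clamp_id.
  generalize (Rmin_l (t - a) (b - t)) (Rmin_r (t - a) (b - t)).
  apply Rabs_lt_between in Hs. lra.
Qed.

Lemma rder_ext u v t A : locally t (fun x => u x = v x) -> rder u t A -> rder v t A.
Proof.
  intros He [q [Hq E]]. exists q. split; auto.
  assert (Hw := locally_singleton _ _ He). simpl in Hw.
  generalize (filter_and _ _ He E). apply filter_imp. intros x [E1 E2].
  rewrite <- E1, <- Hw. auto.
Qed.

Lemma tends_Re_continuity (G : R -> C) t c :
  tends (locally t) G (G t) -> continuity_pt (fun s => Re (c * G s)%C) t.
Proof.
  intro H. apply continuity_pt_filterlim. intros P [e He].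
  assert (K := tends_mult _ _ _ _ (tends_const c) H e (cond_pos e)).
  unfold filtermap. revert K. apply filter_imp. intros s Hs. apply He.
  eapply Rle_lt_trans; [ | apply Hs]. eapply Rle_trans; [ | apply re_le_Cmod]. right. reflexivity.
Qed.

(** Projected onto the direction of the increment, this is the real mean value theorem. *)
Lemma rder_bound (G : R -> C) (B a b : R) : a <= b ->
  (forall s, a <= s <= b -> tends (within (fun x => a <= x <= b) (locally s)) G (G s)) ->
  (forall s, a < s < b -> exists A, rder G s A /\ Cmod A <= B) ->
  Cmod (G b - G a) <= B * (b - a).
Proof.
  intros Hab HG HD.
  destruct (Req_dec a b) as [<- | Hn].
  { replace (G a - G a)%C with (RtoC 0) by ring. rewrite Cmod_0. lra. }
  set (w := (G b - G a)%C). destruct (Ceq_dec w 0) as [-> | Hw].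
  { rewrite Cmod_0. destruct (HD ((a + b) / 2) ltac:(lra)) as [A [_ K]].
    apply Rmult_le_pos; [ | lra]. eapply Rle_trans; [apply Cmod_ge_0 | apply K]. }
  set (c := Cconj w).
  destruct (choice (fun s A => (a < s < b -> rder G s A) /\ Cmod A <= B)) as [D HD'].
  { intros s. destruct (classic (a < s < b)) as [K | K].
    - destruct (HD s K) as [A HA]. exists A; tauto.
    - exists (RtoC 0). split; [tauto |]. rewrite Cmod_0.
      destruct (HD ((a + b) / 2) ltac:(lra)) as [A [_ K']].
      eapply Rle_trans; [apply Cmod_ge_0 | apply K']. }
  destruct (MVT_gen (fun s => Re (c * G (clamp a b s))%C) a b (fun s => Re (c * D s)%C))
    as [s [Hs E]].
  - rewrite Rmin_left, Rmax_right by lra. intros s Hs. apply rder_is_derive_lin.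
    apply rder_ext with G; [ | now apply HD'].
    generalize (clamp_near a b s Hs). apply filter_imp. now intros x ->.
  - intros s _. apply (tends_Re_continuity (fun s => G (clamp a b s))). now apply tends_clamp.
  - rewrite Rmin_left, Rmax_right in Hs by lra. rewrite !clamp_id in E by lra.
    assert (E' : Re (c * G b)%C - Re (c * G a)%C = (Cmod w) ^ 2).
    { unfold c, w. rewrite Cmod2_alt. unfold Re, Im, Cconj, Cmult, Cminus, Cplus, Copp; simpl. ring. }
    rewrite E' in E.
    assert (HDs := proj2 (HD' s)).
    assert (Hle : Re (c * D s)%C <= Cmod w * B).
    { eapply Rle_trans; [apply Rle_abs |]. eapply Rle_trans; [apply re_le_Cmod |].
      rewrite Cmod_mult. unfold c. rewrite Cmod_conj.
      apply Rmult_le_compat_l; [apply Cmod_ge_0 | auto]. }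
    apply Cmod_gt_0 in Hw.
    assert (Cmod w * Cmod w <= Cmod w * (B * (b - a))).
    { replace (Cmod w * Cmod w) with (Cmod w ^ 2) by ring. rewrite E.
      rewrite <- Rmult_assoc. apply Rmult_le_compat_r; lra. }
    now apply Rmult_le_reg_l in H.
Qed.

(** * Integrals of complex-valued functions *)

Notation isI := (is_RInt (V := C_R_NormedModule)).
Notation exI := (ex_RInt (V := C_R_NormedModule)).

Lemma isI_parts G a b l :
  isI G a b l <-> is_RInt (fun t => Re (G t)) a b (Re l) /\ is_RInt (fun t => Im (G t)) a b (Im l).
Proof.
  split.
  - intro H. split.
    + apply (is_RInt_fct_extend_fst (U := R_NormedModule) (V := R_NormedModule) G a b l H).
    + apply (is_RInt_fct_extend_snd (U := R_NormedModule) (V := R_NormedModule) G a b l H).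
  - intros [H K]. destruct l as [x y].
    apply (is_RInt_fct_extend_pair (U := R_NormedModule) (V := R_NormedModule) G a b x y H K).
Qed.

Lemma isI_eq (G : R -> C) a b (l m : C) : l = m -> isI G a b l -> isI G a b m.
Proof. now intros ->. Qed.

Lemma isI_ext (G H : R -> C) a b (l : C) : a <= b -> (forall t, a < t < b -> G t = H t) -> isI G a b l -> isI H a b l.
Proof.
  intros Hab E. apply is_RInt_ext. rewrite Rmin_left, Rmax_right; auto.
Qed.

Lemma isI_unique (G : R -> C) a b (l m : C) : isI G a b l -> isI G a b m -> l = m.
Proof.
  intros H K. apply (is_RInt_unique (V := C_R_CompleteNormedModule)) in H.
  apply (is_RInt_unique (V := C_R_CompleteNormedModule)) in K. congruence.
Qed.

Lemma isI_plus G H a b l m :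
  isI G a b l -> isI H a b m -> isI (fun t => G t + H t)%C a b (l + m)%C.
Proof. intros A B. exact (is_RInt_plus _ _ _ _ _ _ A B). Qed.

Lemma isI_minus G H a b l m :
  isI G a b l -> isI H a b m -> isI (fun t => G t - H t)%C a b (l - m)%C.
Proof. intros A B. exact (is_RInt_minus _ _ _ _ _ _ A B). Qed.

(** The module underlying these integrals has real scalars, so a complex factor has to be treated
    through real and imaginary parts. *)
Lemma isI_scal c G a b l : isI G a b l -> isI (fun t => c * G t)%C a b (c * l)%C.
Proof.
  intros H. apply isI_parts in H. destruct H as [H K]. apply isI_parts. split.
  - exact (is_RInt_minus _ _ _ _ _ _ (is_RInt_scal _ _ _ (Re c) _ H) (is_RInt_scal _ _ _ (Im c) _ K)).
  - exact (is_RInt_plus _ _ _ _ _ _ (is_RInt_scal _ _ _ (Re c) _ K) (is_RInt_scal _ _ _ (Im c) _ H)).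
Qed.

Lemma isI_conj G a b l : isI G a b l -> isI (fun t => Cconj (G t)) a b (Cconj l).
Proof.
  intros H. apply isI_parts in H. destruct H as [H K]. apply isI_parts. split.
  - exact H.
  - exact (is_RInt_opp _ _ _ _ K).
Qed.

Lemma isI_const (c : C) a b : isI (fun _ => c) a b (RtoC (b - a) * c)%C.
Proof.
  apply isI_parts. split.
  - replace (Re (RtoC (b - a) * c)) with (scal (b - a) (Re c));
      [exact (is_RInt_const (V := R_NormedModule) a b (Re c)) |].
    unfold scal; simpl; unfold mult, Re, Cmult, RtoC; simpl; ring.
  - replace (Im (RtoC (b - a) * c)) with (scal (b - a) (Im c));
      [exact (is_RInt_const (V := R_NormedModule) a b (Im c)) |].
    unfold scal; simpl; unfold mult, Im, Cmult, RtoC; simpl; ring.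
Qed.

Lemma isI_Chasles G a b c l m : isI G a b l -> isI G b c m -> isI G a c (l + m)%C.
Proof. intros A B. exact (is_RInt_Chasles _ _ _ _ _ _ A B). Qed.

Lemma isI_swap G a b l : isI G a b l -> isI G b a (- l)%C.
Proof. intros A. exact (is_RInt_swap _ _ _ _ A). Qed.

Lemma isI_point G a : isI G a a (RtoC 0).
Proof. exact (is_RInt_point G a). Qed.

Lemma isI_shift G v a b l : isI G (a + v) (b + v) l -> isI (fun t => G (t + v)) a b l.
Proof.
  intro H.
  assert (K := is_RInt_comp_lin (V := C_R_NormedModule) G 1 v a b l).
  replace (1 * a + v) with (a + v) in K by ring.
  replace (1 * b + v) with (b + v) in K by ring. specialize (K H).
  eapply is_RInt_ext; [ | exact K]. intros x _. simpl.
  replace (1 * x + v) with (x + v) by ring. exact (scal_one (V := C_R_NormedModule) (G (x + v))).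
Qed.

Lemma isI_norm G g a b l lg : a <= b -> (forall t, a <= t <= b -> Cmod (G t) <= g t) ->
  isI G a b l -> is_RInt g a b lg -> Cmod l <= lg.
Proof.
  intros Hab H HG Hg. rewrite Cmod_norm.
  apply (norm_RInt_le (V := C_R_NormedModule) G g a b); auto.
  intros t Ht. specialize (H t Ht). rewrite Cmod_norm in H. exact H.
Qed.

Lemma isI_norm_const G M a b l : a <= b -> (forall t, a <= t <= b -> Cmod (G t) <= M) ->
  isI G a b l -> Cmod l <= (b - a) * M.
Proof.
  intros Hab H HG. rewrite Cmod_norm.
  apply (norm_RInt_le_const (V := C_R_NormedModule) G a b); auto.
  intros t Ht. specialize (H t Ht). rewrite Cmod_norm in H. exact H.
Qed.

Lemma exI_continuous G a b : a <= b -> (forall t, a <= t <= b -> tends (locally t) G (G t)) -> exI G a b.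
Proof.
  intros Hab H. apply (ex_RInt_continuous (V := C_R_CompleteNormedModule)).
  rewrite Rmin_left, Rmax_right by auto. intros t Ht. apply tends_continuous; auto.
Qed.

Definition cts_on (a b : R) (G : R -> C) : Prop :=
  forall s, a <= s <= b -> tends (within (fun x => a <= x <= b) (locally s)) G (G s).

Lemma cts_on_sub G a b a' b' : a <= a' -> b' <= b -> cts_on a b G -> cts_on a' b' G.
Proof.
  intros Ha Hb H s Hs e He. generalize (H s ltac:(lra) e He).
  unfold within. apply filter_imp. intros x K Hx. apply K. lra.
Qed.

Lemma cts_on_join G a b c : a <= b <= c -> cts_on a b G -> cts_on b c G -> cts_on a c G.
Proof.
  intros Hb H K s Hs e He.
  assert (A : locally s (fun x => a <= x <= b -> Cmod (G x - G s) < e)).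
  { destruct (Rle_dec s b) as [A | A]; [now apply H |].
    apply locally_R_iff. exists (s - b). split; [lra |]. intros x Hx Hx'.
    apply Rabs_lt_between in Hx. lra. }
  assert (B : locally s (fun x => b <= x <= c -> Cmod (G x - G s) < e)).
  { destruct (Rle_dec b s) as [B | B]; [now apply K |].
    apply locally_R_iff. exists (b - s). split; [lra |]. intros x Hx Hx'.
    apply Rabs_lt_between in Hx. lra. }
  unfold within. generalize (filter_and _ _ A B). apply filter_imp. intros x [A1 B1] Hx.
  destruct (Rle_dec x b); [apply A1 | apply B1]; lra.
Qed.

Lemma exI_cts_on G a b : a <= b -> cts_on a b G -> exI G a b.
Proof.
  intros Hab H. destruct (exI_continuous (fun s => G (clamp a b s)) a b Hab) as [l Hl].
  - intros t _. exact (tends_clamp G a b t Hab H).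
  - exists l. apply isI_ext with (fun s => G (clamp a b s)); auto.
    intros t Ht. rewrite clamp_id; auto. lra.
Qed.

Lemma cts_on_bounded G a b : a <= b -> cts_on a b G -> exists M, forall t, a <= t <= b -> Cmod (G t) <= M.
Proof.
  intros Hab H. destruct (bounded_continuity (V := C_R_NormedModule) (fun s => G (clamp a b s)) a b) as [M HM].
  - intros t _. exact (tends_continuous (fun s => G (clamp a b s)) t (tends_clamp G a b t Hab H)).
  - exists M. intros t Ht. specialize (HM t Ht). rewrite clamp_id in HM by auto.
    rewrite Cmod_norm. now left.
Qed.

(** The derivative is given only at interior points. The integral of the clamped [D], minus [G], has
    zero derivative there and is continuous up to the ends, so [rder_bound] with bound 0 makes it
    constant. *)
Lemma isI_FTC G D a b : a <= b -> cts_on a b G -> cts_on a b D ->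
  (forall s, a < s < b -> rder G s (D s)) -> isI D a b (G b - G a)%C.
Proof.
  intros Hab HG HD HGD.
  set (D' := fun s => D (clamp a b s)).
  assert (HD' : forall t, continuous (U := C_R_NormedModule) D' t).
  { intros t. apply tends_continuous. exact (tends_clamp D a b t Hab HD). }
  set (I := fun x => (RInt (V := C_R_CompleteNormedModule) D' a x : C)).
  assert (HI : forall x, isI D' a x (I x)).
  { intros x. apply (RInt_correct (V := C_R_CompleteNormedModule)).
    apply (ex_RInt_continuous (V := C_R_CompleteNormedModule)). intros z _. apply HD'. }
  assert (HIr : forall x, rder I x (D' x)).
  { intros x. apply is_derive_rder. apply (is_derive_RInt D' I a x); [ | apply HD'].
    apply filter_forall. apply HI. }
  assert (E : Cmod ((I b - G b) - (I a - G a)) <= 0 * (b - a)).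
  { apply (rder_bound (fun x => I x - G x)%C); auto.
    - intros s Hs. apply tends_minus; [ | now apply HG].
      generalize (rder_tends _ _ _ (HIr s)). apply tends_le_filter. apply filter_le_within.
    - intros s Hs. exists (D' s - D s)%C. split.
      + apply rder_minus; auto.
      + unfold D'. rewrite clamp_id by lra. rewrite Cminus_diag, Cmod_0. lra. }
  rewrite Rmult_0_l in E.
  assert (E' := Cmod_eq_0 _ (Rle_antisym _ _ E (Cmod_ge_0 _))).
  assert (Ia : I a = RtoC 0) by apply (isI_unique _ _ _ _ _ (HI a) (isI_point D' a)).
  apply isI_ext with D'; auto.
  { intros t Ht. unfold D'. rewrite clamp_id; auto. lra. }
  apply isI_eq with (I b); auto.
  apply Cminus_eq0. rewrite <- E', Ia. ring.
Qed.

(** * Line integrals along a piecewise smooth curve *)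

(** Since [velocity] is built from the total function [Derive], it has a value even at corners; this
    predicate marks the parameters where that value is a genuine, nonzero, continuous derivative. *)
Definition regular (gamma : R -> C) (t : R) : Prop :=
  rder gamma t (velocity gamma t) /\ velocity gamma t <> RtoC 0 /\
  tends (locally t) (velocity gamma) (velocity gamma t).

Lemma velocity_eq gamma t d : rder gamma t d -> velocity gamma t = d.
Proof.
  intro H. unfold velocity. transitivity (Re d, Im d); [ | now destruct d].
  f_equal; apply is_derive_unique; [now apply rder_Re | now apply rder_Im].
Qed.

Lemma smooth_arc_spec gamma a b : smooth_arc gamma a b ->
  cts_on a b gamma /\
  exists d, cts_on a b d /\
    (forall t, a < t < b -> rder gamma t (d t) /\ velocity gamma t = d t) /\
    (forall t, a < t < b -> regular gamma t).
Proof.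
  intros [Hg [d [Hd [Hc Hn]]]]. split.
  { intros s Hs. apply (continuous_on_tends_R _ _ _ Hg Hs). }
  exists d.
  assert (Hr : forall t, a < t < b -> rder gamma t (d t) /\ velocity gamma t = d t).
  { intros t Ht. assert (K := is_derive_rder _ _ _ (Hd t Ht)). split; auto.
    now apply velocity_eq. }
  assert (Hdc : cts_on a b d) by (intros s Hs; apply (continuous_on_tends_R _ _ _ Hc Hs)).
  split; [exact Hdc |]. split; [exact Hr |].
  intros t Ht. destruct (Hr t Ht) as [A B]. split; [now rewrite B |]. split.
  - rewrite B. apply Hn. split; lra.
  - rewrite B. assert (E := clamp_near a b t Ht).
    apply tends_ext with (fun s => d (clamp a b s)).
    + assert (E' : locally t (fun s => a < s < b)).
      { apply (open_and (fun s => a < s) (fun s => s < b)); [apply open_gt | apply open_lt | exact Ht]. }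
      generalize (filter_and _ _ E E'). apply filter_imp. intros s [-> Hs].
      symmetry. now apply Hr.
    + replace (d t) with (d (clamp a b t)) by (rewrite clamp_id; auto; lra).
      apply (tends_clamp d); auto. lra.
Qed.

(** The interface to piecewise smoothness: the partition does not appear after this point. Corners
    are absorbed by [pf_ext], which compares integrands at regular parameters only, and by a bound
    that includes the default values of [velocity]. *)
Record path_facts (gamma : R -> C) (a b : R) : Prop := {
  pf_cts : cts_on a b gamma;
  pf_bound : exists L, forall t, a <= t <= b -> Cmod (velocity gamma t) <= L;
  pf_exI : forall phi, cts_on a b phi -> exI (fun t => phi t * velocity gamma t)%C a b;
  pf_ext : forall G H l, (forall t, a < t < b -> regular gamma t -> G t = H t) ->
    isI G a b l -> isI H a b l;
  pf_FTC : forall Q q x, a <= x <= b ->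
    (forall t, a <= t <= b -> cder Q (gamma t) (q (gamma t))) ->
    cts_on a b (fun t => q (gamma t)) ->
    isI (fun t => q (gamma t) * velocity gamma t)%C a x (Q (gamma x) - Q (gamma a))%C
}.

Lemma isI_split (G : R -> C) a b c (l : C) : a <= b <= c -> isI G a c l ->
  exists l1 l2 : C, isI G a b l1 /\ isI G b c l2 /\ l = (l1 + l2)%C.
Proof.
  intros Hb H. assert (E : exI G a c) by (exists l; auto).
  destruct (ex_RInt_Chasles_1 (V := C_R_CompleteNormedModule) G a b c Hb E) as [l1 H1].
  destruct (ex_RInt_Chasles_2 (V := C_R_CompleteNormedModule) G a b c Hb E) as [l2 H2].
  exists l1, l2. repeat split; auto.
  apply (isI_unique G a c); auto. eapply isI_Chasles; eauto.
Qed.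

Lemma piecewise_smooth_facts gamma a b : piecewise_smooth gamma a b -> path_facts gamma a b.
Proof.
  intros [n [t [Ha [Hb Hi]]]]. subst a b.
  assert (Hle : forall k, (k <= n)%nat -> t O <= t k).
  { induction k; intros Hk; [lra |]. destruct (Hi k ltac:(lia)) as [K _].
    specialize (IHk ltac:(lia)). lra. }
  assert (H : forall k, (k <= n)%nat -> path_facts gamma (t O) (t k)).
  2: { apply H; lia. }
  induction k as [ | k IH]; intros Hk.
  - assert (Hpt : forall phi : R -> C, cts_on (t O) (t O) phi).
    { intros phi s Hs e He. unfold within. apply filter_forall. intros x Hx.
      replace x with s by lra. now rewrite Cminus_diag, Cmod_0. }
    split; auto.
    + exists (Cmod (velocity gamma (t O))). intros s Hs. replace s with (t O) by lra. lra.
    + intros phi _. exists (RtoC 0). apply isI_point.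
    + intros G H l _ K. rewrite (isI_unique _ _ _ _ _ K (isI_point _ _)). apply isI_point.
    + intros Q q x Hx _ _. replace x with (t O) by lra.
      apply isI_eq with (RtoC 0); [ring | apply isI_point].
  - specialize (IH ltac:(lia)). destruct (Hi k ltac:(lia)) as [Hlt Hs].
    assert (H0k := Hle k ltac:(lia)).
    apply smooth_arc_spec in Hs. destruct Hs as [Hg [d [Hd [Hv Hr]]]].
    destruct IH as [C1 [L HL] C3 C4 C5].
    assert (Hcts : cts_on (t O) (t (S k)) gamma) by (apply cts_on_join with (t k); auto; lra).
    assert (HexI : forall phi, cts_on (t k) (t (S k)) phi ->
       exI (fun s => phi s * velocity gamma s)%C (t k) (t (S k))).
    { intros phi Hphi. destruct (exI_cts_on (fun s => phi s * d s)%C (t k) (t (S k))) as [l Hl].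
      - lra.
      - intros s Hs. apply tends_mult; auto.
      - exists l. apply isI_ext with (fun s => phi s * d s)%C; auto; [lra |].
        intros s Hs. destruct (Hv s Hs) as [_ ->]. reflexivity. }
    split; auto.
    + destruct (cts_on_bounded d (t k) (t (S k)) ltac:(lra) Hd) as [M HM].
      (* At the break point itself [velocity] may be unrelated to the one-sided derivatives, so its
         value there enters the bound separately. *)
      exists (Rmax (Rmax L M) (Cmod (velocity gamma (t (S k))))). intros s Hs.
      destruct (Rle_dec s (t k)) as [A | A].
      * eapply Rle_trans; [apply HL; lra |]. eapply Rle_trans; [apply Rmax_l |]. apply Rmax_l.
      * destruct (Req_dec s (t (S k))) as [-> | B]; [apply Rmax_r |].
        destruct (Hv s ltac:(lra)) as [_ ->].
        eapply Rle_trans; [apply HM; lra |]. eapply Rle_trans; [ | apply Rmax_l]. apply Rmax_r.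
    + intros phi Hphi. apply (ex_RInt_Chasles (V := C_R_NormedModule)) with (t k).
      * apply C3. eapply cts_on_sub; [ | | apply Hphi]; lra.
      * apply HexI. eapply cts_on_sub; [ | | apply Hphi]; lra.
    + intros G H l E K. assert (Hm : t O <= t k <= t (S k)) by lra.
      destruct (isI_split _ _ (t k) _ _ Hm K) as [l1 [l2 [K1 [K2 ->]]]].
      apply isI_Chasles with (t k).
      * apply C4 with G; auto. intros s Hs. apply E. lra.
      * apply isI_ext with G; auto; [lra |]. intros s Hs. apply E; auto. lra.
    + intros Q q x Hx HQ Hq. destruct (Rle_dec x (t k)) as [A | A].
      * apply C5; [lra | | ].
        -- intros s Hs. apply HQ. lra.
        -- eapply (cts_on_sub (fun s => q (gamma s))); [ | | apply Hq]; lra.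
      * apply isI_eq with ((Q (gamma (t k)) - Q (gamma (t O))) + (Q (gamma x) - Q (gamma (t k))))%C; [ring |].
        apply isI_Chasles with (t k).
        -- apply C5; [lra | | ].
          ++ intros s Hs. apply HQ. lra.
          ++ eapply (cts_on_sub (fun s => q (gamma s))); [ | | apply Hq]; lra.
        -- apply isI_ext with (fun s => q (gamma s) * d s)%C; [lra | | ].
          ++ intros s Hs. destruct (Hv s ltac:(lra)) as [_ ->]. reflexivity.
          ++ apply (isI_FTC (fun s => Q (gamma s))); [lra | | | ].
            ** intros s Hs. eapply tends_comp_C.
               --- eapply (cts_on_sub gamma (t k) (t (S k))); [ | | apply Hg | apply Hs]; lra.
               --- eapply cder_tends. apply HQ. lra.
            ** intros s Hs. apply (tends_mult (fun s => q (gamma s)) d).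
               --- eapply (cts_on_sub (fun s => q (gamma s)) (t O) (t (S k))); [ | | apply Hq | apply Hs]; lra.
               --- eapply (cts_on_sub d (t k) (t (S k))); [ | | apply Hd | apply Hs]; lra.
            ** intros s Hs. apply rder_comp; [apply Hv; lra | apply HQ; lra].
Qed.

(** * Goursat's theorem on rectangles *)

Definition CI (G : R -> C) (a b : R) : C := RInt (V := C_R_CompleteNormedModule) G a b.

Lemma CI_spec G a b : exI G a b -> isI G a b (CI G a b).
Proof. apply (RInt_correct (V := C_R_CompleteNormedModule)). Qed.

Lemma CI_eq G a b l : isI G a b l -> CI G a b = l.
Proof. apply (is_RInt_unique (V := C_R_CompleteNormedModule)). Qed.

Lemma nested_intervals (u l : nat -> R) :
  (forall n, 0 <= l n) -> (forall n, u n <= u (S n)) ->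
  (forall n, u (S n) + l (S n) <= u n + l n) ->
  exists X, forall n, u n <= X <= u n + l n.
Proof.
  intros Hl Hu Hd.
  assert (Hu' : forall n m, u n <= u (n + m)%nat).
  { intros n m. induction m; [rewrite Nat.add_0_r; lra |].
    replace (n + S m)%nat with (S (n + m)) by lia. specialize (Hu (n + m)%nat). lra. }
  assert (Hd' : forall n m, u (n + m)%nat + l (n + m)%nat <= u n + l n).
  { intros n m. induction m; [rewrite Nat.add_0_r; lra |].
    replace (n + S m)%nat with (S (n + m)) by lia. specialize (Hd (n + m)%nat). lra. }
  assert (Hx : forall n m, u m <= u n + l n).
  { intros n m. specialize (Hd' n m). specialize (Hu' m n). rewrite (Nat.add_comm m n) in Hu'.
    specialize (Hl (n + m)%nat). lra. }
  destruct (completeness (fun x => exists n, x = u n)) as [X [HX1 HX2]].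
  - exists (u O + l O). intros x [n ->]. apply Hx.
  - exists (u O). now exists O.
  - exists X. intro n. split; [apply HX1; now exists n |].
    apply HX2. intros x [m ->]. apply Hx.
Qed.

Lemma two_pow_pos n : 0 < 2 ^ n.
Proof. apply pow_lt. lra. Qed.

Lemma div_pow2_S c n : c / 2 ^ n = c / 2 ^ S n + c / 2 ^ S n.
Proof. simpl. assert (H := two_pow_pos n). field. lra. Qed.

Lemma div_pow2_small c d : 0 < d -> exists N, forall n, (N <= n)%nat -> c / 2 ^ n < d.
Proof.
  intros Hd. destruct (Pow_x_infinity 2 ltac:(rewrite Rabs_right; lra) (Rabs c / d + 1)) as [N HN].
  exists N. intros n Hn. specialize (HN n Hn). assert (H := two_pow_pos n).
  rewrite Rabs_right in HN by lra. apply Rlt_div_l; auto.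
  assert (Rabs c / d < 2 ^ n) by lra. apply Rlt_div_l in H0; auto.
  generalize (Rle_abs c). lra.
Qed.

(** If the property failed, some quarter of each failing rectangle would fail again, and these
    nested rectangles would shrink to a point that contradicts the local hypothesis. At depth [n]
    all rectangles have the same sides, so a corner determines the rectangle. *)
Lemma bisection (P : nat -> R -> R -> Prop) (L M x0 y0 : R) : 0 <= L -> 0 <= M ->
  (forall n x y, let l := L / 2 ^ S n in let m := M / 2 ^ S n in
     x0 <= x -> x + L / 2 ^ n <= x0 + L -> y0 <= y -> y + M / 2 ^ n <= y0 + M ->
     P (S n) x y -> P (S n) (x + l) y -> P (S n) x (y + m) -> P (S n) (x + l) (y + m) -> P n x y) ->
  (forall X Y, x0 <= X <= x0 + L -> y0 <= Y <= y0 + M -> exists N, forall n x y, (N <= n)%nat ->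
     x0 <= x -> x + L / 2 ^ n <= x0 + L -> y0 <= y -> y + M / 2 ^ n <= y0 + M ->
     x <= X <= x + L / 2 ^ n -> y <= Y <= y + M / 2 ^ n -> P n x y) ->
  P O x0 y0.
Proof.
  intros HL HM Hstep Hloc. apply NNPP. intro HP.
  set (inr n x y := x0 <= x /\ x + L / 2 ^ n <= x0 + L /\ y0 <= y /\ y + M / 2 ^ n <= y0 + M).
  set (bad n (p : R * R) := inr n (fst p) (snd p) /\ ~ P n (fst p) (snd p)).
  set (next n (p q : R * R) :=
    (fst q = fst p \/ fst q = fst p + L / 2 ^ S n) /\ (snd q = snd p \/ snd q = snd p + M / 2 ^ S n)).
  assert (Hl : forall n, 0 <= L / 2 ^ n) by (intro; apply Rdiv_le_0_compat; [auto | apply two_pow_pos]).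
  assert (Hm : forall n, 0 <= M / 2 ^ n) by (intro; apply Rdiv_le_0_compat; [auto | apply two_pow_pos]).
  assert (Hn : forall n p, bad n p -> exists q, bad (S n) q /\ next n p q).
  { intros n [x y] [[A [B [C D]]] H]. simpl in *. apply NNPP. intro K. apply H.
    assert (EL := div_pow2_S L n). assert (EM := div_pow2_S M n).
    assert (HlS := Hl (S n)). assert (HmS := Hm (S n)). simpl pow in *.
    apply Hstep; auto; simpl pow;
    apply NNPP; intro Q; apply K;
      [exists (x, y) | exists (x + L / (2 * 2 ^ n), y) | exists (x, y + M / (2 * 2 ^ n))
      | exists (x + L / (2 * 2 ^ n), y + M / (2 * 2 ^ n))]; unfold bad, inr, next; simpl;
      repeat split; auto; lra. }
  destruct (choice (fun (np : nat * (R * R)) q => bad (fst np) (snd np) ->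
      bad (S (fst np)) q /\ next (fst np) (snd np) q)) as [nx Hnx].
  { intros [n p]. destruct (classic (bad n p)) as [K | K].
    - destruct (Hn n p K) as [q Hq]. exists q. auto.
    - exists p. simpl. tauto. }
  set (s := fix s n := match n with O => (x0, y0) | S k => nx (k, s k) end).
  assert (Hs : forall n, bad n (s n)).
  { induction n as [ | n IH].
    - split; auto. unfold inr; simpl. unfold Rdiv. rewrite Rinv_1. lra.
    - simpl. now apply (Hnx (n, s n)). }
  assert (Hs' : forall n, next n (s n) (s (S n))).
  { intro n. simpl. now apply (Hnx (n, s n)). }
  destruct (nested_intervals (fun n => fst (s n)) (fun n => L / 2 ^ n)) as [X HX].
  - apply Hl.
  - intro n. destruct (Hs' n) as [[E | E] _]; rewrite E; specialize (Hl (S n)); lra.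
  - intro n. assert (EL := div_pow2_S L n).
    destruct (Hs' n) as [[E | E] _]; rewrite E; specialize (Hl (S n)); lra.
  - destruct (nested_intervals (fun n => snd (s n)) (fun n => M / 2 ^ n)) as [Y HY].
    + apply Hm.
    + intro n. destruct (Hs' n) as [_ [E | E]]; rewrite E; specialize (Hm (S n)); lra.
    + intro n. assert (EL := div_pow2_S M n).
      destruct (Hs' n) as [_ [E | E]]; rewrite E; specialize (Hm (S n)); lra.
    + destruct (Hloc X Y) as [N HN].
      * generalize (HX O). simpl. unfold Rdiv. rewrite Rinv_1. lra.
      * generalize (HY O). simpl. unfold Rdiv. rewrite Rinv_1. lra.
      * destruct (Hs N) as [[A [B [C D]]] K]. apply K. apply HN; auto.
Qed.

(** The integral of [g dz] counterclockwise around the rectangle, with [dz = i dy] on the vertical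
    sides. *)
Definition bd (g : C -> C) (x1 x2 y1 y2 : R) : C :=
  (CI (fun x => g (x, y1)) x1 x2 + Ci * CI (fun y => g (x2, y)) y1 y2
   - CI (fun x => g (x, y2)) x1 x2 - Ci * CI (fun y => g (x1, y)) y1 y2)%C.

Lemma tends_hline (g : C -> C) x y A : cder g (x, y) A ->
  tends (locally x) (fun x => g (x, y)) (g (x, y)).
Proof.
  intro H. apply cder_tends in H. eapply (tends_comp_C (fun x => (x, y))); [ | apply H].
  apply tends_ext with (fun s => RtoC s + (0, y))%C.
  - apply filter_forall. intros s. unfold Cplus, RtoC; simpl. f_equal; ring.
  - apply tends_eq with (RtoC x + (0, y))%C.
    + unfold Cplus, RtoC; simpl. f_equal; ring.
    + apply tends_plus; [apply tends_RtoC | apply tends_const].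
Qed.

Lemma tends_vline (g : C -> C) x y A : cder g (x, y) A ->
  tends (locally y) (fun y => g (x, y)) (g (x, y)).
Proof.
  intro H. apply cder_tends in H. eapply (tends_comp_C (fun y => (x, y))); [ | apply H].
  apply tends_ext with (fun s => RtoC s * Ci + RtoC x)%C.
  - apply filter_forall. intros s. unfold Cplus, Cmult, Ci, RtoC; simpl. f_equal; ring.
  - apply tends_eq with (RtoC y * Ci + RtoC x)%C.
    + unfold Cplus, Cmult, Ci, RtoC; simpl. f_equal; ring.
    + apply tends_plus; [apply tends_mult; [apply tends_RtoC | apply tends_const] | apply tends_const].
Qed.

Definition hol_rect (g : C -> C) (x1 x2 y1 y2 : R) : Prop :=
  forall x y, x1 <= x <= x2 -> y1 <= y <= y2 -> exists A, cder g (x, y) A.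

Lemma exI_hline g x1 x2 y1 y2 u v y : hol_rect g x1 x2 y1 y2 ->
  x1 <= u -> u <= v -> v <= x2 -> y1 <= y <= y2 -> exI (fun x => g (x, y)) u v.
Proof.
  intros H Hu Huv Hv Hy. apply exI_continuous; auto. intros t Ht.
  destruct (H t y) as [A HA]; [lra | lra |]. apply (tends_hline g t y A HA).
Qed.

Lemma exI_vline g x1 x2 y1 y2 u v x : hol_rect g x1 x2 y1 y2 ->
  y1 <= u -> u <= v -> v <= y2 -> x1 <= x <= x2 -> exI (fun y => g (x, y)) u v.
Proof.
  intros H Hu Huv Hv Hy. apply exI_continuous; auto. intros t Ht.
  destruct (H x t) as [A HA]; [lra | lra |]. apply (tends_vline g x t A HA).
Qed.

Lemma CI_Chasles G a b c : exI G a b -> exI G b c -> CI G a c = (CI G a b + CI G b c)%C.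
Proof.
  intros H K. apply CI_eq. apply isI_Chasles with b; now apply CI_spec.
Qed.

Lemma bd_split_x g x1 x2 x3 y1 y2 : x1 <= x2 <= x3 -> y1 <= y2 -> hol_rect g x1 x3 y1 y2 ->
  bd g x1 x3 y1 y2 = (bd g x1 x2 y1 y2 + bd g x2 x3 y1 y2)%C.
Proof.
  intros Hx Hy H. unfold bd.
  rewrite (CI_Chasles (fun x => g (x, y1)) x1 x2 x3), (CI_Chasles (fun x => g (x, y2)) x1 x2 x3);
    try (eapply exI_hline; [apply H | ..]; lra).
  ring.
Qed.

Lemma bd_split_y g x1 x2 y1 y2 y3 : y1 <= y2 <= y3 -> x1 <= x2 -> hol_rect g x1 x2 y1 y3 ->
  bd g x1 x2 y1 y3 = (bd g x1 x2 y1 y2 + bd g x1 x2 y2 y3)%C.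
Proof.
  intros Hx Hy H. unfold bd.
  rewrite (CI_Chasles (fun y => g (x1, y)) y1 y2 y3), (CI_Chasles (fun y => g (x2, y)) y1 y2 y3);
    try (eapply exI_vline; [apply H | ..]; lra).
  ring.
Qed.

Lemma hol_rect_sub g x1 x2 y1 y2 u1 u2 v1 v2 : x1 <= u1 -> u2 <= x2 -> y1 <= v1 -> v2 <= y2 ->
  hol_rect g x1 x2 y1 y2 -> hol_rect g u1 u2 v1 v2.
Proof. intros A B D E H x y Hx Hy. apply H; lra. Qed.

Lemma cts_on_tends a b G : (forall t, a <= t <= b -> tends (locally t) G (G t)) -> cts_on a b G.
Proof.
  intros H s Hs. generalize (H s Hs). apply tends_le_filter. apply filter_le_within.
Qed.

Lemma bd_primitive Q q x1 x2 y1 y2 : x1 <= x2 -> y1 <= y2 ->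
  (forall z, cder Q z (q z)) -> (forall z, tends (nb z) q (q z)) -> bd q x1 x2 y1 y2 = RtoC 0.
Proof.
  intros Hx Hy HQ Hq.
  assert (Eh : forall y, CI (fun x => q (x, y)) x1 x2 = (Q (x2, y) - Q (x1, y))%C).
  { intro y. apply CI_eq. apply (isI_FTC (fun x => Q (x, y))); auto.
    - apply cts_on_tends. intros t _. eapply tends_hline. apply HQ.
    - apply cts_on_tends. intros t _.
      eapply (tends_comp_C (fun x => (x, y))); [ | apply Hq].
      apply (tends_hline (fun z => z) t y _ (cder_id _)).
    - intros s Hs. apply (rder_eq _ _ (q (s, y) * 1)%C); [ring |].
      apply (rder_comp (fun x => (x, y)) Q); [ | apply HQ].
      apply rder_ext with (fun s => (0, y) + RtoC s * 1)%C; [ | apply rder_affine].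
      apply filter_forall. intros r. unfold Cplus, Cmult, RtoC; simpl. f_equal; ring. }
  assert (Ev : forall x, (Ci * CI (fun y => q (x, y)) y1 y2 = Q (x, y2) - Q (x, y1))%C).
  { intro x.
    assert (H : isI (fun y => Ci * q (x, y))%C y1 y2 (Q (x, y2) - Q (x, y1))%C).
    { assert (Ht : forall t, tends (locally t) (fun y => q (x, y)) (q (x, t))).
      { intro t. eapply (tends_comp_C (fun y => (x, y))); [ | apply Hq].
        apply (tends_vline (fun z => z) x t _ (cder_id _)). }
      apply (isI_FTC (fun y => Q (x, y))); auto.
      - apply cts_on_tends. intros t _. eapply tends_vline. apply HQ.
      - apply cts_on_tends. intros t _. apply tends_mult; [apply tends_const | apply Ht].
      - intros s Hs. apply (rder_eq _ _ (q (x, s) * Ci)%C); [ring |].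
        apply (rder_comp (fun y => (x, y)) Q); [ | apply HQ].
        apply rder_ext with (fun s => RtoC x + RtoC s * Ci)%C; [ | apply rder_affine].
        apply filter_forall. intros r. unfold Cplus, Cmult, Ci, RtoC; simpl. f_equal; ring. }
    apply (isI_unique (fun y => Ci * q (x, y))%C y1 y2); auto.
    apply isI_scal. apply CI_spec. apply exI_continuous; auto.
    intros t _. eapply (tends_comp_C (fun y => (x, y))); [ | apply Hq].
    apply (tends_vline (fun z => z) x t _ (cder_id _)). }
  unfold bd. rewrite !Eh, !Ev. ring.
Qed.

Lemma bd_minus g h x1 x2 y1 y2 : x1 <= x2 -> y1 <= y2 ->
  hol_rect g x1 x2 y1 y2 -> hol_rect h x1 x2 y1 y2 ->
  bd (fun z => g z - h z)%C x1 x2 y1 y2 = (bd g x1 x2 y1 y2 - bd h x1 x2 y1 y2)%C.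
Proof.
  intros Hx Hy Hg Hh.
  assert (Eh : forall y, y1 <= y <= y2 -> CI (fun x => g (x, y) - h (x, y))%C x1 x2 =
     (CI (fun x => g (x, y)) x1 x2 - CI (fun x => h (x, y)) x1 x2)%C).
  { intros y Hyy. apply CI_eq. apply isI_minus; apply CI_spec; eapply exI_hline; eauto; lra. }
  assert (Ev : forall x, x1 <= x <= x2 -> CI (fun y => g (x, y) - h (x, y))%C y1 y2 =
     (CI (fun y => g (x, y)) y1 y2 - CI (fun y => h (x, y)) y1 y2)%C).
  { intros y Hyy. apply CI_eq. apply isI_minus; apply CI_spec; eapply exI_vline; eauto; lra. }
  unfold bd. rewrite !Eh, !Ev by lra. ring.
Qed.

Lemma bd_bound g K x1 x2 y1 y2 : x1 <= x2 -> y1 <= y2 -> hol_rect g x1 x2 y1 y2 ->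
  (forall x y, x1 <= x <= x2 -> y1 <= y <= y2 -> Cmod (g (x, y)) <= K) ->
  Cmod (bd g x1 x2 y1 y2) <= 2 * K * ((x2 - x1) + (y2 - y1)).
Proof.
  intros Hx Hy Hg HK.
  assert (Eh : forall y, y1 <= y <= y2 -> Cmod (CI (fun x => g (x, y)) x1 x2) <= (x2 - x1) * K).
  { intros y Hyy. apply isI_norm_const with (fun x => g (x, y)); auto.
    apply CI_spec; eapply exI_hline; eauto; lra. }
  assert (Ev : forall x, x1 <= x <= x2 -> Cmod (Ci * CI (fun y => g (x, y)) y1 y2) <= (y2 - y1) * K).
  { intros x Hxx. rewrite Cmod_mult, Cmod_Ci, Rmult_1_l.
    apply isI_norm_const with (fun y => g (x, y)); auto.
    apply CI_spec; eapply exI_vline; eauto; lra. }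
  unfold bd. unfold Cminus.
  eapply Rle_trans; [apply Cmod_triangle |]. rewrite Cmod_opp.
  eapply Rle_trans; [apply Rplus_le_compat_r; apply Cmod_triangle |]. rewrite Cmod_opp.
  eapply Rle_trans; [do 2 apply Rplus_le_compat_r; apply Cmod_triangle |].
  generalize (Eh y1 ltac:(lra)) (Eh y2 ltac:(lra)) (Ev x1 ltac:(lra)) (Ev x2 ltac:(lra)). lra.
Qed.

Theorem goursat g x0 y0 L M : 0 <= L -> 0 <= M ->
  hol_rect g x0 (x0 + L) y0 (y0 + M) -> bd g x0 (x0 + L) y0 (y0 + M) = RtoC 0.
Proof.
  intros HL HM H. apply Cmod_small_eq0. intros e He.
  assert (Hl : forall n, 0 <= L / 2 ^ n) by (intro; apply Rdiv_le_0_compat; [auto | apply two_pow_pos]).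
  assert (Hm : forall n, 0 <= M / 2 ^ n) by (intro; apply Rdiv_le_0_compat; [auto | apply two_pow_pos]).
  (* Quartering divides the tolerance by 4, so the bounds of the four quarters add up to exactly the
     bound of the parent. *)
  set (P n x y := Cmod (bd g x (x + L / 2 ^ n) y (y + M / 2 ^ n)) <= e / (2 ^ n * 2 ^ n)).
  assert (HP : P O x0 y0).
  { apply bisection with L M; auto.
    - intros n x y l m A B D E P1 P2 P3 P4. unfold P in *.
      assert (EL := div_pow2_S L n). assert (EM := div_pow2_S M n).
      fold l m in EL, EM, P1, P2, P3, P4. rewrite EL, EM in *.
      assert (0 <= l) by apply Hl. assert (0 <= m) by apply Hm.
      rewrite (bd_split_x g x (x + l) (x + (l + l))) by
        (first [lra | eapply hol_rect_sub; [ | | | | apply H]; lra]).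
      rewrite !(bd_split_y g _ _ y (y + m) (y + (m + m))) by
        (first [lra | eapply hol_rect_sub; [ | | | | apply H]; lra]).
      replace (x + (l + l)) with (x + l + l) by ring.
      replace (y + (m + m)) with (y + m + m) by ring.
      eapply Rle_trans; [apply Cmod_triangle |].
      eapply Rle_trans; [apply Rplus_le_compat; apply Cmod_triangle |].
      replace (e / (2 ^ n * 2 ^ n)) with (4 * (e / (2 ^ S n * 2 ^ S n))).
      + lra.
      + simpl. field. apply Rgt_not_eq. apply two_pow_pos.
    - intros X Y HX HY. destruct (H X Y HX HY) as [A HA].
      (* On a rectangle of depth [n] the remainder is at most [e' * S / 2^n], and [bd_bound] turns
         this into [2 * e' * S^2 / 4^n]. The summand 1 keeps the denominator positive for a
         degenerate rectangle. *)
      set (S := L + M). set (e' := e / (2 * (S * S) + 1)).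
      assert (HS : 0 <= S) by (unfold S; lra).
      assert (He' : 0 < e') by (apply Rdiv_lt_0_compat; nra).
      destruct (cder_domin _ _ _ e' HA He') as [d [Hd Hdom]].
      destruct (div_pow2_small S d Hd) as [N HN]. exists N.
      intros n x y Hn B D E F Hx Hy. specialize (HN n Hn). unfold P.
      assert (Hp := two_pow_pos n).
      assert (ES : S / 2 ^ n = L / 2 ^ n + M / 2 ^ n) by (unfold S; field; lra).
      set (l := L / 2 ^ n) in *. set (m := M / 2 ^ n) in *.
      assert (0 <= l) by apply Hl. assert (0 <= m) by apply Hm.
      (* The affine approximation has a primitive, hence zero boundary integral, so it can be
         subtracted and only the remainder is left to estimate. *)
      set (q := fun z => (A * z + (g (X, Y) - A * (X, Y)))%C).
      assert (Hq : forall z, cder q z A).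
      { intro z. apply (cder_eq _ _ ((0 * z + A * 1) + 0)%C); [ring |].
        apply cder_plus; [ | apply cder_const].
        apply (cder_mult (fun _ => A) (fun z => z)); [apply cder_const | apply cder_id]. }
      assert (Hbq : bd q x (x + l) y (y + m) = RtoC 0).
      { apply bd_primitive with (fun z => (A / 2) * (z * z) + (g (X, Y) - A * (X, Y)) * z)%C; try lra.
        - intro z. unfold q.
          eapply cder_eq; [ | apply cder_plus; apply cder_mult;
            [apply cder_const | apply cder_mult; apply cder_id | apply cder_const | apply cder_id]].
          cbv beta. field.
        - intro z. eapply cder_tends. apply Hq. }
      assert (Hhg : hol_rect g x (x + l) y (y + m)) by
        (eapply hol_rect_sub; [ | | | | apply H]; lra).
      assert (Hhq : hol_rect q x (x + l) y (y + m)) by (intros u v _ _; exists A; apply Hq).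
      replace (bd g x (x + l) y (y + m)) with (bd (fun z => g z - q z)%C x (x + l) y (y + m)).
      2: { rewrite bd_minus, Hbq; try lra; auto. ring. }
      assert (Hdist : forall u v, x <= u <= x + l -> y <= v <= y + m ->
          Cmod ((u, v) - (X, Y)) <= S / 2 ^ n).
      { intros u v Hu Hv. eapply Rle_trans; [apply Cmod_le_parts |].
        unfold Re, Im; simpl. rewrite ES. apply Rplus_le_compat; apply Rabs_le; lra. }
      eapply Rle_trans; [apply bd_bound with (K := e' * (S / 2 ^ n)); try lra | ].
      + intros u v Hu Hv. destruct (Hhg u v Hu Hv) as [G HG]. exists (G - A)%C.
        apply cder_minus; auto.
      + intros u v Hu Hv. specialize (Hdist u v Hu Hv). unfold q.
        replace (g (u, v) - (A * (u, v) + (g (X, Y) - A * (X, Y))))%C with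
          (g (u, v) - g (X, Y) - A * ((u, v) - (X, Y)))%C by ring.
        eapply Rle_trans; [apply Hdom; lra |].
        apply Rmult_le_compat_l; lra.
      + replace (x + l - x + (y + m - y)) with (S / 2 ^ n) by (rewrite ES; ring).
        replace (2 * (e' * (S / 2 ^ n)) * (S / 2 ^ n)) with
          ((e' * (2 * (S * S))) / (2 ^ n * 2 ^ n)) by (field; lra).
        apply Rmult_le_compat_r; [left; apply Rinv_0_lt_compat; nra |].
        apply Rle_trans with (e' * (2 * (S * S) + 1)); [nra |].
        right. unfold e'. field. apply Rgt_not_eq. nra. }
  unfold P in HP. simpl in HP. unfold Rdiv in HP. rewrite Rmult_1_r, Rinv_1, !Rmult_1_r in HP. exact HP.
Qed.

(** * Compactness in the plane *)

(** Without a cluster point, every [z] has a gauge [d] such that terms near [z] have index below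
    [/ d]. One number serves as radius and as index bound, so [compactness_value_2d] gives a single
    bound for all indices, which is absurd. *)
Lemma cluster_point (x : nat -> C) (M : R) : (forall n, Cmod (x n) <= M) ->
  exists z, forall e N, 0 < e -> exists n, (N <= n)%nat /\ Cmod (x n - z) < e.
Proof.
  intros HM. apply NNPP. intro H.
  assert (Hz : forall z : R * R, exists d : posreal, forall n, Cmod (x n - z) < 2 * d -> INR n < / d).
  { intro z. apply NNPP. intro K. apply H. exists z. intros e N He. apply NNPP. intro Q.
    apply K. assert (HN : 0 < INR N + 1) by (generalize (pos_INR N); lra).
    assert (Hd : 0 < Rmin (e / 2) (/ (INR N + 1))).
    { apply Rmin_glb_lt; [lra |]. now apply Rinv_0_lt_compat. }
    exists (mkposreal _ Hd). simpl. intros n Hn.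
    assert (Hne : Cmod (x n - z) < e) by (generalize (Rmin_l (e / 2) (/ (INR N + 1))); lra).
    assert (HnN : (n < N)%nat).
    { apply Nat.nle_gt. intro K'. apply Q. now exists n. }
    apply lt_INR in HnN.
    apply Rlt_le_trans with (INR N + 1); [lra |].
    assert (K' := Rinv_le_contravar _ _ Hd (Rmin_r _ _)). now rewrite Rinv_inv in K'. }
  apply choice in Hz. destruct Hz as [delta Hdelta].
  destruct (compactness_value_2d (- M) M (- M) M (fun u v => delta (u, v))) as [d Hd].
  destruct (INR_unbounded (/ d)) as [n Hn].
  apply (Hd (Re (x n)) (Im (x n))).
  - apply Rabs_le_between. eapply Rle_trans; [apply re_le_Cmod | apply HM].
  - apply Rabs_le_between. eapply Rle_trans; [apply im_le_Cmod | apply HM].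
  - intros [u [v [_ [_ [Hu [Hv Hdd]]]]]].
    assert (K : INR n < / delta (u, v)).
    { apply Hdelta. eapply Rle_lt_trans; [apply Cmod_le_parts |].
      change (Rabs (Re (x n) - u) + Rabs (Im (x n) - v) < 2 * delta (u, v)). lra. }
    assert (/ delta (u, v) <= / d).
    { apply Rinv_le_contravar; auto. apply cond_pos. }
    lra.
Qed.

Definition limit_closed (E : C -> Prop) : Prop :=
  forall z, (forall e, 0 < e -> exists w, E w /\ Cmod (w - z) < e) -> E z.

Definition cts_in (E : C -> Prop) (u : C -> C) : Prop :=
  forall w, E w -> tends (within E (nb w)) u (u w).

Lemma inv_INR_small e : 0 < e -> exists N, forall n, (N <= n)%nat -> / (INR n + 1) < e.
Proof.
  intro He. destruct (INR_unbounded (/ e)) as [N HN]. exists N. intros n Hn.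
  apply le_INR in Hn. rewrite <- (Rinv_inv e). apply Rinv_lt_contravar; [ | lra].
  assert (0 < / e) by now apply Rinv_0_lt_compat.
  apply Rmult_lt_0_compat; lra.
Qed.

Lemma unif_cont E u M : limit_closed E -> (forall w, E w -> Cmod w <= M) -> cts_in E u ->
  forall e, 0 < e -> exists d, 0 < d /\
    forall w w', E w -> E w' -> Cmod (w - w') < d -> Cmod (u w - u w') < e.
Proof.
  intros Hc HM Hu e He. apply NNPP. intro H.
  assert (Hn : forall n : nat, exists p : C * C, E (fst p) /\ E (snd p) /\
     Cmod (fst p - snd p) < / (INR n + 1) /\ e <= Cmod (u (fst p) - u (snd p))).
  { intro n. apply NNPP. intro K. apply H. exists (/ (INR n + 1)). split.
    - apply Rinv_0_lt_compat. generalize (pos_INR n). lra.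
    - intros w w' Hw Hw' Hd. apply Rnot_le_lt. intro Q. apply K. exists (w, w'). auto. }
  apply choice in Hn. destruct Hn as [p Hp].
  destruct (cluster_point (fun n => fst (p n)) M) as [z Hz].
  { intro n. apply HM. apply Hp. }
  assert (Ez : E z).
  { apply Hc. intros e' He'. destruct (Hz e' O He') as [n [_ K]]. exists (fst (p n)).
    split; auto. apply Hp. }
  destruct (Hu z Ez (e / 2) ltac:(lra)) as [d [Hd K]].
  destruct (inv_INR_small (d / 2) ltac:(lra)) as [N HN].
  assert (Hd2 : 0 < d / 2) by lra.
  destruct (Hz (d / 2) N Hd2) as [n [Hn Hnz]]. specialize (HN n Hn).
  destruct (Hp n) as [E1 [E2 [A B]]].
  assert (K1 := K (fst (p n)) ltac:(lra) E1).
  assert (K2 : Cmod (snd (p n) - z) < d).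
  { eapply Rle_lt_trans; [apply (Cmod_sub_triangle _ (fst (p n))) |].
    rewrite (Cmod_minus_sym (snd (p n))). lra. }
  specialize (K _ K2 E2).
  generalize (Cmod_sub_triangle (u (fst (p n))) (u z) (u (snd (p n)))).
  rewrite (Cmod_minus_sym (u z)). lra.
Qed.

Lemma cts_in_bounded E u M : limit_closed E -> (forall w, E w -> Cmod w <= M) -> cts_in E u ->
  exists B, forall w, E w -> Cmod (u w) <= B.
Proof.
  intros Hc HM Hu. apply NNPP. intro H.
  assert (Hn : forall n : nat, exists w, E w /\ INR n < Cmod (u w)).
  { intro n. apply NNPP. intro K. apply H. exists (INR n). intros w Hw.
    apply Rnot_lt_le. intro Q. apply K. exists w. auto. }
  apply choice in Hn. destruct Hn as [p Hp].
  destruct (cluster_point p M) as [z Hz].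
  { intro n. apply HM. apply Hp. }
  assert (Ez : E z).
  { apply Hc. intros e' He'. destruct (Hz e' O He') as [n [_ K]]. exists (p n).
    split; auto. apply Hp. }
  destruct (Hu z Ez 1 ltac:(lra)) as [d [Hd K]].
  destruct (INR_unbounded (Cmod (u z) + 1)) as [N HN].
  destruct (Hz d N Hd) as [n [Hn Hnz]].
  destruct (Hp n) as [E1 E2]. apply le_INR in Hn.
  assert (K1 := K (p n) Hnz E1). generalize (Cmod_le_add_sub (u (p n)) (u z)). lra.
Qed.

(** * Circular means *)

Definition cis (t : R) : C := (cos t, sin t).

Lemma Cmod_cis t : Cmod (cis t) = 1.
Proof.
  unfold Cmod, cis; simpl. replace (cos t * (cos t * 1) + sin t * (sin t * 1)) with 1.
  - apply sqrt_1.
  - generalize (sin2_cos2 t). unfold Rsqr. lra.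
Qed.

Lemma cis_plus s t : cis (s + t) = (cis s * cis t)%C.
Proof. unfold cis, Cmult; simpl. rewrite cos_plus, sin_plus. f_equal; ring. Qed.

Lemma cis_2PI t : cis (t + 2 * PI) = cis t.
Proof. unfold cis. now rewrite cos_plus, sin_plus, cos_2PI, sin_2PI, !Rmult_0_r, !Rmult_1_r, Rminus_0_r, Rplus_0_r. Qed.

Lemma derivable_small f l : derivable_pt_lim f 0 l -> forall e, 0 < e ->
  exists d, 0 < d /\ forall h, Rabs h < d -> Rabs (f h - f 0 - l * h) <= e * Rabs h.
Proof.
  intros H e He. destruct (H e He) as [d Hd]. exists d. split; [apply cond_pos |].
  intros h Hh. destruct (Req_dec h 0) as [-> | Hn].
  - replace (f 0 - f 0 - l * 0) with 0 by ring. rewrite !Rabs_R0. lra.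
  - specialize (Hd h Hn Hh). rewrite Rplus_0_l in Hd.
    replace (f h - f 0 - l * h) with (((f h - f 0) / h - l) * h) by (field; auto).
    rewrite Rabs_mult. apply Rmult_le_compat_r; [apply Rabs_pos | lra].
Qed.

Definition Cexp (z : C) : C := (RtoC (exp (Re z)) * cis (Im z))%C.

Lemma Cexp_plus z w : Cexp (z + w) = (Cexp z * Cexp w)%C.
Proof. unfold Cexp. rewrite Re_plus, Im_plus, exp_plus, cis_plus, RtoC_mult. ring. Qed.

Lemma Cexp_small e : 0 < e -> nb 0 (fun z => Cmod (Cexp z - 1 - z) <= e * Cmod z).
Proof.
  intro He. set (k := Rmin (e / 8) 1).
  assert (Hk : 0 < k) by (apply Rmin_glb_lt; lra).
  assert (Hk1 : k <= e / 8) by apply Rmin_l.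
  assert (Hk2 : k <= 1) by apply Rmin_r.
  destruct (derivable_small _ _ (derivable_pt_lim_exp_0) k Hk) as [d1 [Hd1 E1]].
  assert (Dc := derivable_pt_lim_cos 0). rewrite sin_0, Ropp_0 in Dc.
  assert (Ds := derivable_pt_lim_sin 0). rewrite cos_0 in Ds.
  destruct (derivable_small _ _ Dc k Hk) as [d2 [Hd2 E2]].
  destruct (derivable_small _ _ Ds k Hk) as [d3 [Hd3 E3]].
  exists (Rmin (Rmin d1 d2) (Rmin d3 k)). split.
  { apply Rmin_glb_lt; apply Rmin_glb_lt; auto. }
  intros [s t] Hz. replace ((s, t) - RtoC 0)%C with (s, t) in Hz by
    (unfold Cminus, Cplus, Copp, RtoC; simpl; f_equal; ring).
  assert (Hs := re_le_Cmod (s, t)). assert (Ht := im_le_Cmod (s, t)). unfold Re, Im in Hs, Ht; simpl in Hs, Ht.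
  set (h := Cmod (s, t)) in *.
  assert (A1 := Rmin_l (Rmin d1 d2) (Rmin d3 k)). assert (A2 := Rmin_r (Rmin d1 d2) (Rmin d3 k)).
  assert (A3 := Rmin_l d1 d2). assert (A4 := Rmin_r d1 d2).
  assert (A5 := Rmin_l d3 k). assert (A6 := Rmin_r d3 k).
  specialize (E1 s ltac:(lra)). specialize (E2 t ltac:(lra)). specialize (E3 t ltac:(lra)).
  rewrite exp_0 in E1. rewrite cos_0 in E2. rewrite sin_0 in E3.
  set (a := (exp s - 1 - 1 * s)) in *.
  set (b := (cos t - 1 - 0 * t, sin t - 0 - 1 * t) : C).
  assert (Hb : Cmod b <= 2 * k * h).
  { eapply Rle_trans; [apply Cmod_le_parts |]. unfold b, Re, Im; simpl.
    generalize (Rabs_pos s) (Rabs_pos t). nra. }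
  (* The real and the circular remainders [a] and [b] are separated, leaving only the product
     [s * i t], which is of second order. *)
  replace (Cexp (s, t) - 1 - (s, t))%C with
    (RtoC a * cis t + (RtoC (1 + s) * b + RtoC s * (RtoC t * Ci)))%C.
  2: { unfold Cexp, a, b, cis, Cplus, Cminus, Copp, Cmult, RtoC, Ci, Re, Im; simpl.
       apply injective_projections; simpl; ring. }
  eapply Rle_trans; [apply Cmod_triangle |].
  eapply Rle_trans; [apply Rplus_le_compat_l; apply Cmod_triangle |].
  rewrite !Cmod_mult, Cmod_cis, Cmod_Ci, !Cmod_R.
  assert (H1 : Rabs (1 + s) <= 2).
  { eapply Rle_trans; [apply Rabs_triang |]. rewrite Rabs_R1. lra. }
  assert (0 <= h) by apply Cmod_ge_0.
  assert (Rabs a * 1 <= k * h) by (generalize (Rabs_pos s); nra).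
  assert (Rabs (1 + s) * Cmod b <= 2 * (2 * k * h)).
  { apply Rmult_le_compat; auto. apply Rabs_pos. apply Cmod_ge_0. }
  assert (Rabs s * (Rabs t * 1) <= h * k).
  { apply Rmult_le_compat; try lra. apply Rabs_pos. generalize (Rabs_pos t); lra. }
  nra.
Qed.

Lemma cder_Cexp z : cder Cexp z (Cexp z).
Proof.
  apply cder_of_small. intros e He.
  set (m := Cmod (Cexp z) + 1).
  assert (Hm : 0 < m) by (unfold m; generalize (Cmod_ge_0 (Cexp z)); lra).
  assert (Hem : 0 < e / m) by (apply Rdiv_lt_0_compat; auto).
  destruct (Cexp_small _ Hem) as [d [Hd H]]. exists d. split; auto.
  intros x Hx. specialize (H (x - z)%C). replace (x - z - 0)%C with (x - z)%C in H by ring.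
  specialize (H Hx).
  replace (Cexp x) with (Cexp z * Cexp (x - z))%C by (rewrite <- Cexp_plus; f_equal; ring).
  replace (Cexp z * Cexp (x - z) - Cexp z - Cexp z * (x - z))%C with
    (Cexp z * (Cexp (x - z) - 1 - (x - z)))%C by ring.
  rewrite Cmod_mult. apply Rle_trans with (m * (e / m * Cmod (x - z))).
  - apply Rmult_le_compat; auto; try apply Cmod_ge_0. unfold m; lra.
  - right. field. lra.
Qed.

Lemma tends_cis t : tends (locally t) cis (cis t).
Proof.
  apply tends_ext with (fun s => Cexp (0, s)).
  - apply filter_forall. intros s. unfold Cexp, Re, Im; simpl. rewrite exp_0. ring.
  - apply tends_eq with (Cexp (0, t)).
    + unfold Cexp, Re, Im; simpl. rewrite exp_0. ring.
    + eapply tends_vline. apply cder_Cexp.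
Qed.

(** An integral over one full turn, not divided by [2 * PI]. The starting angle is free because the
    curve will be cut at the angle of [f (gamma a)]. *)
Definition circ (t0 : R) (u : C -> C) (r : R) : C :=
  CI (fun t => u (RtoC r * cis t)%C) t0 (t0 + 2 * PI).

Lemma Cmod_polar r t : 0 <= r -> Cmod (RtoC r * cis t) = r.
Proof. intro H. rewrite Cmod_mult, Cmod_cis, Cmod_R, Rabs_right; lra. Qed.

Lemma polar_Cexp r t : 0 < r -> (RtoC r * cis t)%C = Cexp (ln r, t).
Proof. intro H. unfold Cexp, Re, Im; simpl. now rewrite exp_ln. Qed.

Lemma exp_monotone x y : x <= y -> exp x <= exp y.
Proof. intros [H | ->]; [left; now apply exp_increasing | lra]. Qed.

(** In logarithmic coordinates the annulus is a rectangle of height [2 * PI]. The horizontal sides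
    of the boundary integral of [u] composed with [Cexp] cancel by periodicity, so Goursat's theorem
    equates the vertical sides, which are the two circular integrals. *)
Lemma circ_const_open t0 u r1 r2 r r' : 0 <= r1 -> r1 < r -> r <= r' -> r' < r2 ->
  (forall w, r1 < Cmod w < r2 -> exists A, cder u w A) -> circ t0 u r = circ t0 u r'.
Proof.
  intros H1 Hr Hrr Hr2 Hu.
  assert (Hln : ln r <= ln r') by (apply ln_le; lra).
  assert (HPI := PI_RGT_0).
  assert (G := goursat (fun z => u (Cexp z)) (ln r) t0 (ln r' - ln r) (2 * PI)).
  replace (ln r + (ln r' - ln r)) with (ln r') in G by ring.
  unfold bd in G.
  assert (E : forall x, Cexp (x, t0 + 2 * PI) = Cexp (x, t0)).
  { intro x. unfold Cexp, Re, Im; simpl. now rewrite cis_2PI. }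
  assert (E0 : CI (fun x => u (Cexp (x, t0 + 2 * PI))) (ln r) (ln r') =
     CI (fun x => u (Cexp (x, t0))) (ln r) (ln r')).
  { unfold CI. apply (RInt_ext (V := C_R_CompleteNormedModule)). intros x _. now rewrite E. }
  assert (Ec : forall s, 0 < s -> CI (fun y => u (Cexp (ln s, y))) t0 (t0 + 2 * PI) = circ t0 u s).
  { intros s Hs. unfold circ, CI. apply (RInt_ext (V := C_R_CompleteNormedModule)). intros x _. now rewrite polar_Cexp. }
  rewrite E0, !Ec in G by lra.
  specialize (G ltac:(lra) ltac:(lra)).
  assert (K : (Ci * (circ t0 u r' - circ t0 u r))%C = RtoC 0).
  { rewrite <- G.
    - ring.
    - intros x y Hx Hy. destruct (Hu (Cexp (x, y))) as [A HA].
      + unfold Cexp. rewrite Cmod_mult, Cmod_cis, Cmod_R, Rmult_1_r. simpl.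
        rewrite Rabs_right by (left; apply exp_pos).
        assert (L1 : exp (ln r) <= exp x) by (apply exp_monotone; lra).
        assert (L2 : exp x <= exp (ln r')) by (apply exp_monotone; lra).
        rewrite exp_ln in L1, L2 by lra. lra.
      + exists (A * Cexp (x, y))%C. apply cder_comp; auto. apply cder_Cexp. }
  symmetry. apply Cminus_eq0.
  replace (circ t0 u r' - circ t0 u r)%C with (- Ci * (Ci * (circ t0 u r' - circ t0 u r)))%C.
  - rewrite K. ring.
  - replace (- Ci * (Ci * (circ t0 u r' - circ t0 u r)))%C with
     (- (Ci * Ci) * (circ t0 u r' - circ t0 u r))%C by ring.
    replace (Ci * Ci)%C with (- (1))%C; [ring |].
    unfold Cmult, Ci, Copp, RtoC; simpl. f_equal; ring.
Qed.

Definition annulus (r1 r2 : R) (w : C) : Prop := r1 <= Cmod w <= r2.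

Lemma annulus_closed r1 r2 : limit_closed (annulus r1 r2).
Proof.
  intros z H. split.
  - apply le_epsilon. intros e He. destruct (H e He) as [w [[A B] D]].
    generalize (Cmod_le_add_sub w z). lra.
  - apply le_epsilon. intros e He. destruct (H e He) as [w [[A B] D]].
    generalize (Cmod_le_add_sub z w). rewrite (Cmod_minus_sym z). lra.
Qed.

Lemma tends_circle r t : tends (locally t) (fun t => RtoC r * cis t)%C (RtoC r * cis t)%C.
Proof. apply tends_mult; [apply tends_const | apply tends_cis]. Qed.

Lemma tends_on_circle E u r : 0 <= r -> cts_in E u -> (forall t, E (RtoC r * cis t)%C) ->
  forall t, tends (locally t) (fun t => u (RtoC r * cis t)%C) (u (RtoC r * cis t)%C).
Proof.
  intros Hr Hu HE t. apply tends_comp_within with E (RtoC r * cis t)%C.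
  - apply filter_forall. auto.
  - apply tends_circle.
  - now apply Hu.
Qed.

Lemma circ_is E t0 u r : 0 <= r -> cts_in E u -> (forall t, E (RtoC r * cis t)%C) ->
  isI (fun t => u (RtoC r * cis t)%C) t0 (t0 + 2 * PI) (circ t0 u r).
Proof.
  intros Hr Hu HE. apply CI_spec. apply exI_continuous; [generalize PI_RGT_0; lra |].
  intros t _. now apply (tends_on_circle E).
Qed.

Lemma circ_close E t0 u r v r' e : 0 <= r -> 0 <= r' -> cts_in E u -> cts_in E v ->
  (forall t, E (RtoC r * cis t)%C) -> (forall t, E (RtoC r' * cis t)%C) ->
  (forall t, Cmod (u (RtoC r * cis t)%C - v (RtoC r' * cis t)%C) <= e) ->
  Cmod (circ t0 u r - circ t0 v r') <= 2 * PI * e.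
Proof.
  intros Hr Hr' Hu Hv HE HE' He.
  replace (2 * PI * e) with ((t0 + 2 * PI - t0) * e) by ring.
  apply isI_norm_const with (fun t => u (RtoC r * cis t) - v (RtoC r' * cis t))%C.
  - generalize PI_RGT_0; lra.
  - auto.
  - apply isI_minus; now apply (circ_is E).
Qed.

Lemma circ_near E t0 u r M : limit_closed E -> (forall w, E w -> Cmod w <= M) -> cts_in E u ->
  0 <= r -> (forall t, E (RtoC r * cis t)%C) -> forall e, 0 < e -> exists d, 0 < d /\
  forall r', 0 <= r' -> (forall t, E (RtoC r' * cis t)%C) -> Rabs (r - r') < d ->
    Cmod (circ t0 u r - circ t0 u r') <= e.
Proof.
  intros Hc HM Hu Hr HE e He. assert (HPI := PI_RGT_0).
  assert (He' : 0 < e / (2 * PI)) by (apply Rdiv_lt_0_compat; lra).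
  destruct (unif_cont E u M Hc HM Hu _ He') as [d [Hd K]].
  exists d. split; auto. intros r' Hr' HE' Hdr.
  replace e with (2 * PI * (e / (2 * PI))) by (field; lra).
  apply (circ_close E); auto. intro t. left. apply K; auto.
  replace (RtoC r * cis t - RtoC r' * cis t)%C with (RtoC (r - r') * cis t)%C
    by (rewrite RtoC_minus; ring).
  now rewrite Cmod_mult, Cmod_cis, Cmod_R, Rmult_1_r.
Qed.

Theorem circ_const t0 u r1 r2 : 0 <= r1 -> r1 < r2 -> cts_in (annulus r1 r2) u ->
  (forall w, r1 < Cmod w < r2 -> exists A, cder u w A) -> circ t0 u r1 = circ t0 u r2.
Proof.
  intros H1 H12 Hu Hd. apply Cminus_eq0. apply Cmod_small_eq0. intros e He.
  assert (HE : forall r, r1 <= r <= r2 -> forall t, annulus r1 r2 (RtoC r * cis t)%C).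
  { intros r Hr t. unfold annulus. rewrite Cmod_polar; lra. }
  assert (HM : forall w, annulus r1 r2 w -> Cmod w <= r2) by (intros w [_ K]; auto).
  assert (He2 : 0 < e / 2) by lra.
  assert (HE1 := HE r1 ltac:(lra)). assert (HE2 := HE r2 ltac:(lra)).
  assert (H2 : 0 <= r2) by lra.
  destruct (circ_near _ t0 u r1 r2 (annulus_closed r1 r2) HM Hu H1 HE1 _ He2) as [d1 [Hd1 K1]].
  destruct (circ_near _ t0 u r2 r2 (annulus_closed r1 r2) HM Hu H2 HE2 _ He2) as [d2 [Hd2 K2]].
  set (h := Rmin (Rmin d1 d2) (r2 - r1) / 3).
  assert (A1 := Rmin_l (Rmin d1 d2) (r2 - r1)). assert (A2 := Rmin_r (Rmin d1 d2) (r2 - r1)).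
  assert (A3 := Rmin_l d1 d2). assert (A4 := Rmin_r d1 d2).
  assert (Hh : 0 < Rmin (Rmin d1 d2) (r2 - r1)).
  { apply Rmin_glb_lt; [apply Rmin_glb_lt; auto | lra]. }
  assert (B1 : Cmod (circ t0 u r1 - circ t0 u (r1 + h)) <= e / 2).
  { apply K1; [unfold h; lra | apply HE; unfold h; lra |].
    replace (r1 - (r1 + h)) with (- h) by ring. rewrite Rabs_Ropp, Rabs_right; unfold h; lra. }
  assert (B2 : Cmod (circ t0 u r2 - circ t0 u (r2 - h)) <= e / 2).
  { apply K2; [unfold h; lra | apply HE; unfold h; lra |].
    replace (r2 - (r2 - h)) with h by ring. rewrite Rabs_right; unfold h; lra. }
  assert (B3 : circ t0 u (r1 + h) = circ t0 u (r2 - h)).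
  { apply (circ_const_open t0 u r1 r2); auto; unfold h; lra. }
  rewrite B3 in B1. rewrite Cmod_minus_sym in B2.
  generalize (Cmod_sub_triangle (circ t0 u r1) (circ t0 u (r2 - h)) (circ t0 u r2)). lra.
Qed.

Lemma circ_0 t0 u : circ t0 u 0 = (RtoC (2 * PI) * u (RtoC 0))%C.
Proof.
  unfold circ. apply CI_eq.
  apply isI_ext with (fun _ => u (RtoC 0)); [generalize PI_RGT_0; lra | |].
  - intros t _. f_equal. ring.
  - apply isI_eq with (RtoC (t0 + 2 * PI - t0) * u (RtoC 0))%C; [f_equal; f_equal; ring |].
    apply isI_const.
Qed.

(** Mean value property; one singular point [y] is harmless because circular
    means depend continuously on the radius. *)
Lemma mean_value u y r : 0 < Cmod y < r -> cts_in (annulus 0 r) u ->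
  (forall w, 0 < Cmod w < r -> w <> y -> exists A, cder u w A) ->
  (RtoC (2 * PI) * u (RtoC 0))%C = circ 0 u r.
Proof.
  intros Hy Hu Hd. rewrite <- (circ_0 0).
  assert (Hsub : forall a b, 0 <= a -> b <= r -> cts_in (annulus a b) u).
  { intros a b Ha Hb w [A B]. generalize (Hu w ltac:(split; lra)). apply tends_le_filter.
    intros P. unfold within. apply filter_imp. intros x K [Kx Kx']. apply K. split; lra. }
  transitivity (circ 0 u (Cmod y)); apply circ_const; try lra; try (apply Hsub; lra).
  - intros w Hw. apply Hd; [lra |]. intros ->. lra.
  - intros w Hw. apply Hd; [lra |]. intros ->. lra.
Qed.

(** * Injective holomorphic functions *)

Lemma tends_nb_at (g : C -> C) w l : tends (nb w) g l -> g w = l.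
Proof.
  intro H. apply Cminus_eq0. apply Cmod_small_eq0. intros e He. destruct (H e He) as [d [Hd K]]. left.
  apply K. now rewrite Cminus_diag, Cmod_0.
Qed.

Lemma nb_near w e : 0 < e -> nb w (fun x => Cmod (x - w) < e).
Proof. intro He. exists e. auto. Qed.

Lemma nb_neq w y : w <> y -> nb w (fun x => x <> y).
Proof.
  intro H. assert (K := Cminus_neq0 _ _ H). apply Cmod_gt_0 in K.
  exists (Cmod (w - y)). split; auto. intros x Hx ->. rewrite Cmod_minus_sym in Hx. lra.
Qed.

Lemma cder_sub_const f z A c : cder f z A -> cder (fun x => f x - c)%C z A.
Proof.
  intro H. apply (cder_eq _ _ (A - 0)%C); [ring |]. apply cder_minus; auto. apply cder_const.
Qed.

Lemma deriv_zero_const f r y : (forall w, Cmod w < r -> cder f w 0) -> Cmod y < r ->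
  f y = f (RtoC 0).
Proof.
  intros H Hy. apply Cminus_eq0. apply Cmod_eq_0. apply Rle_antisym; [ | apply Cmod_ge_0].
  assert (Hr : forall s, 0 <= s <= 1 -> rder (fun s => f (0 + RtoC s * y)%C) s 0).
  { intros s Hs. apply (rder_eq _ _ (0 * y)%C); [ring |].
    apply (rder_comp (fun s => 0 + RtoC s * y)%C f).
    - apply rder_affine.
    - apply H. replace (0 + RtoC s * y)%C with (RtoC s * y)%C by ring.
      rewrite Cmod_mult, Cmod_R, Rabs_right by lra. generalize (Cmod_ge_0 y). nra. }
  assert (B := rder_bound (fun s => f (0 + RtoC s * y)%C) 0 0 1 ltac:(lra)). cbv beta in B.
  replace (0 + RtoC 1 * y)%C with y in B by ring.
  replace (0 + RtoC 0 * y)%C with (RtoC 0) in B by ring.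
  rewrite Rmult_0_l in B. apply B.
  - apply cts_on_tends. intros s Hs. eapply rder_tends. now apply Hr.
  - intros s Hs. exists (RtoC 0). split; [apply Hr; lra | rewrite Cmod_0; lra].
Qed.

(** If [f' 0 = 0], the difference quotients [q x y] of [f] in [x] are zero-free
    for each [y] with [f' y <> 0], so [1 / q x y] has the mean value property in
    [x] and [|q 0 y|] is bounded below for small [y].  But [q 0 y] tends to
    [f' 0 = 0], so [f'] vanishes near [0]. *)
Lemma injective_deriv_at_0 (f D : C -> C) (R0 : R) : 0 < R0 ->
  (forall w, Cmod w < R0 -> cder f w (D w)) ->
  (forall x y, Cmod x < R0 -> Cmod y < R0 -> f x = f y -> x = y) -> D (RtoC 0) <> RtoC 0.
Proof.
  intros HR Hf Hinj HD0. set (r := R0 / 2). assert (Hr : 0 < r < R0) by (unfold r; lra).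
  assert (H0 : Cmod 0 < R0) by (rewrite Cmod_0; auto).
  (* A positive lower bound on the circle of radius [r], obtained as the inverse of an upper bound
     for the reciprocal; by injectivity the denominator has no zero there. *)
  assert (Hm : exists m, 0 < m /\ forall x, Cmod x = r -> m <= Cmod (f x - f (RtoC 0))).
  { destruct (cts_in_bounded (annulus r r) (fun x => / (f x - f (RtoC 0)))%C r) as [B HB].
    - apply annulus_closed.
    - intros w [_ K]; auto.
    - intros w [K1 K2]. apply (tends_le_filter (F := nb w)); [apply nb_within |].
      apply (tends_inv (fun x => f x - f (RtoC 0))%C).
      + apply Cminus_neq0. intro E. apply Hinj in E; try lra; auto. subst w. rewrite Cmod_0 in K1. lra.
      + eapply (cder_tends (fun x => f x - f (RtoC 0))%C). apply cder_sub_const. apply Hf. lra.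
    - exists (/ (Rabs B + 1)). assert (0 <= Rabs B) by apply Rabs_pos. split.
      + apply Rinv_0_lt_compat. lra.
      + intros x Hx. specialize (HB x). unfold annulus in HB. specialize (HB ltac:(lra)).
        assert (Hne : (f x - f (RtoC 0))%C <> RtoC 0).
        { apply Cminus_neq0. intro E. apply Hinj in E; try lra. subst x. rewrite Cmod_0 in Hx. lra. }
        rewrite Cmod_inv in HB by auto. apply Cmod_gt_0 in Hne.
        rewrite <- (Rinv_inv (Cmod _)). apply Rinv_le_contravar.
        * now apply Rinv_0_lt_compat.
        * generalize (Rle_abs B). lra. }
  destruct Hm as [m [Hm0 Hm]].
  (* For [x] on the circle and small [y], [Cmod (x - y) <= 2 * r] and [Cmod (f x - f y) >= m / 2],
     so the inverse difference quotient is at most [/ delta]. *)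
  set (delta := m / 2 / (2 * r)). assert (Hdelta : 0 < delta) by (unfold delta; apply Rdiv_lt_0_compat; lra).
  destruct (cder_tends _ _ _ (Hf _ H0) (m / 2) ltac:(lra)) as [d1 [Hd1 K1]].
  assert (Hdom := Hf _ H0). rewrite HD0 in Hdom.
  assert (Hdelta2 : 0 < delta / 2) by lra.
  destruct (cder_domin _ _ _ _ Hdom Hdelta2) as [d2 [Hd2 K2]].
  set (eta := Rmin (Rmin d1 d2) r).
  assert (A1 := Rmin_l (Rmin d1 d2) r). assert (A2 := Rmin_r (Rmin d1 d2) r).
  assert (A3 := Rmin_l d1 d2). assert (A4 := Rmin_r d1 d2). fold eta in A1, A2.
  assert (Heta : 0 < eta) by (apply Rmin_glb_lt; [apply Rmin_glb_lt; auto | lra]).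
  assert (HD : forall y, Cmod y < eta -> D y = RtoC 0).
  { intros y Hy. destruct (Ceq_dec y 0) as [-> | Hy0]; auto.
    apply NNPP. intro HDy. assert (Hy0' := proj1 (Cmod_gt_0 y) Hy0).
    (* The value [/ D y] fills the gap at [x = y] continuously; [mean_value] tolerates exactly this
       one point where differentiability is not established. *)
    set (u := fun x => (match excluded_middle_informative (x = y) with
           | left _ => / D y | right _ => (x - y) / (f x - f y) end)%C).
    assert (Hux : forall w, w <> y -> Cmod w <= r -> exists A, cder u w A).
    { intros w Hw Hwr. eexists.
      apply cder_ext with (fun x => (x - y) / (f x - f y))%C.
      - generalize (nb_neq w y Hw). apply filter_imp. intros x Hx. unfold u.
        destruct excluded_middle_informative; tauto.
      - unfold u. destruct excluded_middle_informative; tauto.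
      - apply cder_mult; [apply cder_sub_const; apply cder_id |]. apply cder_inv.
        + apply Cminus_neq0. intro E. apply Hw. apply Hinj; auto; lra.
        + apply cder_sub_const. apply Hf. lra. }
    assert (Huc : cts_in (annulus 0 r) u).
    { intros w [_ Hw]. apply (tends_le_filter (F := nb w)); [apply nb_within |].
      destruct (Ceq_dec w y) as [-> | Hn].
      - destruct (Hf y ltac:(lra)) as [q [Hq E]].
        assert (Hqy := tends_nb_at _ _ _ Hq).
        apply tends_eq with (/ D y)%C.
        { unfold u. destruct excluded_middle_informative; tauto. }
        apply tends_ext with (fun x => / q x)%C.
        + generalize (filter_and _ _ E (nb_near y (R0 - r) ltac:(lra))).
          apply filter_imp. intros x [Ex Hx]. unfold u.
          destruct excluded_middle_informative as [-> | Hn]; [now rewrite Hqy |].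
          assert (Hxy := Cminus_neq0 _ _ Hn).
          assert (Hxr : Cmod x < R0) by (generalize (Cmod_le_add_sub x y); lra).
          assert (Hfxy : (f x - f y)%C <> RtoC 0).
          { apply Cminus_neq0. intro E'. apply Hn. apply Hinj; auto; lra. }
          rewrite Ex in Hfxy. rewrite Ex. field. split; auto.
          intro Q. apply Hfxy. rewrite Q. ring.
        + now apply tends_inv.
      - destruct (Hux w Hn Hw) as [A HA]. eapply cder_tends. apply HA. }
    assert (MV := mean_value u y r).
    specialize (MV ltac:(lra) Huc).
    assert (MV' : (RtoC (2 * PI) * u (RtoC 0))%C = circ 0 u r).
    { apply MV. intros w Hw Hn. apply Hux; auto. lra. }
    assert (HPI := PI_RGT_0).
    assert (Hb : Cmod (circ 0 u r) <= 2 * PI * / delta).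
    { replace (2 * PI) with (0 + 2 * PI - 0) by ring.
      apply isI_norm_const with (fun t => u (RtoC r * cis t)%C); [lra | |].
      - intros t _. set (x := (RtoC r * cis t)%C).
        assert (Hx : Cmod x = r) by (apply Cmod_polar; lra).
        unfold u. destruct excluded_middle_informative as [E | Hn].
        { rewrite <- E in Hy. lra. }
        assert (Hfxy : m / 2 <= Cmod (f x - f y)).
        { assert (Q := Hm x Hx). specialize (K1 y). replace (y - 0)%C with y in K1 by ring.
          specialize (K1 ltac:(lra)).
          generalize (Cmod_sub_triangle (f x) (f y) (f (RtoC 0))). lra. }
        assert (Hfn : (f x - f y)%C <> RtoC 0) by (apply Cmod_gt_0; lra).
        rewrite Cmod_div by auto.
        assert (Hxy : Cmod (x - y) <= 2 * r).
        { unfold Cminus. eapply Rle_trans; [apply Cmod_triangle |]. rewrite Cmod_opp. lra. }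
        unfold delta. replace (/ (m / 2 / (2 * r))) with (2 * r * / (m / 2)) by (field; lra).
        unfold Rdiv. apply Rmult_le_compat; auto.
        + apply Cmod_ge_0.
        + left. apply Rinv_0_lt_compat. lra.
        + apply Rinv_le_contravar; lra.
      - apply (circ_is (annulus 0 r)); [lra | exact Huc |].
        intro t. unfold annulus. rewrite Cmod_polar; lra. }
    rewrite <- MV', Cmod_mult, Cmod_R, Rabs_right in Hb by lra.
    apply Rmult_le_reg_l in Hb; [ | lra].
    specialize (K2 y). replace (y - 0)%C with y in K2 by ring.
    specialize (K2 ltac:(lra)). replace (f y - f (RtoC 0) - 0 * y)%C with (f y - f (RtoC 0))%C in K2 by ring.
    assert (Hfy : (f y - f (RtoC 0))%C <> RtoC 0).
    { apply Cminus_neq0. intro E. apply Hy0. apply Hinj; auto; lra. }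
    unfold u in Hb. destruct excluded_middle_informative as [E | Hn]; [now subst y |].
    replace ((0 - y) / (f (RtoC 0) - f y))%C with (y / (f y - f (RtoC 0)))%C in Hb.
    2: { field. split; auto. intro Q. apply Hfy.
         replace (f y - f (RtoC 0))%C with (- (f (RtoC 0) - f y))%C by ring. rewrite Q. ring. }
    rewrite Cmod_div in Hb by auto. apply Cmod_gt_0 in Hfy.
    apply Rle_div_l in Hb; auto.
    (* The mean value property bounds [Cmod y] by [/ delta * Cmod (f y - f 0)], while the vanishing
       derivative at 0 bounds [Cmod (f y - f 0)] by [delta / 2 * Cmod y]. *)
    assert (Cmod y <= / delta * (delta / 2 * Cmod y)).
    { eapply Rle_trans; [apply Hb |]. apply Rmult_le_compat_l; auto.
      left. now apply Rinv_0_lt_compat. }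
    replace (/ delta * (delta / 2 * Cmod y)) with (Cmod y / 2) in H by (field; lra). lra. }
  assert (Hc : forall y, Cmod y < eta -> f y = f (RtoC 0)).
  { intros y Hy. apply deriv_zero_const with eta; auto. intros w Hw.
    rewrite <- (HD w Hw). apply Hf. lra. }
  set (y := RtoC (eta / 2)).
  assert (Hy : Cmod y = eta / 2) by (unfold y; rewrite Cmod_R, Rabs_right; lra).
  assert (E := Hc y ltac:(lra)). apply Hinj in E; auto; [ | lra].
  rewrite E, Cmod_0 in Hy. lra.
Qed.

Lemma injective_deriv (f : C -> C) (z A : C) (R0 : R) : 0 < R0 ->
  (forall w, Cmod (w - z) < R0 -> exists B, cder f w B) ->
  (forall x y, Cmod (x - z) < R0 -> Cmod (y - z) < R0 -> f x = f y -> x = y) ->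
  cder f z A -> A <> RtoC 0.
Proof.
  intros HR Hf Hinj HA.
  assert (Hf' : forall w, exists B, (Cmod w < R0 -> cder (fun x => f (z + x)%C) w B) /\ (w = RtoC 0 -> B = A)).
  { intro w. destruct (classic (Cmod w < R0)) as [Hw | Hw].
    - destruct (Ceq_dec w 0) as [-> | Hn].
      + exists A. split; auto. intros _. apply (cder_eq _ _ (A * (0 + 1))%C); [ring |].
        apply (cder_comp (fun x => z + x)%C f).
        * apply cder_plus; [apply cder_const | apply cder_id].
        * replace (z + 0)%C with z by ring. auto.
      + destruct (Hf (z + w)%C) as [B HB].
        { replace (z + w - z)%C with w by ring. auto. }
        exists (B * (0 + 1))%C. split; [ | tauto]. intros _.
        apply (cder_comp (fun x => z + x)%C f); auto.
        apply cder_plus; [apply cder_const | apply cder_id].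
    - exists A. tauto. }
  apply choice in Hf'. destruct Hf' as [D HD].
  rewrite <- (proj2 (HD (RtoC 0)) eq_refl).
  apply (injective_deriv_at_0 (fun x => f (z + x)%C) D R0); auto.
  - intros w. apply HD.
  - intros x y Hx Hy E. apply Hinj in E.
    + replace x with (z + x - z)%C by ring. rewrite E. ring.
    + replace (z + x - z)%C with x by ring. auto.
    + replace (z + y - z)%C with y by ring. auto.
Qed.

(** * Connected sets and components *)

Lemma open_nb (U : C -> Prop) z : open (T := C_UniformSpace) U -> U z -> nb z U.
Proof. intros HU Hz. apply locally_C_nb. now apply HU. Qed.

Lemma nb_open (U : C -> Prop) : (forall z, U z -> nb z U) -> open (T := C_UniformSpace) U.
Proof. intros H z Hz. apply locally_C_nb. auto. Qed.

Definition convex (A : C -> Prop) : Prop :=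
  forall x y, A x -> A y -> forall s, 0 <= s <= 1 -> A (x + RtoC s * (y - x))%C.

Lemma tends_affine (c d : C) s : tends (locally s) (fun s => c + RtoC s * d)%C (c + RtoC s * d)%C.
Proof. eapply rder_tends. apply rder_affine. Qed.

Lemma rder_locally_const (G : R -> C) s : locally s (fun t => G t = G s) -> rder G s 0.
Proof.
  intro H. exists (fun _ => RtoC 0). split; [apply tends_const |].
  revert H. apply filter_imp. intros t ->. ring.
Qed.

(** Along the segment between a point of [U] and a point of [V], the indicator of [U] would be
    locally constant. Its derivative is then 0, and the mean value inequality forces equal values at
    the two ends. *)
Lemma convex_connected A : convex A -> connected_set A.
Proof.
  intros HA U V HU HV Hcov [x [Ax Ux]] [y [Ay Vy]]. apply NNPP. intro Hd.
  set (p := fun s => (x + RtoC s * (y - x))%C).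
  assert (Hp : forall s, 0 <= s <= 1 -> A (p s)) by (intros; now apply HA).
  set (G := fun s => match excluded_middle_informative (U (p s)) with
             left _ => RtoC 0 | right _ => RtoC 1 end).
  assert (HG : forall s, 0 <= s <= 1 -> locally s (fun t => 0 <= t <= 1 -> G t = G s)).
  { intros s Hs. assert (Hps := tends_affine x (y - x)%C s). fold p in Hps.
    unfold G at 2. destruct excluded_middle_informative as [K | K].
    - destruct (open_nb U _ HU K) as [d [Hd0 Hd1]]. generalize (Hps d Hd0).
      apply filter_imp. intros t Ht Ht'. unfold G.
      destruct excluded_middle_informative as [Q | Q]; auto. destruct Q. now apply Hd1.
    - assert (K' : V (p s)) by (destruct (Hcov _ (Hp s Hs)); tauto).
      destruct (open_nb V _ HV K') as [d [Hd0 Hd1]]. generalize (Hps d Hd0).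
      apply filter_imp. intros t Ht Ht'. unfold G.
      destruct excluded_middle_informative as [Q | Q]; auto. destruct Hd.
      exists (p t). repeat split; auto. }
  assert (B := rder_bound G 0 0 1 Rle_0_1).
  assert (E : Cmod (G 1 - G 0) <= 0 * (1 - 0)).
  { apply B.
    - intros s Hs e He. generalize (HG s Hs). unfold within. apply filter_imp.
      intros t Ht Ht'. rewrite Ht by auto. now rewrite Cminus_diag, Cmod_0.
    - intros s Hs. exists (RtoC 0). split; [ | rewrite Cmod_0; lra].
      assert (Hs' : 0 <= s <= 1) by lra.
      apply rder_locally_const. generalize (filter_and _ _ (HG s Hs') (clamp_near 0 1 s Hs)).
      apply filter_imp. intros t [K1 K2]. apply K1. rewrite <- K2. apply clamp_in. lra. }
  unfold G in E. replace (p 1) with y in E by (unfold p; ring).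
  replace (p 0) with x in E by (unfold p; ring).
  destruct excluded_middle_informative as [K | K].
  - destruct Hd. exists y. auto.
  - destruct excluded_middle_informative; [ | tauto].
    replace (RtoC 1 - RtoC 0)%C with (RtoC 1) in E by ring. rewrite Cmod_1 in E. lra.
Qed.

Lemma ball_convex z r : convex (fun w => Cmod (w - z) < r).
Proof.
  intros x y Hx Hy s Hs.
  replace (x + RtoC s * (y - x) - z)%C with (RtoC (1 - s) * (x - z) + RtoC s * (y - z))%C
    by (rewrite RtoC_minus; ring).
  eapply Rle_lt_trans; [apply Cmod_triangle |].
  rewrite !Cmod_mult, !Cmod_R, !Rabs_right by lra.
  destruct (Req_dec s 0) as [-> | Hn]; [lra |].
  apply Rle_lt_trans with ((1 - s) * r + s * Cmod (y - z)); [nra |].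
  assert (0 < s) by lra. nra.
Qed.

Lemma component_trans E x y z : component E x y -> component E y z -> component E x z.
Proof.
  intros [A [A1 [A2 [A3 A4]]]] [B [B1 [B2 [B3 B4]]]].
  exists (fun w => A w \/ B w). split; [ | repeat split; auto; intros w []; auto].
  intros U V HU HV Hcov [u [Hu Uu]] [v [Hv Vv]].
  assert (CA : (exists z, A z /\ U z) -> (exists z, A z /\ V z) ->
     exists z, (A z \/ B z) /\ U z /\ V z).
  { intros H K. destruct (A1 U V HU HV) as [w Hw]; auto. exists w. tauto. }
  assert (CB : (exists z, B z /\ U z) -> (exists z, B z /\ V z) ->
     exists z, (A z \/ B z) /\ U z /\ V z).
  { intros H K. destruct (B1 U V HU HV) as [w Hw]; auto. exists w. tauto. }
  destruct (Hcov y (or_introl A4)) as [Uy | Vy].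
  - destruct Hv as [Hv | Hv]; [apply CA | apply CB]; eauto.
  - destruct Hu as [Hu | Hu]; [apply CA | apply CB]; eauto.
Qed.

Lemma component_sym E x y : component E x y -> component E y x.
Proof. intros [A H]. exists A. tauto. Qed.

(** A bound for the continuous function [/ G] takes the place of an attained minimum. *)
Lemma cts_on_away G a b : a <= b -> cts_on a b G -> (forall t, a <= t <= b -> G t <> RtoC 0) ->
  exists c, 0 < c /\ forall t, a <= t <= b -> c <= Cmod (G t).
Proof.
  intros Hab HG Hn. destruct (cts_on_bounded (fun t => / G t)%C a b Hab) as [B HB].
  { intros s Hs. apply tends_inv; auto. }
  assert (0 <= Rabs B) by apply Rabs_pos.
  exists (/ (Rabs B + 1)). split; [apply Rinv_0_lt_compat; lra |].
  intros t Ht. specialize (HB t Ht). assert (Hnt := Hn t Ht).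
  rewrite Cmod_inv in HB by auto. apply Cmod_gt_0 in Hnt.
  rewrite <- (Rinv_inv (Cmod _)). apply Rinv_le_contravar.
  - now apply Rinv_0_lt_compat.
  - generalize (Rle_abs B). lra.
Qed.

(** * The sign of the Cauchy kernel at a crossing *)

Lemma Re_nonneg_near_1 (z : C) : Cmod (z - 1) <= 1 -> 0 <= Re z.
Proof.
  intro H. assert (K := Rle_trans _ _ _ (re_le_Cmod _) H).
  apply Rabs_le_between in K. unfold Re, Cminus, Cplus, Copp, RtoC in *; simpl in *. lra.
Qed.

Lemma Re_div_nonneg (z N : C) : N <> RtoC 0 -> 0 <= Re (z * Cconj N)%C -> 0 <= Re (z / N)%C.
Proof.
  intros HN H. assert (HN' := proj1 (Cmod_gt_0 N) HN).
  replace (z / N)%C with (RtoC (/ Cmod N ^ 2) * (z * Cconj N))%C.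
  - replace (Re (RtoC (/ Cmod N ^ 2) * (z * Cconj N))) with (/ Cmod N ^ 2 * Re (z * Cconj N)%C)
      by (unfold Re, Cmult, RtoC; simpl; ring).
    apply Rmult_le_pos; auto. left. apply Rinv_0_lt_compat. now apply pow_lt.
  - assert (HN2 : Cmod N ^ 2 <> 0) by (apply Rgt_not_eq; now apply pow_lt).
    rewrite RtoC_inv by auto. rewrite Cmod2_conj.
    field. split; auto. intro E. apply HN. apply Cmod_eq_0. rewrite <- Cmod_conj, E. apply Cmod_0.
Qed.

(** The integrand of the jump of the winding number across the curve, in
    coordinates where the tangent is 1 and the normal is [i]. *)
Lemma jump_sign (x x' : C) (tau e : R) : Cmod (x - 1) <= / 10 -> Cmod (x' - 1) <= / 10 -> 0 < e ->
  (RtoC tau * x + RtoC e * Ci)%C <> RtoC 0 -> (RtoC tau * x - RtoC e * Ci)%C <> RtoC 0 ->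
  Im (x' / (RtoC tau * x + RtoC e * Ci) - x' / (RtoC tau * x - RtoC e * Ci))%C <= 0.
Proof.
  intros Hx Hx' He N1 N2.
  (* With [N] the product of the two denominators, the difference of the kernels is
     [- 2 i e x' / N], so everything rests on the sign of the real part of [x' / N]. *)
  set (N := (RtoC (tau ^ 2) * (x * x) + RtoC (e ^ 2))%C).
  assert (EN : N = ((RtoC tau * x + RtoC e * Ci) * (RtoC tau * x - RtoC e * Ci))%C).
  { transitivity (RtoC (tau ^ 2) * (x * x) - RtoC (e ^ 2) * (Ci * Ci))%C.
    - unfold N. replace (Ci * Ci)%C with (- (1))%C; [ring |].
      unfold Cmult, Ci, Copp, RtoC; simpl. f_equal; ring.
    - simpl pow. rewrite !RtoC_mult. ring. }
  assert (HN : N <> RtoC 0) by (rewrite EN; now apply Cmult_neq_0).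
  replace (x' / (RtoC tau * x + RtoC e * Ci) - x' / (RtoC tau * x - RtoC e * Ci))%C with
    (RtoC (- 2 * e) * Ci * (x' / N))%C.
  2: { rewrite EN, RtoC_mult. replace (RtoC (-2)) with (- (1 + 1))%C.
       - field. split; auto.
       - unfold Cplus, Copp, RtoC; simpl. f_equal; ring. }
  replace (Im (RtoC (- 2 * e) * Ci * (x' / N))) with (- 2 * e * Re (x' / N)%C)
    by (unfold Re, Im, Cmult, Ci, RtoC; simpl; ring).
  assert (K : 0 <= Re (x' / N)%C); [ | nra].
  apply Re_div_nonneg; auto.
  (* Both real parts are nonnegative: [x'] is within 1/10 of 1, and [x' * Cconj (x * x)] is within
     11/10 * 21/100 + 1/10, which is below 1. *)
  replace (Re (x' * Cconj N)) with (tau ^ 2 * Re (x' * Cconj (x * x))%C + e ^ 2 * Re x')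
    by (unfold N, Re, Cconj, Cmult, Cplus, RtoC; simpl; ring).
  assert (C1 : Cmod x <= 11 / 10).
  { generalize (Cmod_le_add_sub x 1). rewrite Cmod_1. lra. }
  assert (C2 : Cmod x' <= 11 / 10).
  { generalize (Cmod_le_add_sub x' 1). rewrite Cmod_1. lra. }
  assert (C3 : Cmod (x * x - 1) <= 21 / 100).
  { replace (x * x - 1)%C with ((x + 1) * (x - 1))%C by ring. rewrite Cmod_mult.
    assert (Cmod (x + 1) <= 21 / 10).
    { eapply Rle_trans; [apply Cmod_triangle |]. rewrite Cmod_1. lra. }
    replace (21 / 100) with (21 / 10 * / 10) by field.
    apply Rmult_le_compat; auto; apply Cmod_ge_0. }
  apply Rplus_le_le_0_compat; apply Rmult_le_pos; try apply pow2_ge_0; apply Re_nonneg_near_1; [ | lra].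
  replace (x' * Cconj (x * x) - 1)%C with (x' * Cconj (x * x - 1) + (x' - 1))%C.
  - eapply Rle_trans; [apply Cmod_triangle |]. rewrite Cmod_mult, Cmod_conj.
    assert (Cmod x' * Cmod (x * x - 1) <= 11 / 10 * (21 / 100)); [ | lra].
    apply Rmult_le_compat; auto; apply Cmod_ge_0.
  - unfold Cconj, Cmult, Cminus, Cplus, Copp, RtoC; simpl. f_equal; ring.
Qed.

(** * Simple closed curves, monotone parameters and angles *)

(** Injectivity made quantitative at an interior parameter, by compactness on the two intervals away
    from [t0]. It yields continuity of the inverse of the curve, and it keeps the Cauchy kernel
    bounded far from a crossing. *)
Lemma simple_separated gamma a b t0 eta : cts_on a b gamma -> simple_closed gamma a b ->
  a < t0 < b -> 0 < eta ->
  exists c, 0 < c /\ forall t, a <= t <= b -> eta <= Rabs (t - t0) -> c <= Cmod (gamma t - gamma t0).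
Proof.
  intros Hcts [Hab [Hcl Hinj]] Ht0 Heta.
  set (h := Rmin eta (Rmin (t0 - a) (b - t0)) / 2).
  assert (A1 := Rmin_l eta (Rmin (t0 - a) (b - t0))). assert (A2 := Rmin_r eta (Rmin (t0 - a) (b - t0))).
  assert (A3 := Rmin_l (t0 - a) (b - t0)). assert (A4 := Rmin_r (t0 - a) (b - t0)).
  assert (A5 : 0 < Rmin eta (Rmin (t0 - a) (b - t0))).
  { apply Rmin_glb_lt; [auto | apply Rmin_glb_lt; lra]. }
  assert (Hne : forall t, a <= t <= b -> t <> t0 -> (gamma t - gamma t0)%C <> RtoC 0).
  { intros t Ht Hn. apply Cminus_neq0. intro E. destruct (Req_dec t b) as [-> | Hb].
    - rewrite <- Hcl in E. apply Hinj in E; lra.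
    - apply Hinj in E; lra. }
  assert (Hc : cts_on a b (fun t => gamma t - gamma t0)%C).
  { intros s Hs. apply tends_minus; [apply Hcts; auto | apply tends_const]. }
  destruct (cts_on_away (fun t => gamma t - gamma t0)%C a (t0 - h)) as [c1 [Hc1 K1]].
  - unfold h; lra.
  - eapply cts_on_sub; [ | | apply Hc]; unfold h; lra.
  - intros t Ht. apply Hne; unfold h in *; lra.
  - destruct (cts_on_away (fun t => gamma t - gamma t0)%C (t0 + h) b) as [c2 [Hc2 K2]].
    + unfold h; lra.
    + eapply cts_on_sub; [ | | apply Hc]; unfold h; lra.
    + intros t Ht. apply Hne; unfold h in *; lra.
    + exists (Rmin c1 c2). split; [now apply Rmin_glb_lt |].
      intros t Ht Hte. destruct (Rle_dec t t0) as [Q | Q].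
      * rewrite Rabs_left1 in Hte by lra. eapply Rle_trans; [apply Rmin_l | apply K1].
        unfold h; lra.
      * rewrite Rabs_right in Hte by lra. eapply Rle_trans; [apply Rmin_r | apply K2].
        unfold h; lra.
Qed.

Lemma cts_on_unif G a b : cts_on a b G -> forall e, 0 < e -> exists d, 0 < d /\
  forall s t, a <= s <= b -> a <= t <= b -> Rabs (s - t) < d -> Cmod (G s - G t) < e.
Proof.
  intros HG e He.
  (* The interval is placed on the real axis of the plane, so that [unif_cont] can be reused. *)
  set (E := fun z : C => a <= Re z <= b /\ Im z = 0).
  destruct (unif_cont E (fun z => G (Re z)) (Rabs a + Rabs b)) with (e := e) as [d [Hd K]]; auto.
  - intros z H. split.
    + split; apply le_epsilon; intros e' He'; destruct (H e' He') as [w [[K1 K2] K3]];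
        assert (Q := Rle_lt_trans _ _ _ (re_le_Cmod _) K3); apply Rabs_lt_between in Q;
        unfold Re, Cminus, Cplus, Copp in *; simpl in *; lra.
    + apply Rle_antisym; apply le_epsilon; intros e' He'; destruct (H e' He') as [w [[K1 K2] K3]];
        assert (Q := Rle_lt_trans _ _ _ (im_le_Cmod _) K3); apply Rabs_lt_between in Q;
        unfold Im, Cminus, Cplus, Copp in *; simpl in *; lra.
  - intros w [K1 K2]. eapply Rle_trans; [apply Cmod_le_parts |]. rewrite K2, Rabs_R0.
    unfold Rabs; repeat destruct Rcase_abs; lra.
  - intros w [K1 K2] e' He'. destruct (HG (Re w) K1 e' He') as [d Hd].
    exists d. split; [apply cond_pos |]. intros w' Hw' [K3 K4]. apply Hd; auto.
    eapply Rle_lt_trans; [ | apply Hw']. apply (re_le_Cmod (w' - w)).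
  - exists d. split; auto. intros s t Hs Ht Hst.
    apply (K (RtoC s) (RtoC t)); [split; auto | split; auto |].
    rewrite <- RtoC_minus, Cmod_R. auto.
Qed.

Lemma clamp_continuity a b t : continuity_pt (clamp a b) t.
Proof.
  apply continuity_pt_filterlim. intros P [e He]. exists e. intros s Hs. apply He.
  eapply Rle_lt_trans; [apply clamp_lip | exact Hs].
Qed.

(** Given a pair on which [T] decreases and one on which it increases, the ordered pairs are joined
    linearly while [X s < Y s] persists. The intermediate value theorem then finds
    [T (X s) = T (Y s)], against injectivity. The clamp makes the path continuous on all of [R]. *)
Lemma injective_monotone (T : R -> R) u v :
  (forall x, u < x < v -> continuity_pt T x) ->
  (forall x y, u < x < v -> u < y < v -> T x = T y -> x = y) ->
  (forall x y, u < x -> x < y -> y < v -> T x < T y) \/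
  (forall x y, u < x -> x < y -> y < v -> T y < T x).
Proof.
  intros Hc Hi. apply NNPP. intro H. apply not_or_and in H. destruct H as [N1 N2].
  assert (E1 : exists x1 y1, u < x1 /\ x1 < y1 /\ y1 < v /\ T y1 < T x1).
  { apply NNPP. intro K. apply N1. intros x y Hx Hxy Hy. apply Rnot_le_lt. intro Q.
    apply K. exists x, y. repeat split; auto. destruct Q as [Q | Q]; auto.
    apply Hi in Q; lra. }
  assert (E2 : exists x2 y2, u < x2 /\ x2 < y2 /\ y2 < v /\ T x2 < T y2).
  { apply NNPP. intro K. apply N2. intros x y Hx Hxy Hy. apply Rnot_le_lt. intro Q.
    apply K. exists x, y. repeat split; auto. destruct Q as [Q | Q]; auto.
    apply Hi in Q; lra. }
  destruct E1 as [x1 [y1 [A1 [A2 [A3 A4]]]]]. destruct E2 as [x2 [y2 [B1 [B2 [B3 B4]]]]].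
  set (X := fun s => (1 - clamp 0 1 s) * x1 + clamp 0 1 s * x2).
  set (Y := fun s => (1 - clamp 0 1 s) * y1 + clamp 0 1 s * y2).
  assert (HXY : forall s, u < X s /\ X s < Y s /\ Y s < v).
  { intro s. unfold X, Y. destruct (clamp_in 0 1 s Rle_0_1) as [C1 C2].
    set (c := clamp 0 1 s) in *.
    destruct (Req_dec c 0) as [-> | Hn]; [lra |]. assert (0 < c) by lra.
    repeat split; nra. }
  assert (HX : continuity X).
  { intro s. unfold X. assert (K := clamp_continuity 0 1 s). reg; auto. }
  assert (HY : continuity Y).
  { intro s. unfold Y. assert (K := clamp_continuity 0 1 s). reg; auto. }
  assert (HD : continuity (fun s => T (Y s) - T (X s))).
  { intro s. destruct (HXY s) as [C1 [C2 C3]].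
    apply (continuity_pt_minus (fun s => T (Y s)) (fun s => T (X s))).
    - apply (continuity_pt_comp Y T); [apply HY | apply Hc; lra].
    - apply (continuity_pt_comp X T); [apply HX | apply Hc; lra]. }
  destruct (IVT_gen (fun s => T (Y s) - T (X s)) 0 1 0 HD) as [s [_ Es]].
  - unfold X, Y. rewrite (clamp_id 0 1 0), (clamp_id 0 1 1) by lra.
    replace ((1 - 0) * y1 + 0 * y2) with y1 by ring. replace ((1 - 0) * x1 + 0 * x2) with x1 by ring.
    replace ((1 - 1) * y1 + 1 * y2) with y2 by ring. replace ((1 - 1) * x1 + 1 * x2) with x2 by ring.
    rewrite Rmin_left, Rmax_right by lra. lra.
  - destruct (HXY s) as [C1 [C2 C3]]. assert (Q : X s = Y s) by (apply Hi; lra). lra.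
Qed.

(** Continuity and range hold on the whole line, the identity on the given interval. Monotonicity is
    stated beside the record, because its direction varies. *)
Record monotone_param (g Y : R -> C) (a b u v : R) (T : R -> R) : Prop := {
  mp_cts : forall x, tends (locally x) (fun s => RtoC (T s)) (RtoC (T x));
  mp_range : forall x, a <= T x <= b;
  mp_eq : forall x, u <= x <= v -> g (T x) = Y x
}.

(** Continuity of [T] follows from injectivity of [g], as points of the curve
    close to [g (T x)] have parameter close to [T x]; at the end points, where
    [g a = g b], monotonicity excludes the wrong end. *)
Lemma increasing_param (g Y : R -> C) (T0 : R -> R) (a b u v : R) :
  cts_on a b g -> simple_closed g a b -> (forall x, tends (locally x) Y (Y x)) ->
  u < v -> Y u = g a -> Y v = g a ->
  (forall x, u < x < v -> a < T0 x < b /\ g (T0 x) = Y x) ->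
  (forall x y, u < x -> x < y -> y < v -> T0 x < T0 y) ->
  exists T, monotone_param g Y a b u v T /\ (forall x y, x <= y -> T x <= T y) /\ T u = a /\ T v = b.
Proof.
  intros Hg Hs HY Huv Eu Ev HT Hm. assert (Hs' := Hs). destruct Hs' as [Hab [Hcl Hinj]].
  (* [T0] is controlled only on the open interval; the two ends, mapped to the same point of the
     curve, receive the distinct parameters [a] and [b] by hand. *)
  set (T := fun x => if Rle_dec x u then a else if Rle_dec v x then b else T0 x).
  assert (Tl : forall x, x <= u -> T x = a) by (intros x Hx; unfold T; destruct Rle_dec; lra).
  assert (Tr : forall x, v <= x -> T x = b).
  { intros x Hx; unfold T. do 2 (destruct Rle_dec; try lra). }
  assert (Tm : forall x, u < x < v -> T x = T0 x).
  { intros x Hx; unfold T. do 2 (destruct Rle_dec; try lra). }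
  assert (Tin : forall x, a <= T x <= b).
  { intro x. destruct (Rle_dec x u); [rewrite Tl; lra |]. destruct (Rle_dec v x); [rewrite Tr; lra |].
    rewrite Tm by lra. destruct (HT x); lra. }
  assert (Tmono : forall x y, x <= y -> T x <= T y).
  { intros x y Hxy. destruct (Rle_dec x u); [rewrite (Tl x) by auto; apply Tin |].
    destruct (Rle_dec v y); [rewrite (Tr y) by auto; apply Tin |].
    rewrite !Tm by lra. destruct Hxy as [Hxy | ->]; [ | lra]. left. apply Hm; lra. }
  assert (Teq : forall x, u <= x <= v -> g (T x) = Y x).
  { intros x Hx. destruct (Req_dec x u) as [-> | N1]; [rewrite Tl by lra; auto |].
    destruct (Req_dec x v) as [-> | N2]; [rewrite Tr by lra; congruence |].
    rewrite Tm by lra. apply HT. lra. }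
  assert (Hends : forall e, 0 < e -> 2 * e < b - a -> exists c, 0 < c /\
     forall t, a <= t <= b -> Cmod (g t - g a) < c -> t < a + e \/ b - e < t).
  { intros e He He2.
    destruct (cts_on_away (fun t => g t - g a)%C (a + e) (b - e)) as [c [Hc K]].
    - lra.
    - intros s Hse. apply tends_minus; [ | apply tends_const].
      eapply (cts_on_sub g); [ | | apply Hg | ]; lra.
    - intros t Ht. apply Cminus_neq0. intro E. apply Hinj in E; lra.
    - exists c. split; auto. intros t Ht Hc'. destruct (Rlt_dec t (a + e)); auto.
      right. apply Rnot_le_lt. intro Q. specialize (K t ltac:(lra)). lra. }
  exists T. split; [ | split; [ | split]]; auto; [ | apply Tl; lra | apply Tr; lra].
  split; auto. intros x e He.
  assert (HYx := HY x).
  cut (locally x (fun y => Rabs (T y - T x) < e)).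
  { apply filter_imp. intros y Hy. now rewrite <- RtoC_minus, Cmod_R. }
  set (mid := (u + v) / 2). assert (Hmid : u < mid < v) by (unfold mid; lra).
  assert (Hmid' : a < T mid < b) by (rewrite Tm by auto; now apply HT).
  destruct (Rlt_dec x u) as [Q1 | Q1].
  { apply locally_R_iff. exists (u - x). split; [lra |]. intros y Hy.
    apply Rabs_lt_between in Hy. rewrite !Tl by lra. rewrite Rminus_diag, Rabs_R0. auto. }
  destruct (Rlt_dec v x) as [Q2 | Q2].
  { apply locally_R_iff. exists (x - v). split; [lra |]. intros y Hy.
    apply Rabs_lt_between in Hy. rewrite !Tr by lra. rewrite Rminus_diag, Rabs_R0. auto. }
  destruct (Req_dec x u) as [-> | N1]; [ | destruct (Req_dec x v) as [-> | N2]].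
  (* For [y] before [mid], [T y <= T mid < b - e1], so of the two alternatives in [Hends] only
     closeness to [a] survives; the third of [b - a] meets the condition [2 * e1 < b - a]. *)
  - set (e1 := Rmin e (Rmin (b - T mid) (b - a)) / 3).
    assert (A1 := Rmin_l e (Rmin (b - T mid) (b - a))). assert (A2 := Rmin_r e (Rmin (b - T mid) (b - a))).
    assert (A3 := Rmin_l (b - T mid) (b - a)). assert (A4 := Rmin_r (b - T mid) (b - a)).
    assert (A5 : 0 < Rmin e (Rmin (b - T mid) (b - a))) by (apply Rmin_glb_lt; [auto | apply Rmin_glb_lt; lra]).
    destruct (Hends e1 ltac:(unfold e1; lra) ltac:(unfold e1; lra)) as [c [Hc K]].
    destruct (proj1 (locally_R_iff _ _) (HYx c Hc)) as [d [Hd HdY]].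
    apply locally_R_iff. exists (Rmin d (mid - u)). split; [apply Rmin_glb_lt; lra |].
    intros y Hy. rewrite (Tl u) by lra.
    destruct (Rle_dec y u) as [Q | Q]; [rewrite Tl, Rminus_diag, Rabs_R0; auto |].
    assert (Hy1 := Rlt_le_trans _ _ _ Hy (Rmin_l _ _)). assert (Hy2 := Rlt_le_trans _ _ _ Hy (Rmin_r _ _)).
    apply Rabs_lt_between in Hy2. specialize (HdY y Hy1). rewrite Eu, <- Teq in HdY by lra.
    assert (R1 := Tin y). assert (R2 := Tmono y mid ltac:(lra)).
    rewrite Rabs_right by lra.
    destruct (K (T y) R1 HdY); unfold e1 in *; lra.
  - set (e1 := Rmin e (Rmin (T mid - a) (b - a)) / 3).
    assert (A1 := Rmin_l e (Rmin (T mid - a) (b - a))). assert (A2 := Rmin_r e (Rmin (T mid - a) (b - a))).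
    assert (A3 := Rmin_l (T mid - a) (b - a)). assert (A4 := Rmin_r (T mid - a) (b - a)).
    assert (A5 : 0 < Rmin e (Rmin (T mid - a) (b - a))) by (apply Rmin_glb_lt; [auto | apply Rmin_glb_lt; lra]).
    destruct (Hends e1 ltac:(unfold e1; lra) ltac:(unfold e1; lra)) as [c [Hc K]].
    destruct (proj1 (locally_R_iff _ _) (HYx c Hc)) as [d [Hd HdY]].
    apply locally_R_iff. exists (Rmin d (v - mid)). split; [apply Rmin_glb_lt; lra |].
    intros y Hy. rewrite (Tr v) by lra.
    destruct (Rle_dec v y) as [Q | Q]; [rewrite Tr, Rminus_diag, Rabs_R0; auto |].
    assert (Hy1 := Rlt_le_trans _ _ _ Hy (Rmin_l _ _)). assert (Hy2 := Rlt_le_trans _ _ _ Hy (Rmin_r _ _)).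
    apply Rabs_lt_between in Hy2. specialize (HdY y Hy1). rewrite Ev, <- Teq in HdY by lra.
    assert (R1 := Tin y). assert (R2 := Tmono mid y ltac:(lra)).
    rewrite Rabs_left1 by lra.
    destruct (K (T y) R1 HdY); unfold e1 in *; lra.
  - destruct (HT x) as [HTx _]; [lra |]. rewrite <- Tm in HTx by lra.
    destruct (simple_separated g a b (T x) e Hg Hs HTx He) as [c [Hc K]].
    destruct (proj1 (locally_R_iff _ _) (HYx c Hc)) as [d [Hd HdY]].
    apply locally_R_iff. exists (Rmin d (Rmin (x - u) (v - x))).
    split; [apply Rmin_glb_lt; [auto | apply Rmin_glb_lt; lra] |].
    intros y Hy.
    assert (Hy1 := Rlt_le_trans _ _ _ Hy (Rmin_l _ _)). assert (Hy2 := Rlt_le_trans _ _ _ Hy (Rmin_r _ _)).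
    assert (Hy3 := Rlt_le_trans _ _ _ Hy2 (Rmin_l _ _)). assert (Hy4 := Rlt_le_trans _ _ _ Hy2 (Rmin_r _ _)).
    apply Rabs_lt_between in Hy3. apply Rabs_lt_between in Hy4.
    specialize (HdY y Hy1). rewrite <- !Teq in HdY by lra.
    apply Rnot_le_lt. intro Q. specialize (K (T y) (Tin y) Q). lra.
Qed.

Lemma polar_angle w : Cmod w = 1 -> exists t, w = cis t.
Proof.
  intro H. assert (H2 := Cmod2_alt w). rewrite H in H2.
  assert (Hx : -1 <= Re w <= 1) by nra.
  assert (Hs : sin (acos (Re w)) = sqrt (1 - (Re w)²)) by (apply sin_acos; auto).
  assert (Hi : (Im w)² = 1 - (Re w)²) by (unfold Rsqr; lra).
  rewrite <- Hi, sqrt_Rsqr_abs in Hs.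
  destruct (Rle_dec 0 (Im w)) as [Q | Q].
  - exists (acos (Re w)). unfold cis. rewrite cos_acos, Hs, Rabs_right by (auto; lra). now destruct w.
  - exists (- acos (Re w)). unfold cis. rewrite cos_neg, sin_neg, cos_acos, Hs, Rabs_left by (auto; lra).
    rewrite Ropp_involutive. now destruct w.
Qed.

Lemma cis_inj x y : Rabs (x - y) < 2 * PI -> cis x = cis y -> x = y.
Proof.
  intros H E. assert (E1 := f_equal fst E). assert (E2 := f_equal snd E). simpl in E1, E2.
  assert (C1 : cos (x - y) = 1).
  { rewrite cos_minus, E1, E2. generalize (sin2_cos2 y). unfold Rsqr. lra. }
  set (h := (x - y) / 2). replace (x - y) with (2 * h) in C1 by (unfold h; field).
  rewrite cos_2a_sin in C1. assert (Hs : sin h = 0) by nra.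
  apply Rabs_lt_between in H.
  destruct (Rtotal_order h 0) as [Q | [Q | Q]].
  - assert (0 < sin (- h)) by (apply sin_gt_0; unfold h in *; lra). rewrite sin_neg in H0. lra.
  - unfold h in Q. lra.
  - assert (0 < sin h) by (apply sin_gt_0; unfold h in *; lra). lra.
Qed.

(** * Estimates for integrals between two parameters *)

Lemma isI_between G a b s s' : exI G a b -> a <= s <= b -> a <= s' <= b ->
  isI G s s' (CI G a s' - CI G a s)%C.
Proof.
  intros H Hs Hs'.
  assert (K : forall x, a <= x <= b -> isI G a x (CI G a x)).
  { intros x Hx. apply CI_spec. apply (ex_RInt_Chasles_1 (V := C_R_CompleteNormedModule) G a x b); auto. }
  apply isI_eq with (- CI G a s + CI G a s')%C; [ring |].
  apply isI_Chasles with a; auto. apply isI_swap. auto.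
Qed.

Lemma isI_norm_between G M a b s s' l : a <= s <= b -> a <= s' <= b ->
  (forall t, a <= t <= b -> Rabs (t - s) <= Rabs (s' - s) -> Cmod (G t) <= M) ->
  isI G s s' l -> Cmod l <= M * Rabs (s' - s).
Proof.
  intros Hs Hs' HM H. destruct (Rle_dec s s') as [Q | Q].
  - rewrite Rabs_right, Rmult_comm by lra. apply isI_norm_const with G; auto.
    intros t Ht. apply HM; [lra |]. rewrite !Rabs_right; lra.
  - rewrite Rabs_left, Rmult_comm by lra. rewrite <- Cmod_opp.
    replace (- (s' - s)) with (s - s') by ring. apply isI_norm_const with G; [lra | |].
    + intros t Ht. apply HM; [lra |]. rewrite !Rabs_left1; lra.
    + now apply isI_swap.
Qed.

Lemma isI_near_const (G : R -> C) (c : C) (u v e : R) (q : C) : u <= v -> (forall x, u <= x <= v -> Cmod (G x - c) <= e) ->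
  isI G u v q -> Cmod (q - RtoC (v - u) * c) <= (v - u) * e.
Proof.
  intros Huv H K. apply isI_norm_const with (fun x => G x - c)%C; auto.
  apply isI_minus; auto. apply isI_const.
Qed.

(** Telescoping in integrated form: the overlap of the two shifted integrals cancels and only end
    strips of width [d] remain. Divided by [d], their difference tends to [G v - G u] for a merely
    continuous [G]. *)
Lemma isI_shift_diff (G : R -> C) (u v d : R) : 0 <= d -> d <= v - u -> (forall x, tends (locally x) G (G x)) ->
  exists q0 q1 : C, isI G u (u + d) q0 /\ isI G (v - d) v q1 /\
    isI (fun x => G (x + d)%R - G x)%C u (v - d) (q1 - q0)%C.
Proof.
  intros Hd Hdv HG.
  assert (E : forall x y, x <= y -> isI G x y (CI G x y)).
  { intros x y Hxy. apply CI_spec. apply exI_continuous; auto. }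
  exists (CI G u (u + d)), (CI G (v - d) v).
  split; [apply E; lra |]. split; [apply E; lra |].
  assert (Hsum : (CI G u (u + d) + CI G (u + d) v = CI G u (v - d) + CI G (v - d) v)%C).
  { apply (isI_unique G u v).
    - apply isI_Chasles with (u + d); apply E; lra.
    - apply isI_Chasles with (v - d); apply E; lra. }
  apply isI_eq with (CI G (u + d) v - CI G u (v - d))%C.
  - replace (CI G (u + d) v) with
     (CI G u (u + d) + CI G (u + d) v - CI G u (u + d))%C by ring. rewrite Hsum. ring.
  - apply isI_minus; [ | apply E; lra]. apply isI_shift.
    replace (v - d + d) with v by ring. apply E; lra.
Qed.

(** * Power series *)

Notation is_Cseries := (is_series (K := C_AbsRing) (V := C_NormedModule)).

Definition psum (u : nat -> C) (n : nat) : C := sum_n (G := C_AbelianMonoid) u n.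

Lemma psum_S u n : psum u (S n) = (psum u n + u (S n))%C.
Proof. exact (sum_Sn (G := C_AbelianMonoid) u n). Qed.

Lemma psum_O u : psum u O = u O.
Proof. exact (sum_O (G := C_AbelianMonoid) u). Qed.

Lemma is_Cseries_tends (u : nat -> C) (l : C) : is_Cseries u l -> tends eventually (psum u) l.
Proof. intro H. apply filterlim_tends; [apply eventually_filter | exact H]. Qed.

Lemma tends_unique {T} (F : (T -> Prop) -> Prop) (FF : ProperFilter F) g l m :
  tends F g l -> tends F g m -> l = m.
Proof.
  intros H K. apply Cminus_eq0. apply Cmod_small_eq0. intros e He. assert (He2 : 0 < e / 2) by lra.
  destruct (filter_ex _ (filter_and _ _ (H _ He2) (K _ He2))) as [x [A B]].
  generalize (Cmod_sub_triangle l (g x) m). rewrite (Cmod_minus_sym l (g x)). lra.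
Qed.

Lemma series_tail (u : nat -> C) (l : C) (B : R) : (forall k, Cmod (u k) <= B / 2 ^ k) -> is_Cseries u l ->
  forall N, Cmod (l - psum u N) <= B / 2 ^ N.
Proof.
  intros Hu Hl N. apply is_Cseries_tends in Hl.
  assert (HB : 0 <= B).
  { generalize (Hu O) (Cmod_ge_0 (u O)). simpl. lra. }
  assert (K : forall j, Cmod (psum u (N + j) - psum u N) <= B / 2 ^ N - B / 2 ^ (N + j)).
  { induction j as [ | j IH].
    - rewrite Nat.add_0_r. replace (psum u N - psum u N)%C with (RtoC 0) by ring. rewrite Cmod_0. lra.
    - replace (N + S j)%nat with (S (N + j)) by lia. rewrite psum_S.
      replace (psum u (N + j) + u (S (N + j)) - psum u N)%C with
        ((psum u (N + j) - psum u N) + u (S (N + j)))%C by ring.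
      eapply Rle_trans; [apply Cmod_triangle |]. specialize (Hu (S (N + j))).
      rewrite (div_pow2_S B (N + j)) in IH. lra. }
  apply (tends_norm_le (F := eventually) (fun n => psum u n - psum u N)%C).
  - apply eventually_filter.
  - exists N. intros n Hn. replace n with (N + (n - N))%nat by lia.
    eapply Rle_trans; [apply K |]. assert (0 <= B / 2 ^ (N + (n - N))); [ | lra].
    apply Rdiv_le_0_compat; auto. apply two_pow_pos.
  - apply tends_minus; [exact Hl | apply tends_const].
Qed.

Lemma series_terms_bounded (u : nat -> C) (l : C) : is_Cseries u l -> exists B, forall k, Cmod (u k) <= B.
Proof.
  intro H. apply is_Cseries_tends in H. destruct (H 1 ltac:(lra)) as [N HN].
  assert (HK : exists B, forall k, (k <= N)%nat -> Cmod (u k) <= B).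
  { clear HN. induction N as [ | N [B HB]].
    - exists (Cmod (u O)). intros k Hk. replace k with O by lia. lra.
    - exists (Rmax B (Cmod (u (S N)))). intros k Hk. destruct (Nat.eq_dec k (S N)) as [-> | Q].
      + apply Rmax_r.
      + eapply Rle_trans; [apply HB; lia | apply Rmax_l]. }
  destruct HK as [B HB]. exists (Rmax B 2). intro k.
  destruct (Nat.le_gt_cases k N) as [Q | Q].
  - eapply Rle_trans; [apply HB; auto | apply Rmax_l].
  - eapply Rle_trans; [ | apply Rmax_r]. destruct k as [ | k]; [lia |].
    assert (H1 := HN (S k) ltac:(lia)). assert (H2 := HN k ltac:(lia)). rewrite psum_S in H1.
    replace (u (S k)) with ((psum u k + u (S k) - l) - (psum u k - l))%C by ring.
    unfold Cminus at 1. eapply Rle_trans; [apply Cmod_triangle |]. rewrite Cmod_opp. lra.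
Qed.

Section Entire.
Variables (c : nat -> C) (p : C -> C).
Hypothesis Hp : forall z, is_Cseries (fun k => c k * z ^ k)%C (p z).

Definition ppart (N : nat) (z : C) : C := psum (fun k => c k * z ^ k)%C N.

(** Convergence at the radius [2 * M'] bounds the terms there, hence by [B / 2 ^ k] on the disc of
    radius [M']; the tail is then dominated by a geometric one, uniformly. *)
Lemma ppart_unif M e : 0 < e -> exists N, forall z, Cmod z <= M -> Cmod (ppart N z - p z) <= e.
Proof.
  intro He. set (M' := Rabs M + 1). assert (HM' : 0 < M') by (unfold M'; generalize (Rabs_pos M); lra).
  destruct (series_terms_bounded _ _ (Hp (RtoC (2 * M')))) as [B HB].
  destruct (div_pow2_small B e He) as [N HN]. exists N. intros z Hz.
  assert (HzM : Cmod z <= M') by (unfold M'; generalize (Rle_abs M); lra).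
  rewrite Cmod_minus_sym. left. eapply Rle_lt_trans; [ | apply (HN N); lia].
  apply (series_tail (fun k => c k * z ^ k)%C); auto. intro k. specialize (HB k).
  rewrite Cmod_mult, Cmod_pow in *. rewrite Cmod_R, Rabs_right in HB by lra.
  apply -> Rle_div_r; [ | apply two_pow_pos].
  eapply Rle_trans; [ | apply HB]. rewrite Rmult_assoc. apply Rmult_le_compat_l; [apply Cmod_ge_0 |].
  rewrite Rpow_mult_distr, (Rmult_comm (2 ^ k)). apply Rmult_le_compat_r; [left; apply two_pow_pos |].
  apply pow_incr. split; auto. apply Cmod_ge_0.
Qed.

Lemma cder_ppart N z : exists A, cder (ppart N) z A.
Proof.
  induction N as [ | N [A IH]].
  - exists (RtoC 0). apply cder_ext with (fun _ => c O).
    + apply filter_forall. intro x. unfold ppart. rewrite psum_O. simpl. ring.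
    + unfold ppart. rewrite psum_O. simpl. ring.
    + apply cder_const.
  - destruct (cder_pow (fun x => x) (S N) z _ (cder_id z)) as [B HB].
    eexists. apply cder_ext with (fun x => ppart N x + c (S N) * x ^ S N)%C.
    + apply filter_forall. intro x. unfold ppart. now rewrite psum_S.
    + unfold ppart. now rewrite psum_S.
    + apply cder_plus; [exact IH |]. apply cder_mult; [apply cder_const | exact HB].
Qed.

Lemma tends_entire z : tends (nb z) p (p z).
Proof.
  intros e He. assert (He3 : 0 < e / 3) by lra.
  destruct (ppart_unif (Cmod z + 1) _ He3) as [N HN]. destruct (cder_ppart N z) as [A HA].
  generalize (filter_and _ _ (cder_tends _ _ _ HA _ He3) (nb_near z 1 Rlt_0_1)).
  apply filter_imp. intros x [H1 H2].
  assert (H3 := HN x ltac:(generalize (Cmod_le_add_sub x z); lra)).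
  assert (H4 := HN z ltac:(lra)). rewrite Cmod_minus_sym in H3.
  generalize (Cmod_sub_triangle (p x) (ppart N x) (p z)).
  generalize (Cmod_sub_triangle (ppart N x) (ppart N z) (p z)). lra.
Qed.
End Entire.

(** Of the [k + 1] factors [R0 / Cmod z], one is kept as the decay and the others are at most 1/2
    each, so the series is dominated by a geometric one. *)
Lemma laurent_tail_bound (R0 : R) (c' : nat -> C) (s0 : C) : 0 < R0 ->
  is_Cseries (fun k => c' k * (/ RtoC R0) ^ S k)%C s0 ->
  exists B, forall z s : C, 2 * R0 <= Cmod z -> is_Cseries (fun k => c' k * (/ z) ^ S k)%C s ->
    Cmod s <= B / Cmod z.
Proof.
  intros HR H. destruct (series_terms_bounded _ _ H) as [B HB].
  assert (HR0 : RtoC R0 <> RtoC 0) by (intro Q; apply RtoC_inj in Q; lra).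
  assert (HB0 : 0 <= B) by (eapply Rle_trans; [apply Cmod_ge_0 | apply (HB O)]).
  exists (B * (2 * R0)). intros z s Hz Hs.
  assert (Hz0 : z <> RtoC 0) by (apply Cmod_gt_0; lra).
  assert (Hq : 0 <= R0 / Cmod z <= / 2).
  { split; [apply Rdiv_le_0_compat; lra |]. apply Rle_div_l; lra. }
  assert (K : forall k, Cmod (c' k * (/ z) ^ S k) <= (B * (R0 / Cmod z)) / 2 ^ k).
  { intro k. specialize (HB k). rewrite Cmod_mult, Cmod_pow, Cmod_inv in * by auto.
    rewrite Cmod_R, Rabs_right in HB by lra.
    replace (/ Cmod z) with (/ R0 * (R0 / Cmod z)) by (field; lra).
    rewrite Rpow_mult_distr, <- Rmult_assoc.
    apply Rle_trans with (B * (R0 / Cmod z * / 2 ^ k)); [ | right; unfold Rdiv; ring].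
    apply Rmult_le_compat; auto.
    - apply Rmult_le_pos; [apply Cmod_ge_0 |]. apply pow_le. left. now apply Rinv_0_lt_compat.
    - apply pow_le. lra.
    - simpl. apply Rmult_le_compat_l; [lra |]. rewrite <- pow_inv. apply pow_incr. lra. }
  assert (T := series_tail _ _ _ K Hs O). rewrite psum_O in T. specialize (K O).
  rewrite pow_O, Rdiv_1_r in *.
  replace (B * (2 * R0) / Cmod z) with (B * (R0 / Cmod z) + B * (R0 / Cmod z)) by (field; lra).
  generalize (Cmod_le_add_sub s (c' O * (/ z) ^ 1)%C). lra.
Qed.

Lemma cder_pow_S n w : cder (fun x => x ^ S n)%C w (RtoC (INR (S n)) * w ^ n)%C.
Proof.
  induction n as [ | n IH].
  - apply cder_ext with (fun x => x); [apply filter_forall; intros; simpl; ring | simpl; ring |].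
    apply (cder_eq _ _ 1%C); [simpl; ring | apply cder_id].
  - apply (cder_eq _ _ (1 * w ^ S n + w * (RtoC (INR (S n)) * w ^ n))%C).
    + rewrite (S_INR (S n)), RtoC_plus. simpl Cpow. ring.
    + apply (cder_mult (fun x => x) (fun x => x ^ S n)%C); [apply cder_id | exact IH].
Qed.

(** * Real derivatives and the normal derivative of the logarithm *)

Lemma rder_is_derive (G : R -> C) (t : R) (A : C) :
  rder G t A -> is_derive (V := C_R_NormedModule) G t A.
Proof.
  intros [q [Hq E]]. split; [apply is_linear_scal_l |].
  intros x Hx. apply (is_filter_lim_locally_unique t x) in Hx. subst x. intros e.
  generalize (filter_and _ _ E (Hq e (cond_pos e))). apply filter_imp. intros s [E1 E2].
  assert (K : Cmod (G s - G t - RtoC (s - t) * A) <= e * Rabs (s - t)).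
  { rewrite E1. replace (q s * RtoC (s - t) - RtoC (s - t) * A)%C with ((q s - A) * RtoC (s - t))%C by ring.
    rewrite Cmod_mult, Cmod_R. apply Rmult_le_compat_r; [apply Rabs_pos | lra]. }
  rewrite <- minus_scal_C, Cmod_norm in K. exact K.
Qed.

(** [ln (Cmod (x - z))] is the real part of any local logarithm of [x - z], whose derivative along
    [nu y] is this quotient. The proof differentiates in coordinates and so avoids choosing a
    branch. *)
Lemma normal_derivative_log nu y z : y <> z ->
  normal_derivative nu (fun x => ln (Cmod (x - z))) y = Re (nu y / (y - z))%C.
Proof.
  intro Hyz. assert (Hn := Cminus_neq0 _ _ Hyz).
  set (w := (y - z)%C) in *. destruct w as [w1 w2] eqn:Ew. destruct (nu y) as [n1 n2] eqn:En.
  assert (Hpos : 0 < w1 * w1 + w2 * w2).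
  { apply Cmod_gt_0 in Hn. assert (K := Cmod2_alt (w1, w2)). simpl in K.
    assert (0 < Cmod (w1, w2) * (Cmod (w1, w2) * 1)) by (rewrite Rmult_1_r; now apply Rmult_lt_0_compat).
    lra. }
  unfold normal_derivative. rewrite En. apply is_derive_unique.
  apply is_derive_ext with (fun s => ln (sqrt ((w1 + s * n1) * (w1 + s * n1) + (w2 + s * n2) * (w2 + s * n2)))).
  - intro s. replace (y + RtoC s * (n1, n2) - z)%C with (w1 + s * n1, w2 + s * n2).
    + unfold Cmod; simpl. do 2 f_equal. ring.
    + replace (y + RtoC s * (n1, n2) - z)%C with (w + RtoC s * (n1, n2))%C by (unfold w; ring).
      rewrite Ew. unfold Cplus, Cmult, RtoC; simpl. f_equal; ring.
  - auto_derive.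
    + rewrite !Rmult_0_l, !Rplus_0_r. repeat split; auto. now apply sqrt_lt_R0.
    + rewrite !Rmult_0_l, !Rplus_0_r. unfold Re, Cdiv, Cinv, Cmult; simpl.
      set (q := sqrt (w1 * w1 + w2 * w2)).
      assert (Hq : q * q = w1 * w1 + w2 * w2) by (apply sqrt_sqrt; lra).
      assert (Hq0 : 0 < q) by now apply sqrt_lt_R0.
      replace (w1 * (w1 * 1) + w2 * (w2 * 1)) with (q * q) by (rewrite Hq; ring).
      field. lra.
Qed.

Section Curve.
Variables (gamma : R -> C) (a b : R).
Hypothesis pf : path_facts gamma a b.
Hypothesis Hsimple : simple_closed gamma a b.
Let Hab : a < b := proj1 Hsimple.
Let Hclosed : gamma a = gamma b := proj1 (proj2 Hsimple).
Let off := off_curve gamma a b.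

(** * The components of the complement of the curve *)

Lemma gamma_bound : exists M, 0 < M /\ forall t, a <= t <= b -> Cmod (gamma t) <= M.
Proof.
  destruct (cts_on_bounded gamma a b ltac:(lra) (pf_cts _ _ _ pf)) as [M HM].
  exists (Rabs M + 1). split; [generalize (Rabs_pos M); lra |].
  intros t Ht. generalize (HM t Ht) (Rle_abs M). lra.
Qed.

Lemma cts_on_inv_sub z : off z -> cts_on a b (fun t => / (gamma t - z))%C.
Proof.
  intros Hz s Hs. apply (tends_inv (fun t => gamma t - z)%C).
  - apply Cminus_neq0. intro E. apply Hz. exists s. auto.
  - apply tends_minus; [apply (pf_cts _ _ _ pf); auto | apply tends_const].
Qed.

Lemma off_dist z : off z -> exists r, 0 < r /\ forall t, a <= t <= b -> r <= Cmod (gamma t - z).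
Proof.
  intros Hz. apply (cts_on_away (fun t => gamma t - z)%C); [lra | |].
  - intros s Hs. apply tends_minus; [apply (pf_cts _ _ _ pf); auto | apply tends_const].
  - intros t Ht. apply Cminus_neq0. intro E. apply Hz. now exists t.
Qed.

Lemma off_of_dist z r : 0 < r -> (forall t, a <= t <= b -> r <= Cmod (gamma t - z)) -> off z.
Proof.
  intros Hr H [t [Ht E]]. specialize (H t Ht). rewrite E in H.
  replace (z - z)%C with (RtoC 0) in H by ring. rewrite Cmod_0 in H. lra.
Qed.

Lemma off_component z : off z -> nb z (component off z).
Proof.
  intros Hz. destruct (off_dist z Hz) as [r [Hr H]]. exists r. split; auto.
  intros w Hw. exists (fun w => Cmod (w - z) < r). split; [ | split; [ | split]]; auto.
  - apply convex_connected. apply ball_convex.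
  - intros x Hx [t [Ht E]]. specialize (H t Ht). rewrite E in H. lra.
  - now rewrite Cminus_diag, Cmod_0.
Qed.

Lemma component_off z w : component off z w -> off w.
Proof. intros [A [_ [H [_ K]]]]. auto. Qed.

Lemma inner_component z w : inner gamma a b z -> component off z w -> inner gamma a b w.
Proof.
  intros [Hz [M HM]] H. split; [now apply component_off with z |].
  exists M. intros x Hx. apply HM. eapply component_trans; eauto.
Qed.

Lemma outer_component z w : outer gamma a b z -> component off z w -> outer gamma a b w.
Proof.
  intros [Hz HM] H. split; [now apply component_off with z |].
  intros [M K]. apply HM. exists M. intros x Hx. apply K.
  eapply component_trans; [apply component_sym | ]; eauto.
Qed.

Lemma off_cases z : off z -> inner gamma a b z \/ outer gamma a b z.
Proof.
  intro Hz. destruct (classic (bounded_set (component (off_curve gamma a b) z))); [left | right];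
  split; auto.
Qed.

Lemma inner_not_outer z : inner gamma a b z -> ~ (outer gamma a b z \/ curve gamma a b z).
Proof. intros [H1 H2] [[H3 H4] | H3]; [exact (H4 H2) | exact (H1 H3)]. Qed.

Lemma outer_open z : outer gamma a b z -> nb z (outer gamma a b).
Proof.
  intro Hz. generalize (off_component z (proj1 Hz)). apply filter_imp.
  intros w. now apply outer_component.
Qed.

Lemma inner_open z : inner gamma a b z -> nb z (inner gamma a b).
Proof.
  intro Hz. generalize (off_component z (proj1 Hz)). apply filter_imp.
  intros w. now apply inner_component.
Qed.

Definition clo (z : C) : Prop := outer gamma a b z \/ curve gamma a b z.

Lemma clo_or_inner z : clo z \/ inner gamma a b z.
Proof.
  unfold clo. destruct (classic (curve gamma a b z)) as [H | H]; auto.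
  destruct (off_cases z H); auto.
Qed.

Lemma clo_closed : limit_closed clo.
Proof.
  intros z H. destruct (clo_or_inner z) as [K | K]; auto. exfalso.
  destruct (inner_open z K) as [d [Hd Q]]. destruct (H d Hd) as [w [Hw Hwd]].
  apply (inner_not_outer w); auto.
Qed.

Lemma outer_far : exists M, 0 < M /\ (forall t, a <= t <= b -> Cmod (gamma t) <= M) /\
  forall z, M < Cmod z -> outer gamma a b z.
Proof.
  destruct gamma_bound as [M [HM0 HM]]. exists M. repeat split; auto.
  - intros [t [Ht E]]. specialize (HM t Ht). rewrite E in HM. lra.
  - intros [B HB].
    assert (Hz : 0 < Cmod z) by lra.
    (* The ray from [z] away from the origin avoids the curve, and [s] below is chosen so that
       [Cmod (s z) = Cmod z + Rabs B], beyond the supposed bound. *)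
    set (A := fun x => exists s, 1 <= s /\ x = (RtoC s * z)%C).
    set (s := 1 + Rabs B / Cmod z).
    assert (Hs : 1 <= s).
    { unfold s. assert (0 <= Rabs B / Cmod z); [ | lra].
      apply Rdiv_le_0_compat; auto. apply Rabs_pos. }
    assert (K : component (off_curve gamma a b) z (RtoC s * z)%C).
    { exists A. split; [ | split; [ | split]].
      - apply convex_connected. intros x y [u [Hu ->]] [v [Hv ->]] r Hr.
        exists (u + r * (v - u)). split; [nra |]. rewrite RtoC_plus, RtoC_mult, RtoC_minus. ring.
      - intros x [u [Hu ->]] [t [Ht E]]. specialize (HM t Ht).
        rewrite E, Cmod_mult, Cmod_R, Rabs_right in HM by lra. nra.
      - exists 1. split; [lra | ring].
      - exists s. auto. }
    specialize (HB _ K). rewrite Cmod_mult, Cmod_R, Rabs_right in HB by lra.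
    unfold s in HB. rewrite Rmult_plus_distr_r in HB.
    replace (Rabs B / Cmod z * Cmod z) with (Rabs B) in HB by (field; lra).
    generalize (Rle_abs B). lra.
Qed.

(** * Winding numbers *)

(** The winding number times [2 pi i], left unnormalised to match [positively_oriented]. *)
Definition wind (z : C) : C := CI (fun t => velocity gamma t / (gamma t - z))%C a b.

Lemma wind_is z : off z -> isI (fun t => velocity gamma t / (gamma t - z))%C a b (wind z).
Proof.
  intro Hz. apply CI_spec. destruct (pf_exI _ _ _ pf _ (cts_on_inv_sub z Hz)) as [l Hl].
  exists l. revert Hl. apply isI_ext; [lra |]. intros t _. unfold Cdiv. ring.
Qed.

(** The first-order term of the expansion of [/ (gamma t - w)] at [z] is
    [(w - z) / (gamma t - z)^2]. It has the primitive [- / (x - z)] and integrates to 0 over the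
    closed curve. So [wind] has zero derivative, which makes it locally constant. *)
Lemma wind_quadratic z : off z -> exists K, nb z (fun w => Cmod (wind w - wind z) <= K * Cmod (w - z) ^ 2).
Proof.
  intro Hz. destruct (off_dist z Hz) as [r [Hr H]].
  destruct (pf_bound _ _ _ pf) as [L HL].
  exists ((b - a) * (/ (r / 2) * (/ r * / r) * L)). exists (r / 2). split; [lra |].
  intros w Hw.
  assert (Hw' : forall t, a <= t <= b -> r / 2 <= Cmod (gamma t - w)).
  { intros t Ht. specialize (H t Ht). generalize (Cmod_sub_triangle (gamma t) w z). lra. }
  assert (How : off w) by (apply (off_of_dist w (r / 2)); auto; lra).
  assert (Hne : forall t, a <= t <= b -> (gamma t - z)%C <> RtoC 0 /\ (gamma t - w)%C <> RtoC 0).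
  { intros t Ht. specialize (H t Ht). specialize (Hw' t Ht).
    split; apply Cmod_gt_0; lra. }
  assert (F : isI (fun t => / (gamma t - z) * / (gamma t - z) * velocity gamma t)%C a b (RtoC 0)).
  { apply isI_eq with (- / (gamma b - z) - - / (gamma a - z))%C; [rewrite Hclosed; ring |].
    apply (pf_FTC _ _ _ pf (fun x => - / (x - z))%C (fun x => / (x - z) * / (x - z))%C); [lra | |].
    - intros t Ht. destruct (Hne t Ht) as [N1 _].
      apply (cder_eq _ _ (- (- RtoC 1 / ((gamma t - z) * (gamma t - z))))%C); [field; auto |].
      apply (cder_opp (fun x => / (x - z))%C). apply (cder_inv (fun x => x - z)%C); auto.
      apply cder_sub_const. apply cder_id.
    - intros s Hs. apply (tends_mult (fun t => / (gamma t - z))%C (fun t => / (gamma t - z))%C);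
      apply (cts_on_inv_sub z Hz); auto. }
  assert (E : isI (fun t => (velocity gamma t / (gamma t - w) - velocity gamma t / (gamma t - z))
      - (w - z) * (/ (gamma t - z) * / (gamma t - z) * velocity gamma t))%C a b
      (wind w - wind z - (w - z) * 0)%C).
  { apply isI_minus; [apply isI_minus; now apply wind_is | now apply isI_scal]. }
  replace (wind w - wind z)%C with (wind w - wind z - (w - z) * 0)%C by ring.
  rewrite Rmult_assoc. apply (isI_norm_const _ _ _ _ _ (Rlt_le _ _ Hab)) with (2 := E).
  intros t Ht. destruct (Hne t Ht) as [N1 N2].
  replace (velocity gamma t / (gamma t - w) - velocity gamma t / (gamma t - z)
      - (w - z) * (/ (gamma t - z) * / (gamma t - z) * velocity gamma t))%C with
    (/ (gamma t - w) * (/ (gamma t - z) * / (gamma t - z)) * velocity gamma t * ((w - z) * (w - z)))%C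
    by (field; auto).
  rewrite !Cmod_mult, !Cmod_inv by auto.
  replace (Cmod (w - z) ^ 2) with (Cmod (w - z) * Cmod (w - z)) by ring.
  specialize (H t Ht). specialize (Hw' t Ht).
  assert (P1 : 0 <= / Cmod (gamma t - w)) by (left; apply Rinv_0_lt_compat; lra).
  assert (P2 : 0 <= / Cmod (gamma t - z)) by (left; apply Rinv_0_lt_compat; lra).
  assert (P3 := Cmod_ge_0 (velocity gamma t)). assert (P4 := Cmod_ge_0 (w - z)).
  assert (Q1 : / Cmod (gamma t - w) <= / (r / 2)) by (apply Rinv_le_contravar; lra).
  assert (Q2 : / Cmod (gamma t - z) <= / r) by (apply Rinv_le_contravar; lra).
  repeat (apply Rmult_le_compat; auto using Rmult_le_pos); lra.
Qed.

Lemma wind_segment p v : (forall s, 0 <= s <= 1 -> off (p + RtoC s * v)%C) ->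
  wind (p + v)%C = wind p.
Proof.
  intro Hoff. apply Cminus_eq0. apply Cmod_eq_0. apply Rle_antisym; [ | apply Cmod_ge_0].
  assert (Hr : forall s, 0 <= s <= 1 -> rder (fun s => wind (p + RtoC s * v)%C) s 0).
  { intros s Hs. destruct (wind_quadratic _ (Hoff s Hs)) as [K [d [Hd HK]]].
    apply rder_of_small. intros e He. set (B := Rabs K * Cmod v ^ 2 + 1).
    assert (HK0 : 0 <= Rabs K * Cmod v ^ 2) by (apply Rmult_le_pos; [apply Rabs_pos | apply pow2_ge_0]).
    assert (HeB : 0 < e / B) by (apply Rdiv_lt_0_compat; unfold B; lra).
    assert (Hst : locally s (fun t => Rabs (t - s) < e / B)) by (apply locally_R_iff; exists (e / B); auto).
    generalize (filter_and _ _ (tends_affine p v s d Hd) Hst).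
    apply filter_imp. intros t [Ht1 Ht2]. specialize (HK _ Ht1).
    replace (p + RtoC t * v - (p + RtoC s * v))%C with (RtoC (t - s) * v)%C in HK
      by (rewrite RtoC_minus; ring).
    rewrite Cmod_mult, Cmod_R in HK. set (h := Rabs (t - s)) in *.
    replace (wind (p + RtoC t * v) - wind (p + RtoC s * v) - RtoC (t - s) * RtoC 0)%C with
      (wind (p + RtoC t * v) - wind (p + RtoC s * v))%C by ring.
    assert (Hh : 0 <= h) by apply Rabs_pos.
    apply Rlt_div_r in Ht2; [ | unfold B; lra].
    assert (K * (h * Cmod v) ^ 2 <= Rabs K * (h * Cmod v) ^ 2)
      by (apply Rmult_le_compat_r; [apply pow2_ge_0 | apply Rle_abs]).
    replace (Rabs K * (h * Cmod v) ^ 2) with (Rabs K * Cmod v ^ 2 * h * h) in H by ring.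
    assert (Rabs K * Cmod v ^ 2 * h * h <= (h * B) * h) by (unfold B; nra).
    assert (h * B * h <= e * h) by (apply Rmult_le_compat_r; lra). lra. }
  assert (B := rder_bound (fun s => wind (p + RtoC s * v)%C) 0 0 1 Rle_0_1).
  cbv beta in B. replace (p + RtoC 1 * v)%C with (p + v)%C in B by ring.
  replace (p + RtoC 0 * v)%C with p in B by ring.
  rewrite Rmult_0_l in B. apply B.
  - apply cts_on_tends. intros s Hs. eapply rder_tends. now apply Hr.
  - intros s Hs. exists (RtoC 0). split; [apply Hr; lra | rewrite Cmod_0; lra].
Qed.

Lemma wind_locally_const z : off z -> nb z (fun w => wind w = wind z).
Proof.
  intro Hz. destruct (off_dist z Hz) as [r [Hr H]]. exists r. split; auto.
  intros w Hw. replace w with (z + (w - z))%C by ring. apply wind_segment.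
  intros s Hs. apply (off_of_dist _ (r - Cmod (w - z))); [lra |].
  intros t Ht. specialize (H t Ht).
  generalize (Cmod_sub_triangle (gamma t) (z + RtoC s * (w - z)) z).
  replace (z + RtoC s * (w - z) - z)%C with (RtoC s * (w - z))%C by ring.
  rewrite Cmod_mult, Cmod_R, Rabs_right by lra. generalize (Cmod_ge_0 (w - z)). nra.
Qed.

(** Along the ray [s z], [s >= 1], the integral is constant, yet bounded by
    [(b - a) * L / (s * (Cmod z - M))], which becomes arbitrarily small. *)
Lemma wind_far M z : 0 < M -> (forall t, a <= t <= b -> Cmod (gamma t) <= M) -> M < Cmod z ->
  wind z = RtoC 0.
Proof.
  intros HM Hg Hz. apply Cmod_eq_0. apply Rle_antisym; [ | apply Cmod_ge_0].
  destruct (pf_bound _ _ _ pf) as [L HL].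
  assert (HL0 : 0 <= L) by (eapply Rle_trans; [apply Cmod_ge_0 | apply (HL a); lra]).
  assert (Hd : forall s t, 1 <= s -> a <= t <= b -> s * (Cmod z - M) <= Cmod (gamma t - RtoC s * z)).
  { intros s t Hs Ht. specialize (Hg t Ht).
    generalize (Cmod_le_add_sub (RtoC s * z) (gamma t)). rewrite Cmod_minus_sym, Cmod_mult, Cmod_R, Rabs_right by lra.
    nra. }
  assert (Hoff : forall s, 1 <= s -> off (RtoC s * z)%C).
  { intros s Hs. apply (off_of_dist _ (s * (Cmod z - M))); [nra |]. intros t Ht. now apply Hd. }
  assert (E : forall s, 1 <= s -> wind (RtoC s * z)%C = wind z).
  { intros s Hs. replace (RtoC s * z)%C with (z + RtoC (s - 1) * z)%C by (rewrite RtoC_minus; ring).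
    apply wind_segment. intros u Hu.
    replace (z + RtoC u * (RtoC (s - 1) * z))%C with (RtoC (1 + u * (s - 1)) * z)%C
      by (rewrite RtoC_plus, RtoC_mult; ring).
    apply Hoff. nra. }
  apply le_epsilon. intros e He. rewrite Rplus_0_l.
  set (c := Cmod z - M) in *. assert (Hc : 0 < c) by (unfold c; lra).
  set (s := 1 + (b - a) * L / c / e).
  assert (Hs : 1 <= s).
  { unfold s. assert (0 <= (b - a) * L / c / e); [ | lra].
    apply Rdiv_le_0_compat; auto. apply Rdiv_le_0_compat; auto. apply Rmult_le_pos; lra. }
  rewrite <- (E s Hs).
  apply Rle_trans with ((b - a) * (L * / (s * c))).
  - apply (isI_norm_const _ _ _ _ _ (Rlt_le _ _ Hab)) with (2 := wind_is _ (Hoff s Hs)).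
    intros t Ht. specialize (Hd s t Hs Ht).
    assert (0 < s * c) by nra.
    assert (Hn : (gamma t - RtoC s * z)%C <> RtoC 0) by (apply Cmod_gt_0; lra).
    rewrite Cmod_div by auto. unfold Rdiv.
    apply Rmult_le_compat; auto; [apply Cmod_ge_0 | |].
    + left. apply Rinv_0_lt_compat. lra.
    + apply Rinv_le_contravar; lra.
  - replace ((b - a) * (L * / (s * c))) with ((b - a) * L / c / s) by (field; lra).
    apply Rle_div_l; [lra |].
    unfold s. rewrite Rmult_plus_distr_l. replace (e * ((b - a) * L / c / e)) with ((b - a) * L / c) by (field; lra).
    lra.
Qed.

(** The parts of the complement with [wind] zero and nonzero are both open, so a connected set
    reaching a far point, where [wind_far] gives 0, cannot start at a point where it is nonzero. *)
Lemma wind_outer z : outer gamma a b z -> wind z = RtoC 0.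
Proof.
  intros [Hz Hub]. apply NNPP. intro Hn.
  destruct outer_far as [M [HM0 [HM _]]].
  assert (Hx : exists x, component (off_curve gamma a b) z x /\ M < Cmod x).
  { apply NNPP. intro K. apply Hub. exists M. intros x Hx. apply Rnot_lt_le. intro Q.
    apply K. exists x. auto. }
  destruct Hx as [x [[A [A1 [A2 [A3 A4]]]] Hx]].
  destruct (A1 (fun w => off w /\ wind w = RtoC 0) (fun w => off w /\ wind w <> RtoC 0))
    as [w [_ [[_ E] [_ F]]]]; auto.
  - apply nb_open. intros w [Hw E].
    generalize (filter_and _ _ (wind_locally_const w Hw) (off_component w Hw)).
    apply filter_imp. intros u [-> K]. split; auto. now apply component_off in K.
  - apply nb_open. intros w [Hw E].
    generalize (filter_and _ _ (wind_locally_const w Hw) (off_component w Hw)).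
    apply filter_imp. intros u [-> K]. split; auto. now apply component_off in K.
  - intros w Hw. destruct (classic (wind w = RtoC 0)); [left | right]; split; auto; now apply A2.
  - exists x. repeat split; auto; [now apply A2 |]. now apply wind_far with M.
  - exists z. auto.
Qed.

(** * Orientation and the normal field *)

Hypothesis Horiented : positively_oriented gamma a b.

(** Between [y - e nu] inside and [y + e nu] outside, the winding integral drops by [2 pi i]. If
    [nu] were [i] times the unit tangent, the imaginary part of the integrand of this difference
    would be at most 0 near [t0] by [jump_sign] and of order [e] elsewhere, so [2 * PI] would be
    bounded by a multiple of [e]. *)
Lemma normal_not_inward t0 nu : a < t0 < b -> regular gamma t0 ->
  (RtoC (Cmod (velocity gamma t0)) * nu = Ci * velocity gamma t0)%C ->
  ~ outward_unit_normal gamma a b (gamma t0) (velocity gamma t0) nu.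
Proof.
  intros Ht0 [Hr [Hd0 Hdc]] Hnu [Hnu1 [_ [delta [Hdelta Hside]]]].

  set (y := gamma t0) in *. set (d := velocity gamma t0) in *.
  assert (Hd := proj1 (Cmod_gt_0 d) Hd0). set (m := Cmod d) in *.
  assert (Hm0 : RtoC m <> RtoC 0) by (intro Q; apply RtoC_inj in Q; lra).
  destruct Hr as [q [Hq E]]. fold d in Hq.
  assert (Hm10 : 0 < m / 10) by lra.
  assert (Hev := filter_and _ _ E (filter_and _ _ (Hq _ Hm10) (Hdc _ Hm10))).
  destruct Hev as [eta Heta].
  destruct (simple_separated gamma a b t0 eta (pf_cts _ _ _ pf) Hsimple Ht0 (cond_pos eta)) as [c [Hc Hsep]]. fold y in Hsep.
  destruct (pf_bound _ _ _ pf) as [L HL].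
  assert (HL0 : 0 <= L) by (eapply Rle_trans; [apply Cmod_ge_0 | apply (HL a); lra]).
  (* Far from [t0] both evaluation points stay at distance [c / 2] from the curve point, so the
     kernels differ by at most [L * 2 e / (c / 2)^2]. *)
  set (K := 8 * L / (c * c)).
  assert (HK : 0 <= K) by (unfold K; apply Rdiv_le_0_compat; nra).
  assert (Hall : forall e, 0 < e -> e < delta -> e <= c / 2 -> 2 * PI <= (b - a) * (K * e)).
  { intros e He Hed Hec. destruct (Hside e ltac:(lra)) as [Ho Hi].
    assert (I1 := Horiented _ Hi). assert (I2 := wind_is _ (proj1 Ho)).
    rewrite wind_outer in I2 by auto.
    assert (I3 := isI_minus _ _ _ _ _ _ I1 I2). apply isI_parts in I3. destruct I3 as [_ I3].
    replace (Im (RtoC (2 * PI) * Ci - RtoC 0)) with (2 * PI) in I3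
      by (unfold Im, Cminus, Copp, Cplus, Cmult, Ci, RtoC; simpl; ring).
    apply (is_RInt_le _ (fun _ => K * e) a b _ _ (Rlt_le _ _ Hab) I3).
    { exact (is_RInt_const (V := R_NormedModule) a b (K * e)). }
    intros t Ht.
    assert (Hn1 : (gamma t - (y - RtoC e * nu))%C <> RtoC 0).
    { apply Cminus_neq0. intro Q. apply (proj1 Hi). exists t. split; auto. lra. }
    assert (Hn2 : (gamma t - (y + RtoC e * nu))%C <> RtoC 0).
    { apply Cminus_neq0. intro Q. apply (proj1 Ho). exists t. split; auto. lra. }
    destruct (Rlt_dec (Rabs (t - t0)) eta) as [Hnear | Hfar].
    - apply Rle_trans with 0; [ | apply Rmult_le_pos; lra].
      destruct (Heta t Hnear) as [E1 [E2 E3]].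
      (* Dividing by the tangent [d] gives the coordinates of [jump_sign], with [x = q t / d],
         [x' = velocity gamma t / d] and height [e / m]. *)
      assert (Enu : (RtoC e * nu = RtoC (e / m) * Ci * d)%C).
      { rewrite RtoC_div by lra. transitivity (RtoC e / RtoC m * (RtoC m * nu))%C; [field; auto |].
        rewrite Hnu. ring. }
      assert (Eg : gamma t = (y + q t * RtoC (t - t0))%C) by (rewrite <- E1; unfold y; ring).
      assert (F1 : (gamma t - (y - RtoC e * nu) = d * (RtoC (t - t0) * (q t / d) + RtoC (e / m) * Ci))%C).
      { rewrite Enu, Eg. field. auto. }
      assert (F2 : (gamma t - (y + RtoC e * nu) = d * (RtoC (t - t0) * (q t / d) - RtoC (e / m) * Ci))%C).
      { rewrite Enu, Eg. field. auto. }
      rewrite F1 in Hn1 |- *. rewrite F2 in Hn2 |- *.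
      assert (Hn1' : (RtoC (t - t0) * (q t / d) + RtoC (e / m) * Ci)%C <> RtoC 0).
      { intro Q. apply Hn1. rewrite Q. ring. }
      assert (Hn2' : (RtoC (t - t0) * (q t / d) - RtoC (e / m) * Ci)%C <> RtoC 0).
      { intro Q. apply Hn2. rewrite Q. ring. }
      set (w1 := (RtoC (t - t0) * (q t / d) + RtoC (e / m) * Ci)%C) in *.
      set (w2 := (RtoC (t - t0) * (q t / d) - RtoC (e / m) * Ci)%C) in *.
      replace (velocity gamma t / (d * w1) - velocity gamma t / (d * w2))%C with
        (velocity gamma t / d / w1 - velocity gamma t / d / w2)%C by (field; auto).
      assert (Hclose : forall z, Cmod (z - d) < m / 10 -> Cmod (z / d - 1) <= / 10).
      { intros z Hz. replace (z / d - 1)%C with ((z - d) / d)%C by (field; auto).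
        rewrite Cmod_div by auto. fold m. apply Rle_div_l; lra. }
      apply jump_sign; auto. apply Rdiv_lt_0_compat; auto.
    - assert (Hd' := Hsep t ltac:(lra) ltac:(lra)).
      assert (Hen : Cmod (RtoC e * nu) = e).
      { rewrite Cmod_mult, Cmod_R, Hnu1, Rabs_right; lra. }
      set (v := (RtoC e * nu)%C) in *.
      assert (G1 : c / 2 <= Cmod (gamma t - (y - v))).
      { replace (gamma t - (y - v))%C with (gamma t - y + v)%C by ring.
        generalize (Cmod_le_add_sub (gamma t - y) (gamma t - y + v)).
        replace (gamma t - y - (gamma t - y + v))%C with (- v)%C by ring. rewrite Cmod_opp. lra. }
      assert (G2 : c / 2 <= Cmod (gamma t - (y + v))).
      { replace (gamma t - (y + v))%C with (gamma t - y - v)%C by ring.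
        generalize (Cmod_le_add_sub (gamma t - y) (gamma t - y - v)).
        replace (gamma t - y - (gamma t - y - v))%C with v by ring. lra. }
      eapply Rle_trans; [apply Rle_abs |]. eapply Rle_trans; [apply im_le_Cmod |].
      replace (velocity gamma t / (gamma t - (y - v)) - velocity gamma t / (gamma t - (y + v)))%C with
        (velocity gamma t * (- (v + v)) * (/ (gamma t - (y - v)) * / (gamma t - (y + v))))%C
        by (field; auto).
      rewrite !Cmod_mult, !Cmod_inv, Cmod_opp by auto.
      unfold K. replace (8 * L / (c * c) * e) with (L * (2 * e) * (/ (c / 2) * / (c / 2))) by (field; lra).
      assert (0 <= Cmod (velocity gamma t)) by apply Cmod_ge_0.
      assert (0 <= Cmod (v + v)) by apply Cmod_ge_0.
      assert (0 <= / Cmod (gamma t - (y - v))) by (left; apply Rinv_0_lt_compat; lra).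
      assert (0 <= / Cmod (gamma t - (y + v))) by (left; apply Rinv_0_lt_compat; lra).
      assert (Cmod (v + v) <= 2 * e) by (eapply Rle_trans; [apply Cmod_triangle | lra]).
      repeat (apply Rmult_le_compat; auto using Rmult_le_pos);
        first [apply HL; lra | apply Rinv_le_contravar; lra]. }
  assert (HPI := PI_RGT_0).
  (* The last entry keeps [(b - a) * (K * e)] below [2 * PI], contradicting [Hall]. *)
  set (e := Rmin (Rmin (delta / 2) (c / 2)) (PI / ((b - a) * K + 1))).
  assert (B1 := Rmin_l (Rmin (delta / 2) (c / 2)) (PI / ((b - a) * K + 1))).
  assert (B2 := Rmin_r (Rmin (delta / 2) (c / 2)) (PI / ((b - a) * K + 1))).
  assert (B3 := Rmin_l (delta / 2) (c / 2)). assert (B4 := Rmin_r (delta / 2) (c / 2)).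
  fold e in B1, B2.
  assert (HbK : 0 <= (b - a) * K) by (apply Rmult_le_pos; lra).
  assert (He : 0 < e).
  { apply Rmin_glb_lt; [apply Rmin_glb_lt; lra |]. apply Rdiv_lt_0_compat; lra. }
  specialize (Hall e He ltac:(lra) ltac:(lra)).
  apply Rle_div_r in B2; [ | lra]. nra.
Qed.

(** Perpendicularity makes [nu * Cconj d] imaginary, and its modulus is [m]; of the two possible
    signs, [normal_not_inward] excludes one. *)
Lemma outward_normal_eq t0 nu : a < t0 < b -> regular gamma t0 ->
  outward_unit_normal gamma a b (gamma t0) (velocity gamma t0) nu ->
  (RtoC (Cmod (velocity gamma t0)) * nu = - Ci * velocity gamma t0)%C.
Proof.
  intros Ht0 Hr Hn. assert (Hd0 := proj1 (proj2 Hr)).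
  assert (K : ~ (RtoC (Cmod (velocity gamma t0)) * nu = Ci * velocity gamma t0)%C).
  { intro K. exact (normal_not_inward t0 nu Ht0 Hr K Hn). }
  destruct Hn as [H1 [H2 _]]. set (d := velocity gamma t0) in *.
  assert (Hd := proj1 (Cmod_gt_0 d) Hd0). set (m := Cmod d) in *.
  set (s := Im nu * Re d - Re nu * Im d).
  assert (Es : (nu * Cconj d = RtoC s * Ci)%C).
  { unfold s, Cmult, Cconj, Ci, RtoC, Re, Im in *. apply injective_projections; simpl in *; lra. }
  assert (Ed : (d * Cconj d = RtoC m * RtoC m)%C).
  { rewrite <- Cmod2_conj. fold m. rewrite <- RtoC_mult. f_equal. ring. }
  assert (Es2 : s * s = m * m).
  { assert (Q : Cmod (nu * Cconj d) = m) by (rewrite Cmod_mult, Cmod_conj, H1; fold m; ring).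
    rewrite Es, Cmod_mult, Cmod_Ci, Cmod_R, Rmult_1_r in Q. rewrite <- Q.
    rewrite <- Rabs_mult. symmetry. apply Rabs_right. nra. }
  assert (Hs : s = m \/ s = - m) by (destruct (Req_dec s m); [auto | right; nra]).
  assert (Hm0 : RtoC m <> RtoC 0) by (intro Q; apply RtoC_inj in Q; lra).
  assert (E2 : (RtoC m * (RtoC m * nu) = RtoC s * (Ci * d))%C).
  { transitivity (nu * (d * Cconj d))%C; [rewrite Ed; ring |].
    transitivity (nu * Cconj d * d)%C; [ring |]. rewrite Es. ring. }
  assert (E3 : (RtoC m * nu = RtoC s * (Ci * d) / RtoC m)%C).
  { rewrite <- E2. field; auto. }
  destruct Hs as [-> | ->].
  - destruct K. rewrite E3. field; auto.
  - rewrite E3, RtoC_opp. field; auto.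
Qed.

(** * The inverse of the exterior Riemann map *)

Variable f : C -> C.
Hypothesis Hf : exterior_riemann_map gamma a b f.

Definition ext_disc (w : C) : Prop := 1 <= Cmod w.

Lemma f_clo z : clo z -> ext_disc (f z).
Proof.
  intros [H | H]; unfold ext_disc.
  - left. now apply (erm_bij _ _ _ _ Hf).
  - right. symmetry. now apply (erm_boundary _ _ _ _ Hf).
Qed.

(** The modulus of [f] exceeds 1 outside and equals 1 on the curve, so points of the two kinds never
    collide and the two bijections combine. *)
Lemma f_inj x y : clo x -> clo y -> f x = f y -> x = y.
Proof.
  intros Hx Hy E. destruct (erm_bij _ _ _ _ Hf) as [B1 B2]. destruct (erm_boundary _ _ _ _ Hf) as [B3 B4].
  destruct Hx as [Hx | Hx], Hy as [Hy | Hy].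
  - destruct (B2 (f y) (B1 y Hy)) as [z [_ K]]. rewrite <- (K x), <- (K y); auto.
  - apply B1 in Hx. apply B3 in Hy. rewrite E in Hx. lra.
  - apply B3 in Hx. apply B1 in Hy. rewrite E in Hx. lra.
  - destruct (B4 (f y) (B3 y Hy)) as [z [_ K]]. rewrite <- (K x), <- (K y); auto.
Qed.

Lemma f_surj w : ext_disc w -> exists z, clo z /\ f z = w.
Proof.
  intros [H | H].
  - destruct (proj2 (erm_bij _ _ _ _ Hf) w H) as [z [[K1 K2] _]]. exists z. split; auto. now left.
  - destruct (proj2 (erm_boundary _ _ _ _ Hf) w (eq_sym H)) as [z [[K1 K2] _]].
    exists z. split; auto. now right.
Qed.

Lemma f_cts : cts_in (clo) f.
Proof. intros w Hw. apply continuous_on_tends; auto. apply (erm_continuous _ _ _ _ Hf). Qed.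

Lemma f_cder z : outer gamma a b z -> cder f z (C_derive f z).
Proof.
  intro Hz. apply is_derive_cder. apply C_derive_correct; [exact (RtoC 0) |].
  now apply (erm_analytic _ _ _ _ Hf).
Qed.

(** The inverse is picked on the closed exterior disc, boundary circle included; the value 0 for
    [Cmod w < 1] is a default. *)
Definition psi (w : C) : C :=
  match excluded_middle_informative (ext_disc w) with
  | left H => proj1_sig (constructive_indefinite_description _ (f_surj w H))
  | right _ => RtoC 0
  end.

Lemma psi_spec w : ext_disc w -> clo (psi w) /\ f (psi w) = w.
Proof.
  intro Hw. unfold psi. destruct excluded_middle_informative; [ | tauto].
  exact (proj2_sig (constructive_indefinite_description _ (f_surj w e))).
Qed.

Lemma psi_f z : clo z -> psi (f z) = z.
Proof. intro Hz. destruct (psi_spec (f z) (f_clo z Hz)). now apply f_inj. Qed.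

Lemma psi_curve w : Cmod w = 1 -> curve gamma a b (psi w).
Proof.
  intro Hw. destruct (psi_spec w) as [[H | H] E]; auto; [unfold ext_disc; lra |].
  apply (erm_bij _ _ _ _ Hf) in H. rewrite E in H. lra.
Qed.

Lemma psi_outer w : 1 < Cmod w -> outer gamma a b (psi w).
Proof.
  intro Hw. destruct (psi_spec w) as [[H | H] E]; auto; [unfold ext_disc; lra |].
  apply (erm_boundary _ _ _ _ Hf) in H. rewrite E in H. lra.
Qed.

Lemma psi_bounded B : exists M, forall w, ext_disc w -> Cmod w <= B -> Cmod (psi w) <= M.
Proof.
  destruct (erm_infty _ _ _ _ Hf (fun w => B < Cmod w)) as [M HM]; [now exists B |].
  exists M. intros w Hw HB. apply Rnot_lt_le. intro K. apply HM in K.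
  rewrite (proj2 (psi_spec w Hw)) in K. lra.
Qed.

Lemma clo_ball_closed M : limit_closed (fun z => clo z /\ Cmod z <= M).
Proof.
  intros z H. split.
  - apply clo_closed; auto. intros e He. destruct (H e He) as [w [[K _] Q]]. exists w; auto.
  - apply le_epsilon. intros e He. destruct (H e He) as [w [[_ K] Q]].
    generalize (Cmod_le_add_sub z w). rewrite (Cmod_minus_sym z). lra.
Qed.

Lemma f_bounded M : exists B, forall z, clo z -> Cmod z <= M -> Cmod (f z) <= B.
Proof.
  destruct (cts_in_bounded (fun z => clo z /\ Cmod z <= M) f M) as [B HB].
  - apply clo_ball_closed.
  - tauto.
  - intros w [Hw _]. generalize (f_cts w Hw). apply tends_le_filter.
    intros P. unfold within. apply filter_imp. tauto.
  - exists B. auto.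
Qed.

(** A sequence tending to [w] has bounded images under [psi], because [f] tends to infinity at
    infinity. By continuity of [f] any cluster point [z] of the images satisfies [f z = w], hence
    equals [psi w]. *)
Lemma psi_cts : cts_in ext_disc psi.
Proof.
  intros w Hw e He. apply NNPP. intro H.
  assert (Hn : forall n : nat, exists x, ext_disc x /\ Cmod (x - w) < / (INR n + 1) /\
     e <= Cmod (psi x - psi w)).
  { intro n. apply NNPP. intro K. apply H. exists (/ (INR n + 1)). split.
    - apply Rinv_0_lt_compat. generalize (pos_INR n). lra.
    - intros x Hx Hd. apply Rnot_le_lt. intro Q. apply K. exists x. auto. }
  apply choice in Hn. destruct Hn as [x Hx].
  assert (Hx1 : forall n, Cmod (x n) <= Cmod w + 1).
  { intro n. destruct (Hx n) as [_ [Q _]].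
    assert (/ (INR n + 1) <= 1).
    { rewrite <- Rinv_1. apply Rinv_le_contravar; [lra |]. generalize (pos_INR n). lra. }
    generalize (Cmod_le_add_sub (x n) w). lra. }
  destruct (psi_bounded (Cmod w + 1)) as [M HM].
  destruct (cluster_point (fun n => psi (x n)) M) as [z Hz].
  { intro n. apply HM; auto. apply Hx. }
  assert (Hzc : clo z).
  { apply clo_closed; auto. intros e' He'. destruct (Hz e' O He') as [n [_ K]].
    exists (psi (x n)). split; auto. apply psi_spec. apply Hx. }
  assert (E : f z = w).
  { apply Cminus_eq0. apply Cmod_small_eq0. intros e' He'.
    assert (He2 : 0 < e' / 2) by lra.
    destruct (f_cts z Hzc _ He2) as [d [Hd K]].
    destruct (inv_INR_small _ He2) as [N HN].
    destruct (Hz d N Hd) as [n [Hn Q]]. specialize (HN n Hn).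
    destruct (Hx n) as [X1 [X2 X3]]. destruct (psi_spec _ X1) as [P1 P2].
    specialize (K _ Q P1). rewrite P2 in K.
    generalize (Cmod_sub_triangle (f z) (x n) w). rewrite (Cmod_minus_sym (f z) (x n)). lra. }
  assert (Ez : z = psi w) by (rewrite <- E; symmetry; now apply psi_f).
  destruct (Hz e O He) as [n [_ Q]]. destruct (Hx n) as [_ [_ K]]. rewrite Ez in Q. lra.
Qed.

Lemma ext_disc_nb w : 1 < Cmod w -> nb w (fun x => 1 < Cmod x).
Proof.
  intro Hw. exists (Cmod w - 1). split; [lra |]. intros x Hx.
  generalize (Cmod_le_add_sub w x). rewrite Cmod_minus_sym. lra.
Qed.

Lemma cts_in_tends u w : cts_in ext_disc u -> 1 < Cmod w -> tends (nb w) u (u w).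
Proof.
  intros Hu Hw e He.
  assert (K : ext_disc w) by (unfold ext_disc; lra).
  generalize (filter_and _ _ (ext_disc_nb w Hw) (Hu w K e He)). apply filter_imp.
  intros x [H1 H2]. apply H2. unfold ext_disc; lra.
Qed.

Lemma psi_cder w : 1 < Cmod w -> exists A, cder psi w A.
Proof.
  intro Hw. assert (Ho := psi_outer w Hw).
  assert (Hwe : ext_disc w) by (unfold ext_disc; lra).
  exists (/ C_derive f (psi w))%C. apply cder_inverse with f.
  - now apply f_cder.
  - destruct (outer_open _ Ho) as [r [Hr H]].
    apply (injective_deriv f (psi w) _ r); auto.
    + intros x Hx. exists (C_derive f x). apply f_cder. auto.
    + intros x y Hx Hy. apply f_inj; left; auto.
    + now apply f_cder.
  - now apply cts_in_tends; [apply psi_cts |].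
  - generalize (ext_disc_nb w Hw). apply filter_imp. intros x Hx. apply psi_spec. unfold ext_disc; lra.
  - now apply psi_spec.
Qed.

(** Beyond a radius [M] the derivative is within [alpha / 2] of [alpha]. The mean value inequality
    along the ray from a point [z0] of the circle of radius [M] compares [f z - f z0] with
    [alpha * (z - z0)], and [f z0] is bounded by compactness. *)
Lemma f_growth : exists M c1 c2, 0 < c1 /\ 0 < c2 /\
  forall z, M < Cmod z -> c1 * Cmod z <= Cmod (f z) <= c2 * Cmod z.
Proof.
  destruct (erm_derive_infty _ _ _ _ Hf) as [alpha [Ha Hl]].
  apply filterlim_tends in Hl; [ | typeclasses eauto].
  assert (Ha2 : 0 < alpha / 2) by lra.
  destruct (Hl _ Ha2) as [M1 HM1].
  destruct (outer_far) as [M2 [HM20 [_ HM2]]].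
  set (M := Rmax M1 M2 + 1).
  assert (A1 := Rmax_l M1 M2). assert (A2 := Rmax_r M1 M2).
  destruct (f_bounded M) as [B HB].
  assert (K : forall z, M <= Cmod z -> exists z0, Cmod z0 = M /\
     Cmod (z - z0) = Cmod z - M /\ Cmod (f z - f z0 - RtoC alpha * (z - z0)) <= alpha / 2 * (Cmod z - M)).
  { intros z Hz. assert (HM : 0 < M) by (unfold M; lra).
    assert (Hz0 : 0 < Cmod z) by lra.
    set (s := fun t => (RtoC (M / Cmod z) + RtoC t * RtoC (1 - M / Cmod z))%C).
    assert (Hs : forall t, s t = RtoC (M / Cmod z + t * (1 - M / Cmod z))).
    { intro t. unfold s. now rewrite RtoC_plus, RtoC_mult. }
    assert (Hm : 0 <= 1 - M / Cmod z).
    { assert (M / Cmod z <= 1) by (apply Rle_div_l; lra). lra. }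
    assert (Hm' : 0 < M / Cmod z) by (apply Rdiv_lt_0_compat; lra).
    assert (E0 : Cmod (z - s 0 * z) = Cmod z - M).
    { rewrite Hs. replace (z - RtoC (M / Cmod z + 0 * (1 - M / Cmod z)) * z)%C with
        (RtoC (1 - M / Cmod z) * z)%C.
      - rewrite Cmod_mult, Cmod_R, Rabs_right by lra. field. lra.
      - rewrite Rmult_0_l, Rplus_0_r, RtoC_minus. ring. }
    exists (s 0 * z)%C. split; [ | split]; auto.
    - rewrite Hs, Cmod_mult, Cmod_R, Rabs_right by lra. field. lra.
    - set (G := fun t => (f (s 0 * z + RtoC t * (z - s 0 * z)) - RtoC alpha * (z - s 0 * z) * RtoC t)%C).
      assert (HG : forall t, 0 <= t <= 1 -> exists A, rder G t A /\ Cmod A <= alpha / 2 * (Cmod z - M)).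
      { intros t Ht. set (x := (s 0 * z + RtoC t * (z - s 0 * z))%C).
        assert (Hx : M <= Cmod x).
        { unfold x. replace (s 0 * z + RtoC t * (z - s 0 * z))%C with
            (RtoC (M / Cmod z + t * (1 - M / Cmod z)) * z)%C.
          - rewrite Cmod_mult, Cmod_R, Rabs_right by nra.
            rewrite Rmult_plus_distr_r.
            replace (M / Cmod z * Cmod z) with M by (field; lra).
            assert (0 <= t * (1 - M / Cmod z) * Cmod z); [ | lra].
            apply Rmult_le_pos; [apply Rmult_le_pos | ]; lra.
          - rewrite Hs. rewrite !RtoC_plus, !RtoC_mult, RtoC_minus. ring. }
        exists (C_derive f x * (z - s 0 * z) - RtoC alpha * (z - s 0 * z))%C. split.
        - apply rder_minus.
          + apply (rder_comp (fun t => s 0 * z + RtoC t * (z - s 0 * z))%C f); [apply rder_affine |].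
            apply f_cder. apply HM2. fold x. unfold M in Hx. lra.
          + apply rder_ext with (fun t => 0 + RtoC t * (RtoC alpha * (z - s 0 * z)))%C; [ | apply rder_affine].
            apply filter_forall. intros r. ring.
        - replace (C_derive f x * (z - s 0 * z) - RtoC alpha * (z - s 0 * z))%C with
            ((C_derive f x - RtoC alpha) * (z - s 0 * z))%C by ring.
          rewrite Cmod_mult, E0. apply Rmult_le_compat_r; [lra |]. left. apply HM1. unfold M in Hx. lra. }
      assert (Q := rder_bound G (alpha / 2 * (Cmod z - M)) 0 1 Rle_0_1).
      replace (alpha / 2 * (Cmod z - M)) with (alpha / 2 * (Cmod z - M) * (1 - 0)) by ring.
      replace (f z - f (s 0 * z) - RtoC alpha * (z - s 0 * z))%C with (G 1 - G 0)%C.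
      + apply Q.
        * apply cts_on_tends. intros t Ht. destruct (HG t Ht) as [A [HA _]]. eapply rder_tends. apply HA.
        * intros t Ht. apply HG. lra.
      + unfold G. replace (s 0 * z + RtoC 1 * (z - s 0 * z))%C with z by ring.
        replace (s 0 * z + RtoC 0 * (z - s 0 * z))%C with (s 0 * z)%C by ring. ring. }
  set (B' := Rabs B). assert (HB' : 0 <= B') by apply Rabs_pos.
  (* The threshold is where [alpha / 4 * Cmod z] exceeds [alpha / 2 * M + B'], so that the lower
     estimate [alpha / 2 * (Cmod z - M) - B'] is still at least [alpha / 4 * Cmod z]. *)
  exists (Rmax M ((alpha / 2 * M + B') / (alpha / 4))), (alpha / 4), (3 * alpha).
  split; [lra |]. split; [lra |]. intros z Hz.
  assert (Z1 := Rle_lt_trans _ _ _ (Rmax_l _ _) Hz). assert (Z2 := Rle_lt_trans _ _ _ (Rmax_r _ _) Hz).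
  apply Rlt_div_l in Z2; [ | lra].
  destruct (K z ltac:(lra)) as [z0 [Hz0 [E1 E2]]].
  assert (Hfz0 : Cmod (f z0) <= B').
  { eapply Rle_trans; [apply HB | apply Rle_abs]; [ | lra]. left. apply HM2. rewrite Hz0. unfold M. lra. }
  assert (E3 : Cmod (RtoC alpha * (z - z0)) = alpha * (Cmod z - M)).
  { rewrite Cmod_mult, Cmod_R, Rabs_right, E1; lra. }
  assert (HM : 0 < M) by (unfold M; lra).
  split.
  - generalize (Cmod_le_add_sub (RtoC alpha * (z - z0)) (f z - f z0)).
    rewrite Cmod_minus_sym in E2.
    assert (T1 := Cmod_triangle (f z) (- f z0)). rewrite Cmod_opp in T1.
    change (f z + - f z0)%C with (f z - f z0)%C in T1. nra.
  - generalize (Cmod_le_add_sub (f z - f z0) (RtoC alpha * (z - z0))).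
    generalize (Cmod_le_add_sub (f z) (f z0)). nra.
Qed.

Lemma psi_infty M : exists B, forall w, B < Cmod w -> ext_disc w -> M < Cmod (psi w).
Proof.
  destruct (f_bounded M) as [B HB]. exists B. intros w Hw He. apply Rnot_le_lt. intro K.
  destruct (psi_spec w He) as [P1 P2]. specialize (HB _ P1 K). rewrite P2 in HB. lra.
Qed.

(** Both moduli are comparable with [Cmod w], by the linear growth of [f]. This controls [psi] under
    rotations of [w]. *)
Lemma psi_growth : exists B k, 0 < B /\ 0 < k /\ forall w w', B < Cmod w -> ext_disc w -> Cmod w' = Cmod w ->
  Cmod (psi w') <= k * Cmod (psi w).
Proof.
  destruct f_growth as [M [c1 [c2 [H1 [H2 H]]]]].
  destruct (psi_infty M) as [B HB]. exists (Rabs B + 1), (c2 / c1).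
  split; [generalize (Rabs_pos B); lra |].
  split; [now apply Rdiv_lt_0_compat |]. intros w w' Hw He E. assert (HBw : B < Cmod w).
  { generalize (Rle_abs B). lra. }
  assert (He' : ext_disc w') by (unfold ext_disc in *; lra).
  destruct (H _ (HB w HBw He)) as [_ K1]. rewrite <- E in HBw.
  destruct (H _ (HB w' HBw He')) as [K2 _].
  rewrite (proj2 (psi_spec _ He)) in K1. rewrite (proj2 (psi_spec _ He')) in K2.
  replace (c2 / c1 * Cmod (psi w)) with (c2 * Cmod (psi w) / c1) by (field; lra).
  apply Rle_div_r; auto. lra.
Qed.

(** * A monotone parametrisation of the curve by the unit circle *)

Lemma tends_Y x : tends (locally x) (fun t => psi (cis t)) (psi (cis x)).
Proof.
  apply tends_comp_within with ext_disc (cis x).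
  - apply filter_forall. intro t. unfold ext_disc. rewrite Cmod_cis. lra.
  - apply tends_cis.
  - apply psi_cts; auto. unfold ext_disc. rewrite Cmod_cis. lra.
Qed.

(** The angle [t0] is that of [f (gamma a)], so the cut of the circle falls on the closing point of
    the curve. In between each angle has one parameter, depending continuously and injectively on
    it, hence monotonically. The sign [s] tells whether [gamma] is traversed forwards or
    backwards. *)
Lemma circle_param : exists t0 T s, (s = 1 \/ s = -1) /\
  monotone_param gamma (fun t => psi (cis t)) a b t0 (t0 + 2 * PI) T /\
  (forall x y, x <= y -> s * T x <= s * T y) /\ s * (T (t0 + 2 * PI) - T t0) = b - a.
Proof.
  assert (Ha : curve gamma a b (gamma a)) by (exists a; split; auto; lra).
  destruct (polar_angle (f (gamma a))) as [t0 Ht0]; [now apply (erm_boundary _ _ _ _ Hf) |].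
  assert (HPI := PI_RGT_0).
  set (t1 := t0 + 2 * PI).
  assert (Hcl := proj1 (proj2 Hsimple)). assert (Hinj := proj2 (proj2 Hsimple)).
  set (Y := fun t => psi (cis t)).
  assert (Y0 : Y t0 = gamma a).
  { unfold Y. rewrite <- Ht0. apply psi_f. now right. }
  assert (Y1 : Y t1 = gamma a) by (unfold Y, t1; rewrite cis_2PI; exact Y0).
  assert (HT0 : forall t, exists x, a <= x < b /\ gamma x = Y t).
  { intro t. destruct (psi_curve (cis t) (Cmod_cis t)) as [x [Hx Ex]].
    destruct (Req_dec x b) as [-> | N].
    - exists a. split; [lra |]. rewrite Hcl. exact Ex.
    - exists x. split; [lra | exact Ex]. }
  apply choice in HT0. destruct HT0 as [T0 HT0].
  assert (Yinj : forall x y, Rabs (x - y) < 2 * PI -> Y x = Y y -> x = y).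
  { intros x y Hxy E. apply cis_inj; auto. apply (f_equal f) in E. unfold Y in E.
    rewrite !(fun w H => proj2 (psi_spec w H)) in E; auto;
      unfold ext_disc; rewrite Cmod_cis; lra. }
  assert (HT : forall x, t0 < x < t1 -> a < T0 x < b /\ gamma (T0 x) = Y x).
  { intros x Hx. destruct (HT0 x) as [K1 K2]. split; auto. split; [ | lra].
    destruct (Req_dec (T0 x) a) as [E | N]; [ | lra]. exfalso.
    rewrite E, <- Y0 in K2. apply Yinj in K2; [lra |]. unfold t1 in Hx. rewrite Rabs_left; lra. }
  assert (HYc : forall x, tends (locally x) Y (Y x)) by apply tends_Y.
  assert (Hc : forall x, t0 < x < t1 -> continuity_pt T0 x).
  { intros x Hx. destruct (HT x Hx) as [Hx1 Hx2].
    apply continuity_pt_filterlim. intros P [e He]. unfold filtermap.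
    destruct (simple_separated gamma a b (T0 x) e (pf_cts _ _ _ pf) Hsimple Hx1 (cond_pos e)) as [c [Hcp K]].
    generalize (HYc x c Hcp). apply filter_imp. intros y Hy. apply He.
    destruct (HT0 y) as [R1 R2]. rewrite <- R2, <- Hx2 in Hy.
    apply Rnot_le_lt. intro Q. specialize (K (T0 y) ltac:(lra) Q). lra. }
  assert (Hi : forall x y, t0 < x < t1 -> t0 < y < t1 -> T0 x = T0 y -> x = y).
  { intros x y Hx Hy E. apply Yinj.
    - unfold t1 in *. apply Rabs_lt_between. lra.
    - destruct (HT0 x) as [_ <-]. destruct (HT0 y) as [_ <-]. now rewrite E. }
  exists t0.
  destruct (injective_monotone T0 t0 t1 Hc Hi) as [M | M].
  - destruct (increasing_param gamma Y T0 a b t0 t1 (pf_cts _ _ _ pf) Hsimple HYc) as [T [K1 [K2 [K3 K4]]]]; auto.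
    + unfold t1; lra.
    + exists T, 1. split; auto. split; auto. split.
      * intros x y Hxy. specialize (K2 x y Hxy). lra.
      * fold t1. rewrite K3, K4. lra.
  (* The decreasing case is the increasing one for the reversed curve; [T] is then reflected
     back. *)
  - set (g := fun t => gamma (a + b - t)).
    assert (Hg : cts_on a b g).
    { intros s Hsr e He. destruct (pf_cts _ _ _ pf (a + b - s) ltac:(lra) e He) as [d Hd].
      exists d. intros t Ht Htr. apply Hd; [ | lra].
      change (Rabs (a + b - t - (a + b - s)) < d).
      replace (a + b - t - (a + b - s)) with (- (t - s)) by ring. now rewrite Rabs_Ropp. }
    assert (Hgs : simple_closed g a b).
    { split; [auto |]. split.
      - unfold g. replace (a + b - a) with b by ring. replace (a + b - b) with a by ring. auto.
      - intros s t Hsr Htr E. unfold g in E.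
        destruct (Req_dec s a) as [-> | N1], (Req_dec t a) as [-> | N2]; auto.
        + replace (a + b - a) with b in E by ring. rewrite <- Hcl in E. apply Hinj in E; lra.
        + replace (a + b - a) with b in E by ring. rewrite <- Hcl in E. apply Hinj in E; lra.
        + apply Hinj in E; lra. }
    assert (Ega : g a = gamma a) by (unfold g; rewrite Hcl; f_equal; ring).
    destruct (increasing_param g Y (fun x => a + b - T0 x) a b t0 t1 Hg Hgs HYc) as [T [K1 [K2 [K3 K4]]]].
    + unfold t1; lra.
    + congruence.
    + congruence.
    + intros x Hx. destruct (HT x Hx) as [R1 R2]. split; [lra |]. unfold g.
      replace (a + b - (a + b - T0 x)) with (T0 x) by ring. auto.
    + intros x y Hx Hxy Hy. specialize (M x y Hx Hxy Hy). lra.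
    + exists (fun x => a + b - T x), (-1). split; auto. split; [split | split].
      * intro x. apply tends_ext with (fun s => RtoC (a + b) - RtoC (T s))%C.
        { apply filter_forall. intros s. now rewrite <- RtoC_minus. }
        apply tends_eq with (RtoC (a + b) - RtoC (T x))%C; [now rewrite <- RtoC_minus |].
        apply tends_minus; [apply tends_const | apply (mp_cts _ _ _ _ _ _ _ K1)].
      * intro x. generalize (mp_range _ _ _ _ _ _ _ K1 x). lra.
      * intros x Hx. rewrite <- (mp_eq _ _ _ _ _ _ _ K1 x Hx). reflexivity.
      * intros x y Hxy. specialize (K2 x y Hxy). lra.
      * fold t1. rewrite K3, K4. lra.
Qed.

(** * Line integrals as limits of difference quotients on the circle *)

Lemma cts_on_boundary K : cts_in ext_disc K -> cts_on a b (fun t => K (f (gamma t))).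
Proof.
  intros HK t Ht.
  assert (Hc : forall t, a <= t <= b -> clo (gamma t)) by (intros x Hx; right; now exists x).
  assert (HF : within (fun x => a <= x <= b) (locally t) (fun x => a <= x <= b)).
  { unfold within. apply filter_forall. auto. }
  apply (tends_comp_within ext_disc (fun t => f (gamma t)) K (f (gamma t))).
  - revert HF. apply filter_imp. intros x Hx. apply (f_clo). auto.
  - apply (tends_comp_within (clo) gamma f (gamma t)).
    + revert HF. apply filter_imp. auto.
    + apply (pf_cts _ _ _ pf); auto.
    + apply (f_cts). auto.
  - apply HK. apply (f_clo). auto.
Qed.

Lemma f_gamma_unit t : a <= t <= b -> Cmod (f (gamma t)) = 1.
Proof. intro Ht. apply (erm_boundary _ _ _ _ Hf). now exists t. Qed.

Lemma cts_in_circle_bounded K : cts_in ext_disc K ->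
  exists B, 0 <= B /\ forall w, Cmod w = 1 -> Cmod (K w) <= B.
Proof.
  intro HK. destruct (cts_in_bounded (annulus 1 1) K 1) as [B HB].
  - apply annulus_closed.
  - intros w [_ H]; auto.
  - intros w [H1 H2]. generalize (HK w H1). apply tends_le_filter.
    intros P. unfold within. apply filter_imp. intros x Q [H3 H4]. apply Q. exact H3.
  - assert (HB' : forall w, Cmod w = 1 -> Cmod (K w) <= B).
    { intros w Hw. apply HB. split; lra. }
    exists B. split; auto. eapply Rle_trans; [ | apply (HB' (RtoC 1) Cmod_1)]. apply Cmod_ge_0.
Qed.

(** With [Y t = psi (cis t)], the integral of [K(f(y)) dy] over the curve is, up
    to sign, the limit as [d -> 0] of the means over the circle of
    [K (cis t) * (Y (t + d) - Y t) / d], although [Y] need not be differentiable. *)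
Theorem stieltjes_zero K : cts_in ext_disc K ->
  (forall t0 d, circ t0 (fun w => K w * (psi (cis d * w) - psi w))%C 1 = RtoC 0) ->
  isI (fun t => K (f (gamma t)) * velocity gamma t)%C a b (RtoC 0).
Proof.
  intros HK Hcirc.
  destruct (circle_param) as [t0 [T [s [Hs1 [HT [Tm Te]]]]]].
  set (Y := fun t => psi (cis t)) in *. set (t1 := t0 + 2 * PI) in *.
  assert (HPI := PI_RGT_0).
  assert (Ht01 : t1 - t0 = 2 * PI) by (unfold t1; ring).
  assert (HY : forall x, tends (locally x) Y (Y x)) by (apply tends_Y; auto).
  set (Kg := fun t => K (f (gamma t))).
  assert (HKg : cts_on a b Kg) by now apply cts_on_boundary.
  set (D := velocity gamma). set (G := fun t => (Kg t * D t)%C).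
  assert (HG : exI G a b) by (apply (pf_exI _ _ _ pf); auto).
  destruct (cts_in_circle_bounded K HK) as [B [HB0 HB]].
  destruct (pf_bound _ _ _ pf) as [L HL]. fold D in HL.
  assert (HL0 : 0 <= L) by (eapply Rle_trans; [apply Cmod_ge_0 | apply (HL a); lra]).
  assert (HD : forall x y, a <= x <= b -> a <= y <= b -> isI D x y (gamma y - gamma x)%C).
  { assert (H0 : forall x, a <= x <= b -> isI D a x (gamma x - gamma a)%C).
    { intros x Hx. apply isI_ext with (fun t => RtoC 1 * D t)%C; [lra | intros; ring |].
      apply (pf_FTC _ _ _ pf (fun z => z) (fun _ => RtoC 1)); auto.
      - intros t _. apply cder_id.
      - intros t _. apply tends_const. }
    intros x y Hx Hy.
    apply isI_eq with (- (gamma x - gamma a) + (gamma y - gamma a))%C; [ring |].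
    apply isI_Chasles with a; auto. apply isI_swap; auto. }
  (* The integral along the curve up to the point at angle [x]; the goal becomes [A t1 = A t0]. *)
  set (A := fun x => CI G a (T x)).
  assert (HTr := mp_range _ _ _ _ _ _ _ HT).
  assert (HAd : forall x y, isI G (T x) (T y) (A y - A x)%C).
  { intros x y. apply isI_between with b; auto. }
  assert (HGb : forall t, a <= t <= b -> Cmod (G t) <= B * L).
  { intros t Ht. unfold G. rewrite Cmod_mult. apply Rmult_le_compat; auto; try apply Cmod_ge_0.
    apply HB. now apply f_gamma_unit. }
  assert (HAb : forall x y, Cmod (A y - A x) <= B * L * Rabs (T y - T x)).
  { intros x y. apply (isI_norm_between G (B * L) a b (T x) (T y)); auto. }
  assert (HBL : 0 <= B * L) by (apply Rmult_le_pos; auto).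
  assert (HA : forall x, tends (locally x) A (A x)).
  { intros x e He. assert (He' : 0 < e / (B * L + 1)) by (apply Rdiv_lt_0_compat; lra).
    generalize (mp_cts _ _ _ _ _ _ _ HT x _ He'). apply filter_imp. intros y Hy.
    rewrite <- RtoC_minus, Cmod_R in Hy.
    eapply Rle_lt_trans; [apply HAb |].
    apply Rle_lt_trans with (B * L * (e / (B * L + 1))).
    - apply Rmult_le_compat_l; lra.
    - replace (B * L * (e / (B * L + 1))) with (B * L * e / (B * L + 1)) by (field; lra).
      apply Rlt_div_l; nra. }
  assert (Hsx : forall x, Rabs (s * x) = Rabs x).
  { intro x. rewrite Rabs_mult. destruct Hs1 as [-> | ->];
    [rewrite Rabs_R1 | rewrite Rabs_left by lra]; ring. }
  (* In the constant, [2 * (B * L)] comes from replacing [A] by its end values on two strips of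
     width [d], [B] from the last strip of the circle integral, and [L * (b - a + 2)] from comparing
     [v] with the increments of [A]. *)
  assert (Hmain : forall e, 0 < e -> e <= 1 ->
     Cmod (A t1 - A t0) <= e * (2 * (B * L) + B + L * (b - a + 2))).
  { intros e He He1.
    destruct (cts_on_unif Kg a b HKg e He) as [d1 [Hd1 U1]].
    assert (Hd1e : 0 < Rmin d1 e) by (apply Rmin_glb_lt; auto).
    destruct (cts_on_unif (fun x => RtoC (T x)) t0 t1) with (e := Rmin d1 e) as [d2 [Hd2 U2]]; auto.
    { apply cts_on_tends. intros x _. apply (mp_cts _ _ _ _ _ _ _ HT). }
    assert (U2' : forall x y, t0 <= x <= t1 -> t0 <= y <= t1 -> Rabs (x - y) < d2 ->
       Rabs (T x - T y) < d1 /\ Rabs (T x - T y) < e).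
    { intros x y Hx Hy Hxy. specialize (U2 x y Hx Hy Hxy). rewrite <- RtoC_minus, Cmod_R in U2.
      split; eapply Rlt_le_trans; eauto; [apply Rmin_l | apply Rmin_r]. }
    destruct (cts_on_unif Y t0 (t1 + 2 * PI)) with (e := e) as [d3 [Hd3 U3]]; auto.
    { apply cts_on_tends. intros x _. apply HY. }
    set (d := Rmin (Rmin d2 d3) (2 * PI) / 2).
    assert (M1 := Rmin_l (Rmin d2 d3) (2 * PI)). assert (M2 := Rmin_r (Rmin d2 d3) (2 * PI)).
    assert (M3 := Rmin_l d2 d3). assert (M4 := Rmin_r d2 d3).
    assert (M5 : 0 < Rmin (Rmin d2 d3) (2 * PI)) by (apply Rmin_glb_lt; [apply Rmin_glb_lt; auto | lra]).
    assert (Hd : 0 < d /\ d < d2 /\ d < d3 /\ d < 2 * PI) by (unfold d; lra).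
    destruct Hd as [Hd [Hdd2 [Hdd3 Hdpi]]]. clearbody d. clear M1 M2 M3 M4 M5.
    set (v := fun t => (K (cis t) * (Y (t + d)%R - Y t))%C).
    assert (HKc : forall t, tends (locally t) (fun t => K (cis t)) (K (cis t))).
    { intro t. apply tends_comp_within with ext_disc (cis t).
      - apply filter_forall. intro x. unfold ext_disc. rewrite Cmod_cis. lra.
      - apply tends_cis.
      - apply HK. unfold ext_disc. rewrite Cmod_cis. lra. }
    assert (HYd : forall t, tends (locally t) (fun t => Y (t + d)) (Y (t + d))).
    { intro t. intros e' He'. destruct (HY (t + d) e' He') as [r Hr]. exists r.
      intros x Hx. apply Hr.
      change (Rabs (x + d - (t + d)) < r). replace (x + d - (t + d)) with (x - t) by ring. exact Hx. }
    assert (Hv : isI v t0 t1 (RtoC 0)).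
    { rewrite <- (Hcirc t0 d).
      apply isI_ext with (fun t => K (RtoC 1 * cis t) * (psi (cis d * (RtoC 1 * cis t)) - psi (RtoC 1 * cis t)))%C.
      - lra.
      - intros t _. unfold v, Y. rewrite cis_plus, (Cmult_comm (cis t)), Cmult_1_l. reflexivity.
      - apply (CI_spec (fun t => K (RtoC 1 * cis t) * (psi (cis d * (RtoC 1 * cis t)) - psi (RtoC 1 * cis t)))%C).
        destruct (exI_continuous v t0 t1) as [l Hl]; [lra | |].
        + intros t _. apply tends_mult; auto. apply tends_minus; auto.
        + exists l. revert Hl. apply isI_ext; [lra |].
          intros t _. unfold v, Y. rewrite cis_plus, (Cmult_comm (cis t)), Cmult_1_l. reflexivity. }
    assert (Hmid : t0 <= t1 - d <= t1) by lra.
    (* On the last strip [t + d] exceeds [t1], where [T] no longer parametrises [Y]; there [v] is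
       bounded directly by uniform continuity of [Y]. *)
    destruct (isI_split v t0 (t1 - d) t1 _ Hmid Hv) as [l1 [l2 [I1 [I2 Esum]]]].
    assert (N2 : Cmod l2 <= d * (B * e)).
    { replace d with (t1 - (t1 - d)) by ring. apply isI_norm_const with v; [lra | | exact I2].
      intros t Ht. unfold v. rewrite Cmod_mult. apply Rmult_le_compat; try apply Cmod_ge_0.
      - apply HB. apply Cmod_cis.
      - left. apply U3; try lra. replace (t + d - t) with d by ring. rewrite Rabs_right; lra. }
    destruct (isI_shift_diff A t0 t1 d) as [q0 [q1 [Q0 [Q1 Q2]]]]; [lra | lra | exact HA |].
    assert (E1 : Cmod (q1 - RtoC (t1 - (t1 - d)) * A t1) <= (t1 - (t1 - d)) * (B * L * e)).
    { apply isI_near_const with A; [lra | | exact Q1]. intros x Hx.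
      eapply Rle_trans; [apply HAb |]. apply Rmult_le_compat_l; auto. left. apply U2'; try lra.
      apply Rabs_lt_between. lra. }
    assert (E0 : Cmod (q0 - RtoC (t0 + d - t0) * A t0) <= (t0 + d - t0) * (B * L * e)).
    { apply isI_near_const with A; [lra | | exact Q0]. intros x Hx.
      eapply Rle_trans; [apply HAb |]. apply Rmult_le_compat_l; auto. left. apply U2'; try lra.
      apply Rabs_lt_between. lra. }
    replace (t1 - (t1 - d)) with d in E1 by ring. replace (t0 + d - t0) with d in E0 by ring.
    (* By monotonicity [S (t + d) - S t] is [Rabs (T (t + d) - T t)], which bounds the error at [t]
       up to the factor [e * L]. Its integral telescopes to about [d * (b - a)], so a factor [d] can
       be cancelled however irregular [T] is. *)
    set (S := fun x => RtoC (s * T x)).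
    assert (HS : forall x, tends (locally x) S (S x)).
    { intro x. unfold S. apply tends_ext with (fun x => RtoC s * RtoC (T x))%C.
      - apply filter_forall. intro y. now rewrite RtoC_mult.
      - rewrite RtoC_mult. apply tends_mult; [apply tends_const | apply (mp_cts _ _ _ _ _ _ _ HT)]. }
    assert (HSd : forall x y, Cmod (S x - S y) = Rabs (T x - T y)).
    { intros x y. unfold S. rewrite <- RtoC_minus, Cmod_R, <- Rmult_minus_distr_l. apply Hsx. }
    destruct (isI_shift_diff S t0 t1 d) as [r0 [r1 [R0 [R1 R2]]]]; [lra | lra | exact HS |].
    assert (F1 : Cmod (r1 - RtoC (t1 - (t1 - d)) * S t1) <= (t1 - (t1 - d)) * e).
    { apply isI_near_const with S; [lra | | exact R1]. intros x Hx. rewrite HSd.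
      left. apply U2'; try lra. apply Rabs_lt_between. lra. }
    assert (F0 : Cmod (r0 - RtoC (t0 + d - t0) * S t0) <= (t0 + d - t0) * e).
    { apply isI_near_const with S; [lra | | exact R0]. intros x Hx. rewrite HSd.
      left. apply U2'; try lra. apply Rabs_lt_between. lra. }
    replace (t1 - (t1 - d)) with d in F1 by ring. replace (t0 + d - t0) with d in F0 by ring.
    (* The summand 2 covers the two end strips, each with error [d * e <= d]. *)
    assert (F : Re (r1 - r0)%C <= d * (b - a + 2)).
    { eapply Rle_trans; [apply Rle_abs |]. eapply Rle_trans; [apply re_le_Cmod |].
      replace (r1 - r0)%C with ((r1 - RtoC d * S t1) - (r0 - RtoC d * S t0) + RtoC (d * (b - a)))%C.
      - eapply Rle_trans; [apply Cmod_triangle |].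
        assert (P1 : Cmod (RtoC (d * (b - a))) = d * (b - a)).
        { rewrite Cmod_R. apply Rabs_right. apply Rle_ge. apply Rmult_le_pos; lra. }
        rewrite P1. assert (P2 := Cmod_triangle (r1 - RtoC d * S t1) (- (r0 - RtoC d * S t0))).
        rewrite Cmod_opp in P2. change (r1 - RtoC d * S t1 + - (r0 - RtoC d * S t0))%C with
          (r1 - RtoC d * S t1 - (r0 - RtoC d * S t0))%C in P2. nra.
      - rewrite RtoC_mult, <- Te. unfold S. rewrite Rmult_minus_distr_l, RtoC_minus. ring. }
    assert (N1 : Cmod (l1 - (q1 - q0)) <= e * L * Re (r1 - r0)%C).
    { apply isI_norm with (fun t => v t - (A (t + d)%R - A t))%C
        (fun t => e * L * Re (S (t + d)%R - S t)%C) t0 (t1 - d); [lra | | |].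
      - intros t Ht.
        assert (Et : (v t - (A (t + d)%R - A t) =
          K (cis t) * (gamma (T (t + d)%R) - gamma (T t)) - (A (t + d)%R - A t))%C).
        { unfold v. rewrite <- !(mp_eq _ _ _ _ _ _ _ HT) by (fold t1; lra). reflexivity. }
        rewrite Et.
        assert (J := isI_minus _ _ _ _ _ _ (isI_scal (K (cis t)) _ _ _ _ (HD (T t) (T (t + d)) (HTr _) (HTr _)))
            (HAd t (t + d))).
        assert (ER : Re (S (t + d)%R - S t)%C = Rabs (T (t + d) - T t)).
        { rewrite <- Hsx. unfold S. rewrite <- RtoC_minus. simpl.
          rewrite Rmult_minus_distr_l. symmetry. apply Rabs_right.
          assert (Q := Tm t (t + d) ltac:(lra)). lra. }
        rewrite ER.
        apply (isI_norm_between _ (e * L) a b (T t) (T (t + d))) with (4 := J); auto.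
        intros x Hx Hxd. unfold G.
        replace (K (cis t) * D x - Kg x * D x)%C with ((K (cis t) - Kg x) * D x)%C by ring.
        rewrite Cmod_mult. apply Rmult_le_compat; auto; try apply Cmod_ge_0.
        assert (EK : K (cis t) = Kg (T t)).
        { unfold Kg. rewrite (mp_eq _ _ _ _ _ _ _ HT) by (fold t1; lra).
          f_equal. symmetry. apply psi_spec. unfold ext_disc. rewrite Cmod_cis. lra. }
        rewrite EK. left. apply U1; auto. rewrite Rabs_minus_sym.
        eapply Rle_lt_trans; [apply Hxd |]. apply U2'; try lra.
        replace (t + d - t) with d by ring. rewrite Rabs_right; lra.
      - apply isI_minus; auto.
      - apply isI_parts in R2. destruct R2 as [R2 _].
        exact (is_RInt_scal _ _ _ (e * L) _ R2). }
    assert (HeL : 0 <= e * L) by (apply Rmult_le_pos; lra).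
    assert (N1' : e * L * Re (r1 - r0)%C <= e * L * (d * (b - a + 2))) by (apply Rmult_le_compat_l; auto).
    assert (El : Cmod l1 = Cmod l2).
    { replace l1 with (- l2)%C; [apply Cmod_opp |].
      replace l1 with (l1 + l2 - l2)%C by ring. rewrite <- Esum. ring. }
    assert (Efin : (RtoC d * (A t1 - A t0) = - (q1 - RtoC d * A t1) + (q0 - RtoC d * A t0)
       + (- (l1 - (q1 - q0)) + l1))%C) by ring.
    apply Rmult_le_reg_l with d; auto.
    replace (d * Cmod (A t1 - A t0)) with (Cmod (RtoC d * (A t1 - A t0)))
      by (rewrite Cmod_mult, Cmod_R, Rabs_right; lra).
    rewrite Efin.
    eapply Rle_trans; [apply Cmod_triangle |].
    eapply Rle_trans; [apply Rplus_le_compat; apply Cmod_triangle |].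
    rewrite !Cmod_opp, El. lra. }
  assert (HC : 0 <= 2 * (B * L) + B + L * (b - a + 2)).
  { assert (0 <= L * (b - a + 2)) by (apply Rmult_le_pos; lra). lra. }
  assert (E0 : (A t1 - A t0)%C = RtoC 0).
  { apply Cmod_small_eq0. intros e He.
    set (Cc := 2 * (B * L) + B + L * (b - a + 2)) in *.
    set (e' := Rmin 1 (e / (Cc + 1))).
    assert (He' : 0 < e') by (apply Rmin_glb_lt; [lra | apply Rdiv_lt_0_compat; lra]).
    assert (X1 := Rmin_l 1 (e / (Cc + 1))). assert (X2 := Rmin_r 1 (e / (Cc + 1))). fold e' in X1, X2.
    eapply Rle_trans; [apply (Hmain e'); auto |].
    apply Rle_div_r in X2; [ | lra]. nra. }
  assert (Hfin := HAd t0 t1). rewrite E0 in Hfin.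
  assert (Hends : (T t0 = a /\ T t1 = b) \/ (T t0 = b /\ T t1 = a)).
  { destruct (HTr t0), (HTr t1). destruct Hs1 as [-> | ->]; [left | right]; lra. }
  destruct Hends as [[X1 X2] | [X1 X2]]; rewrite X1, X2 in Hfin.
  - exact Hfin.
  - apply isI_eq with (- RtoC 0)%C; [ring |]. now apply isI_swap.
Qed.

(** * The Cauchy integrals *)

Variable z : C.
Hypothesis Hz : inner gamma a b z.

Lemma gamma_neq_z t : a <= t <= b -> (gamma t - z)%C <> RtoC 0.
Proof. intro Ht. apply Cminus_neq0. intro E. apply (proj1 Hz). now exists t. Qed.

Lemma integral_pow_zero n : isI (fun t => gamma t ^ n * velocity gamma t)%C a b (RtoC 0).
Proof.
  assert (Hn : RtoC (INR (S n)) <> RtoC 0).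
  { intro Q. apply RtoC_inj in Q. now apply not_0_INR in Q. }
  set (Q := fun x => (/ RtoC (INR (S n)) * x ^ S n)%C).
  apply isI_eq with (Q (gamma b) - Q (gamma a))%C.
  { rewrite (proj1 (proj2 Hsimple)). ring. }
  apply (pf_FTC _ _ _ pf Q (fun x => x ^ n)%C); [lra | |].
  - intros t Ht. apply (cder_eq _ _ (0 * (gamma t) ^ S n + / RtoC (INR (S n)) * (RtoC (INR (S n)) * gamma t ^ n))%C).
    + field. auto.
    + apply (cder_mult (fun _ => / RtoC (INR (S n)))%C (fun x => x ^ S n)%C); [apply cder_const | apply cder_pow_S].
  - intros t Ht. apply (tends_pow gamma). now apply (pf_cts _ _ _ pf).
Qed.

(** Induction by [y^(n+1) / (y - z) = y^n + z * y^n / (y - z)]: the first term has a primitive, and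
    the case [n = 0] is the orientation hypothesis. *)
Lemma cauchy_pow n : isI (fun t => gamma t ^ n * (velocity gamma t / (gamma t - z)))%C a b
  (z ^ n * (RtoC (2 * PI) * Ci))%C.
Proof.
  induction n as [ | n IH].
  - apply isI_eq with (RtoC (2 * PI) * Ci)%C; [simpl; ring |].
    apply isI_ext with (2 := fun t _ => eq_sym (Cmult_1_l _)); [lra |]. now apply Horiented.
  - apply isI_eq with (0 + z * (z ^ n * (RtoC (2 * PI) * Ci)))%C; [simpl; ring |].
    apply isI_ext with (fun t => gamma t ^ n * velocity gamma t +
       z * (gamma t ^ n * (velocity gamma t / (gamma t - z))))%C; [lra | |].
    + intros t Ht. simpl. field. apply gamma_neq_z. lra.
    + apply isI_plus; [apply integral_pow_zero | now apply isI_scal].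
Qed.

Lemma cauchy_ppart c N : isI (fun t => ppart c N (gamma t) * (velocity gamma t / (gamma t - z)))%C a b
  (ppart c N z * (RtoC (2 * PI) * Ci))%C.
Proof.
  induction N as [ | N IH].
  - unfold ppart. rewrite psum_O. apply isI_eq with (c O * (z ^ 0 * (RtoC (2 * PI) * Ci)))%C; [ring |].
    apply isI_ext with (fun t => c O * (gamma t ^ 0 * (velocity gamma t / (gamma t - z))))%C; [lra | |].
    + intros t _. rewrite psum_O. ring.
    + apply isI_scal. apply cauchy_pow.
  - unfold ppart in *. rewrite psum_S.
    apply isI_eq with (psum (fun k => c k * z ^ k) N * (RtoC (2 * PI) * Ci) +
      c (S N) * (z ^ S N * (RtoC (2 * PI) * Ci)))%C; [ring |].
    apply isI_ext with (fun t => psum (fun k => c k * gamma t ^ k) N * (velocity gamma t / (gamma t - z)) +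
      c (S N) * (gamma t ^ S N * (velocity gamma t / (gamma t - z))))%C; [lra | |].
    + intros t _. rewrite psum_S. ring.
    + apply isI_plus; auto. apply isI_scal. apply cauchy_pow.
Qed.

Lemma exI_kernel phi : cts_on a b phi -> exI (fun t => phi t * (velocity gamma t / (gamma t - z)))%C a b.
Proof.
  intro H. destruct (pf_exI _ _ _ pf (fun t => phi t * / (gamma t - z))%C) as [l Hl].
  - intros t Ht. apply (tends_mult phi (fun t => / (gamma t - z))%C); auto.
    apply cts_on_inv_sub; auto. apply Hz.
  - exists l. revert Hl. apply isI_ext; [lra |]. intros t _. unfold Cdiv. ring.
Qed.

Lemma kernel_bound : exists B, 0 <= B /\ forall t, a <= t <= b -> Cmod (velocity gamma t / (gamma t - z)) <= B.
Proof.
  destruct (pf_bound _ _ _ pf) as [L HL]. destruct (off_dist z (proj1 Hz)) as [r [Hr H]].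
  assert (HL0 : 0 <= L) by (eapply Rle_trans; [apply Cmod_ge_0 | apply (HL a); lra]).
  exists (L * / r). split.
  - apply Rmult_le_pos; auto. left. now apply Rinv_0_lt_compat.
  - intros t Ht. specialize (H t Ht). rewrite Cmod_div by (now apply gamma_neq_z).
    apply Rmult_le_compat; auto; [apply Cmod_ge_0 | |].
    + left. apply Rinv_0_lt_compat. lra.
    + apply Rinv_le_contravar; lra.
Qed.

Lemma cauchy_entire c p : (forall z, is_Cseries (fun k => c k * z ^ k)%C (p z)) ->
  isI (fun t => p (gamma t) * (velocity gamma t / (gamma t - z)))%C a b (p z * (RtoC (2 * PI) * Ci))%C.
Proof.
  intro Hp. destruct (exI_kernel (fun t => p (gamma t))) as [l Hl].
  { intros t Ht. eapply tends_comp_C; [apply (pf_cts _ _ _ pf); auto | apply (tends_entire c); auto]. }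
  apply isI_eq with l; auto. apply Cminus_eq0. apply Cmod_small_eq0. intros e He.
  destruct kernel_bound as [B [HB0 HB]]. destruct (gamma_bound) as [M [_ HM]].
  assert (HPI := PI_RGT_0).
  (* The two summands measure the approximation error of the partial sum under the integral and at
     [z] itself. *)
  set (q := (b - a) * B + 2 * PI). assert (Hq : 0 < q).
  { unfold q. assert (0 <= (b - a) * B) by (apply Rmult_le_pos; lra). lra. }
  assert (Heq : 0 < e / q) by (apply Rdiv_lt_0_compat; auto).
  destruct (ppart_unif c p Hp (Rmax M (Cmod z)) _ Heq) as [N HN].
  assert (E1 : Cmod (l - ppart c N z * (RtoC (2 * PI) * Ci)) <= (b - a) * (e / q * B)).
  { assert (J := isI_minus _ _ _ _ _ _ Hl (cauchy_ppart c N)).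
    apply (isI_norm_const _ _ _ _ _ (Rlt_le _ _ Hab)) with (2 := J). intros t Ht. cbv beta.
    replace (p (gamma t) * (velocity gamma t / (gamma t - z)) -
      ppart c N (gamma t) * (velocity gamma t / (gamma t - z)))%C with
      ((p (gamma t) - ppart c N (gamma t)) * (velocity gamma t / (gamma t - z)))%C by ring.
    rewrite Cmod_mult. apply Rmult_le_compat; auto; try apply Cmod_ge_0.
    rewrite Cmod_minus_sym. apply HN. eapply Rle_trans; [apply HM; auto | apply Rmax_l]. }
  assert (E2 : Cmod (ppart c N z * (RtoC (2 * PI) * Ci) - p z * (RtoC (2 * PI) * Ci)) <= e / q * (2 * PI)).
  { replace (ppart c N z * (RtoC (2 * PI) * Ci) - p z * (RtoC (2 * PI) * Ci))%C with
      ((ppart c N z - p z) * (RtoC (2 * PI) * Ci))%C by ring.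
    rewrite !Cmod_mult, Cmod_Ci, Cmod_R, Rabs_right by lra.
    rewrite Rmult_1_r. apply Rmult_le_compat_r; [lra |]. apply HN. apply Rmax_r. }
  eapply Rle_trans; [apply (Cmod_sub_triangle _ (ppart c N z * (RtoC (2 * PI) * Ci))%C) |].
  replace e with ((b - a) * (e / q * B) + e / q * (2 * PI)).
  - lra.
  - unfold q. field. unfold q in Hq. lra.
Qed.

Lemma psi_neq_z w : ext_disc w -> (psi w - z)%C <> RtoC 0.
Proof.
  intro Hw. apply Cminus_neq0. intro E. destruct (psi_spec w Hw) as [K _].
  rewrite E in K. now apply inner_not_outer in K.
Qed.

Lemma tends_psi_rot d w : ext_disc w -> tends (within ext_disc (nb w)) (fun w => psi (cis d * w)%C) (psi (cis d * w)%C).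
Proof.
  intro Hw. assert (K : forall x, ext_disc x -> ext_disc (cis d * x)%C).
  { intros x Hx. unfold ext_disc in *. rewrite Cmod_mult, Cmod_cis. lra. }
  apply (tends_comp_within ext_disc (fun w => cis d * w)%C psi (cis d * w)%C).
  - unfold within. apply filter_forall. auto.
  - apply (tends_le_filter (F := nb w)); [apply nb_within |].
    apply tends_mult; [apply tends_const | apply tends_id].
  - apply psi_cts; auto.
Qed.

(** With [K = H / (psi - z)], the integrand of [stieltjes_zero] regroups as [H w * rot d w], a
    factor tending to 0 at infinity times one that stays bounded. *)
Definition rot (d : R) (w : C) : C := ((psi (cis d * w) - psi w) / (psi w - z))%C.

Lemma rot_cts d : cts_in ext_disc (rot d).
Proof.
  intros w Hw. assert (Hpw := psi_cts w Hw). unfold rot.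
  apply tends_div; [now apply psi_neq_z | |].
  - apply tends_minus; [now apply tends_psi_rot | exact Hpw].
  - apply tends_minus; [exact Hpw | apply tends_const].
Qed.

Lemma rot_cder d w : 1 < Cmod w -> exists A, cder (rot d) w A.
Proof.
  intro Hw. destruct (psi_cder w Hw) as [A HA].
  destruct (psi_cder (cis d * w)%C) as [A' HA'].
  { rewrite Cmod_mult, Cmod_cis. lra. }
  eexists. apply cder_mult.
  - apply cder_minus; [ | exact HA].
    apply (cder_comp (fun w => cis d * w)%C psi); [ | exact HA'].
    apply cder_mult; [apply cder_const | apply cder_id].
  - apply cder_inv; [apply psi_neq_z; unfold ext_disc; lra |]. apply cder_sub_const. exact HA.
Qed.

(** The numerator is at most [(k + 1) * Cmod (psi w)] by [psi_growth], and once [Cmod (psi w)]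
    exceeds [2 * Cmod z] the denominator is at least half of [Cmod (psi w)]. *)
Lemma rot_bounded d : exists B k, 0 < B /\ 0 < k /\ forall w, B < Cmod w -> ext_disc w -> Cmod (rot d w) <= k.
Proof.
  destruct (psi_growth) as [B1 [k [HB1 [Hk H]]]].
  destruct (psi_infty (2 * Cmod z + 1)) as [B2 HB2].
  exists (Rmax B1 B2), (2 * (k + 1)).
  assert (A1 := Rmax_l B1 B2). assert (A2 := Rmax_r B1 B2).
  split; [lra |]. split; [lra |]. intros w Hw He.
  assert (H1 := H w (cis d * w)%C ltac:(lra) He ltac:(rewrite Cmod_mult, Cmod_cis; ring)).
  assert (H2 := HB2 w ltac:(lra) He).
  assert (Hz0 := Cmod_ge_0 z).
  assert (H3 : Cmod (psi w) / 2 <= Cmod (psi w - z)).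
  { generalize (Cmod_le_add_sub (psi w) z). lra. }
  unfold rot. rewrite Cmod_div by now apply psi_neq_z.
  apply Rle_div_l; [lra |].
  apply Rle_trans with ((k + 1) * Cmod (psi w)).
  - unfold Cminus. eapply Rle_trans; [apply Cmod_triangle |]. rewrite Cmod_opp. lra.
  - nra.
Qed.

Lemma cts_in_annulus r u : cts_in ext_disc u -> cts_in (annulus 1 r) u.
Proof.
  intros H w [H1 H2]. generalize (H w H1). apply tends_le_filter.
  intros P. unfold within. apply filter_imp. intros x Q [H3 H4]. apply Q. exact H3.
Qed.

(** Cauchy's theorem for the exterior domain, for functions [H (f y) / (y - z)]
    that are only continuous on the curve. *)
Lemma exterior_cauchy (H : C -> C) (HN : nat -> C -> C) :
  cts_in ext_disc H -> (forall N, cts_in ext_disc (HN N)) ->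
  (forall N w, 1 < Cmod w -> exists A, cder (HN N) w A) ->
  (forall r e, 0 < e -> exists N, forall w, annulus 1 r w -> Cmod (HN N w - H w) <= e) ->
  (forall e, 0 < e -> exists B, forall w, B < Cmod w -> ext_disc w -> Cmod (H w) <= e) ->
  isI (fun t => H (f (gamma t)) * (velocity gamma t / (gamma t - z)))%C a b (RtoC 0).
Proof.
  intros HHc HNc HNd Happ Hinf.
  apply isI_ext with (fun t => H (f (gamma t)) / (psi (f (gamma t)) - z) * velocity gamma t)%C; [lra | |].
  { intros t Ht. rewrite psi_f by (right; exists t; split; auto; lra).
    unfold Cdiv. ring. }
  apply (stieltjes_zero (fun w => H w / (psi w - z))%C).
  { intros w Hw. apply tends_div; [now apply psi_neq_z | now apply HHc |].
    apply tends_minus; [now apply psi_cts | apply tends_const]. }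
  intros t0 d.
  assert (HPI := PI_RGT_0).
  assert (Hu : cts_in ext_disc (fun w => H w * rot d w)%C).
  { intros w Hw. apply (tends_mult H (rot d)); [now apply HHc | now apply rot_cts]. }
  assert (HuN : forall N, cts_in ext_disc (fun w => HN N w * rot d w)%C).
  { intros N w Hw. apply (tends_mult (HN N) (rot d)); [now apply HNc | now apply rot_cts]. }
  (* [circ_const] needs complex derivatives, supplied for the approximants [HN]; uniform closeness
     on the annulus carries the equality over to [H]. The factor 4 in [q] collects the errors at the
     two radii. *)
  assert (Hcon : forall r, 1 < r -> circ t0 (fun w => H w * rot d w)%C 1 = circ t0 (fun w => H w * rot d w)%C r).
  { intros r Hr. apply Cminus_eq0. apply Cmod_small_eq0. intros e He.
    destruct (cts_in_bounded (annulus 1 r) (rot d) r) as [B HB].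
    { apply annulus_closed. }
    { intros w [_ Q]; auto. }
    { apply cts_in_annulus. apply rot_cts. }
    assert (HB0 : 0 <= B).
    { eapply Rle_trans; [apply Cmod_ge_0 | apply (HB (RtoC 1))]. unfold annulus. rewrite Cmod_1. lra. }
    set (q := 4 * PI * (B + 1)). assert (Hq : 0 < q) by (unfold q; nra).
    assert (Heq : 0 < e / q) by (apply Rdiv_lt_0_compat; auto).
    destruct (Happ r _ Heq) as [N HNr].
    assert (HE : forall s, 1 <= s <= r -> forall t, annulus 1 r (RtoC s * cis t)%C).
    { intros s Hsr t. unfold annulus. rewrite Cmod_polar; lra. }
    assert (Hcl : forall s, 1 <= s <= r ->
      Cmod (circ t0 (fun w => H w * rot d w)%C s - circ t0 (fun w => HN N w * rot d w)%C s) <= 2 * PI * (e / q * B)).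
    { intros s Hsr. apply (circ_close (annulus 1 r)); try lra; auto.
      - now apply cts_in_annulus.
      - now apply cts_in_annulus.
      - intro t. assert (Hann := HE s Hsr t). set (w := (RtoC s * cis t)%C) in *.
        replace (H w * rot d w - HN N w * rot d w)%C with ((H w - HN N w) * rot d w)%C by ring.
        rewrite Cmod_mult. apply Rmult_le_compat; try apply Cmod_ge_0; auto.
        rewrite Cmod_minus_sym. auto. }
    assert (Hc1 := Hcl 1 ltac:(lra)). assert (Hc2 := Hcl r ltac:(lra)).
    rewrite <- (circ_const t0 (fun w => HN N w * rot d w)%C 1 r) in Hc2; [ | lra | lra | | ].
    - rewrite Cmod_minus_sym in Hc2.
      generalize (Cmod_sub_triangle (circ t0 (fun w => H w * rot d w)%C 1)
        (circ t0 (fun w => HN N w * rot d w)%C 1) (circ t0 (fun w => H w * rot d w)%C r)).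
      assert (4 * PI * (e / q * B) <= e); [ | lra].
      replace (4 * PI * (e / q * B)) with (e * (4 * PI * B) / q) by (field; lra).
      apply Rle_div_l; auto. apply Rmult_le_compat_l; [lra |]. unfold q. nra.
    - now apply cts_in_annulus.
    - intros w Hw. destruct (HNd N w) as [A HA]; [lra |]. destruct (rot_cder d w) as [A' HA']; [lra |].
      eexists. apply cder_mult; [exact HA | exact HA']. }
  transitivity (circ t0 (fun w => H w * rot d w)%C 1).
  { assert (E : forall w, (H w / (psi w - z) * (psi (cis d * w) - psi w) = H w * rot d w)%C)
      by (intro; unfold rot, Cdiv; ring).
    unfold circ, CI. apply (RInt_ext (V := C_R_CompleteNormedModule)). intros t _. apply E. }
  apply Cmod_small_eq0. intros e He.
  destruct (rot_bounded d) as [B1 [k [HB1 [Hk K1]]]].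
  assert (Hek : 0 < e / (2 * PI * k)) by (apply Rdiv_lt_0_compat; nra).
  destruct (Hinf _ Hek) as [B2 K2].
  set (r := Rmax (Rmax B1 B2) 1 + 1).
  assert (A1 := Rmax_l (Rmax B1 B2) 1). assert (A2 := Rmax_r (Rmax B1 B2) 1).
  assert (A3 := Rmax_l B1 B2). assert (A4 := Rmax_r B1 B2).
  rewrite (Hcon r) by (unfold r; lra).
  assert (Hp : forall t, Cmod (RtoC r * cis t) = r) by (intro t; apply Cmod_polar; unfold r; lra).
  replace e with ((t0 + 2 * PI - t0) * (e / (2 * PI * k) * k)) by (field; lra).
  apply isI_norm_const with (fun t => H (RtoC r * cis t) * rot d (RtoC r * cis t))%C; [lra | |].
  - intros t _. assert (Hext : ext_disc (RtoC r * cis t)%C) by (unfold ext_disc; rewrite Hp; unfold r; lra).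
    rewrite Cmod_mult. apply Rmult_le_compat; try apply Cmod_ge_0.
    + apply K2; auto. rewrite Hp. unfold r; lra.
    + apply K1; auto. rewrite Hp. unfold r; lra.
  - apply (circ_is ext_disc t0 (fun w => H w * rot d w)%C); [unfold r; lra | exact Hu |].
    intro t. unfold ext_disc. rewrite Hp. unfold r; lra.
Qed.

(** Here the function of the exterior theorem is the power itself, with constant approximants.
    Positivity of [m] gives the decay at infinity. *)
Lemma cauchy_inverse_power m : (0 < m)%nat ->
  isI (fun t => / f (gamma t) ^ m * (velocity gamma t / (gamma t - z)))%C a b (RtoC 0).
Proof.
  intro Hm.
  assert (Hne : forall w, ext_disc w -> (w ^ m)%C <> RtoC 0).
  { intros w Hw. apply Cpow_nz. apply Cmod_gt_0. unfold ext_disc in Hw. lra. }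
  assert (Hc : cts_in ext_disc (fun w => / w ^ m)%C).
  { intros w Hw. apply (tends_inv (fun w => w ^ m)%C); auto. apply (tends_pow (fun w => w)).
    apply (tends_le_filter (F := nb w)); [apply nb_within | apply tends_id]. }
  apply (exterior_cauchy (fun w => / w ^ m)%C (fun _ w => / w ^ m)%C); auto.
  - intros _ w Hw. destruct (cder_pow (fun x => x) m w _ (cder_id w)) as [A HA].
    eexists. apply (cder_inv (fun x => x ^ m)%C); [ | exact HA]. apply Hne. unfold ext_disc; lra.
  - intros r e He. exists O. intros w _. replace (/ w ^ m - / w ^ m)%C with (RtoC 0) by ring.
    rewrite Cmod_0. lra.
  - intros e He. exists (/ e). intros w Hw Hext. rewrite Cmod_inv, Cmod_pow by auto.
    rewrite <- (Rinv_inv e). assert (0 < / e) by now apply Rinv_0_lt_compat.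
    apply Rinv_le_contravar; auto. left. eapply Rlt_le_trans; [apply Hw |].
    destruct m as [ | m]; [lia |]. simpl. unfold ext_disc in Hext.
    assert (1 <= Cmod w ^ m) by now apply pow_R1_Rle. nra.
Qed.

(** Far out, [w ^ m - p (psi w)] is the sum of the negative powers in the Laurent series at [psi w],
    hence tends to 0. Its integral vanishes by the exterior theorem, and Cauchy's formula for [p]
    remains. *)
Lemma cauchy_faber m p : faber_polynomial gamma a b f m p ->
  isI (fun t => f (gamma t) ^ m * (velocity gamma t / (gamma t - z)))%C a b (p z * (RtoC (2 * PI) * Ci))%C.
Proof.
  intros [R0 [c [c' [HR0 [_ [Hlaurent Hp]]]]]].
  set (H := fun w => (w ^ m - p (psi w))%C).
  assert (Hpc : forall (g : C -> C), (forall x, tends (nb x) g (g x)) ->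
     cts_in ext_disc (fun w => w ^ m - g (psi w))%C).
  { intros g Hg w Hw. apply tends_minus.
    - apply (tends_pow (fun w => w)). apply (tends_le_filter (F := nb w)); [apply nb_within | apply tends_id].
    - eapply tends_comp_C; [apply psi_cts; auto | apply Hg]. }
  assert (J : isI (fun t => H (f (gamma t)) * (velocity gamma t / (gamma t - z)))%C a b (RtoC 0)).
  { apply (exterior_cauchy H (fun N w => w ^ m - ppart c N (psi w))%C).
    - apply Hpc. now apply (tends_entire c).
    - intro N. apply Hpc. intro x. destruct (cder_ppart c N x) as [A HA]. eapply cder_tends. exact HA.
    - intros N w Hw. destruct (cder_pow (fun x => x) m w _ (cder_id w)) as [A HA].
      destruct (psi_cder w Hw) as [A' HA'].
      destruct (cder_ppart c N (psi w)) as [A2 HA2].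
      eexists. apply cder_minus; [exact HA |]. apply (cder_comp psi (ppart c N)); [exact HA' | exact HA2].
    - intros r e He. destruct (psi_bounded r) as [M HM].
      destruct (ppart_unif c p Hp M e He) as [N HN]. exists N. intros w [H1 H2]. unfold H.
      replace (w ^ m - ppart c N (psi w) - (w ^ m - p (psi w)))%C with (- (ppart c N (psi w) - p (psi w)))%C by ring.
      rewrite Cmod_opp. apply HN. apply HM; auto.
    - intros e He.
      (* The expansion holds strictly outside [R0], so the coefficients are bounded by evaluating it
         at the real point [R0 + 1]. *)
      set (R1 := R0 + 1).
      destruct (Hlaurent (RtoC R1)) as [_ [s0 [_ [Hs0 _]]]].
      { rewrite Cmod_R, Rabs_right; unfold R1; lra. }
      destruct (laurent_tail_bound R1 c' s0) as [B HB]; [unfold R1; lra | exact Hs0 |].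
      destruct (psi_infty (Rmax (2 * R1) (B / e))) as [B2 HB2].
      exists B2. intros w Hw Hext. specialize (HB2 w Hw Hext).
      assert (Q1 := Rle_lt_trans _ _ _ (Rmax_l _ _) HB2). assert (Q2 := Rle_lt_trans _ _ _ (Rmax_r _ _) HB2).
      assert (Hpw : 0 < Cmod (psi w)) by (unfold R1 in Q1; lra).
      destruct (Hlaurent (psi w)) as [s1 [s' [Hs1 [Hs' E]]]]; [unfold R1 in Q1; lra |].
      assert (Ep : s1 = p (psi w)).
      { eapply (tends_unique eventually); [apply eventually_filter | |]; apply is_Cseries_tends; [exact Hs1 | apply Hp]. }
      assert (EH : H w = s').
      { unfold H. replace (w ^ m)%C with (f (psi w) ^ m)%C.
        - rewrite E, Ep. ring.
        - now rewrite (proj2 (psi_spec w Hext)). }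
      rewrite EH. eapply Rle_trans; [apply (HB (psi w)); auto; lra |].
      apply Rle_div_l; auto. apply Rlt_div_l in Q2; lra. }
  apply isI_eq with (0 + p z * (RtoC (2 * PI) * Ci))%C; [ring |].
  apply isI_ext with (fun t => H (f (gamma t)) * (velocity gamma t / (gamma t - z)) +
    p (gamma t) * (velocity gamma t / (gamma t - z)))%C; [lra | |].
  - intros t Ht. unfold H. rewrite psi_f by (right; exists t; split; auto; lra). ring.
  - apply isI_plus; [exact J |]. now apply (cauchy_entire c).
Qed.

Lemma unit_conj_inv w : Cmod w = 1 -> Cconj (/ w) = w.
Proof.
  intro Hw. assert (Hn : w <> RtoC 0) by (apply Cmod_gt_0; lra).
  rewrite Cinv_conj by auto.
  assert (E : (w * Cconj w = 1)%C) by (rewrite <- Cmod2_conj, Hw; f_equal; ring).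
  assert (Hc : Cconj w <> RtoC 0) by (intro Q; rewrite Q, Cmult_0_r in E; apply RtoC_inj in E; lra).
  replace w with ((w * Cconj w) * / Cconj w)%C at 2 by (field; auto).
  rewrite E. ring.
Qed.

(** On the curve [conj (f^-m) = f^m], so the conjugate of the vanishing
    integral of [f^-m dy / (y - z)] removes the real part of [dy / (y - z)]. *)
Lemma faber_Im_integral m p : (0 < m)%nat -> faber_polynomial gamma a b f m p ->
  isI (fun t => f (gamma t) ^ m * RtoC (Im (velocity gamma t / (gamma t - z))))%C a b (RtoC PI * p z)%C.
Proof.
  intros Hm Hp. assert (J1 := cauchy_faber m p Hp).
  assert (J2 := isI_conj _ _ _ _ (cauchy_inverse_power m Hm)).
  assert (J := isI_scal (/ (RtoC 2 * Ci)) _ _ _ _ (isI_minus _ _ _ _ _ _ J1 J2)).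
  assert (H2 : RtoC 2 <> RtoC 0) by (intro Q; apply RtoC_inj in Q; lra).
  assert (Hi : Ci <> RtoC 0) by (apply Cmod_gt_0; rewrite Cmod_Ci; lra).
  apply isI_eq with (/ (RtoC 2 * Ci) * (p z * (RtoC (2 * PI) * Ci) - Cconj (RtoC 0)))%C.
  { replace (Cconj (RtoC 0)) with (RtoC 0) by (unfold Cconj, RtoC; simpl; f_equal; ring).
    rewrite RtoC_mult. field. auto. }
  apply isI_ext with (3 := J); [lra |].
  - intros t Ht. cbv beta. set (X := (velocity gamma t / (gamma t - z))%C).
    assert (E : Cconj (/ f (gamma t) ^ m * X) = (f (gamma t) ^ m * Cconj X)%C).
    { transitivity (Cconj (/ f (gamma t) ^ m) * Cconj X)%C.
      - unfold Cconj, Cmult; simpl. f_equal; ring.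
      - rewrite unit_conj_inv; auto. rewrite Cmod_pow, (f_gamma_unit) by lra. apply pow1. }
    rewrite E.
    replace (RtoC (Im X)) with ((X - Cconj X) / (RtoC 2 * Ci))%C.
    + field; auto.
    + replace (X - Cconj X)%C with (RtoC (Im X) * (RtoC 2 * Ci))%C.
      * field; auto.
      * unfold Cconj, Cmult, Cminus, Cplus, Copp, Ci, RtoC, Im; simpl. f_equal; ring.
Qed.
End Curve.

(** * The Faber polynomial as an arc-length integral *)

Theorem lemma3p1 :
  forall (gamma : R -> C) (a b : R),
    piecewise_smooth gamma a b ->
    simple_closed gamma a b ->
    positively_oriented gamma a b ->
    inner gamma a b (RtoC 0) ->
  forall f : C -> C, exterior_riemann_map gamma a b f ->
  forall (m : nat) (p : C -> C),
    (0 < m)%nat -> faber_polynomial gamma a b f m p ->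
  forall nu : C -> C, outward_normal_field gamma a b nu ->
  forall z : C, inner gamma a b z ->
    let g := fun y : C =>
      (f y ^ m * RtoC (normal_derivative nu (fun x => ln (Cmod (x - z))) y))%C in
    ex_arc_integral gamma a b g /\
    p z = (RtoC (1 / PI) * arc_integral gamma a b g)%C.
Proof.
  intros gamma a b Hpw Hs Hor _ f Hf m p Hm Hp nu Hnu z Hz g.
  assert (pf := piecewise_smooth_facts _ _ _ Hpw).
  assert (J := faber_Im_integral gamma a b pf Hs Hor f Hf z Hz m p Hm Hp).
  assert (I : isI (arc_integrand gamma g) a b (RtoC PI * p z)%C).
  (* The two integrands are compared at regular parameters, where the normal is determined; the
     corners are taken care of by [pf_ext]. *)
  { apply (pf_ext _ _ _ pf) with (2 := J). intros t Ht Hr. unfold arc_integrand, g.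
    assert (Hzt : gamma t <> z).
    { intro E. apply (proj1 Hz). exists t. split; auto. lra. }
    assert (Hn := Cminus_neq0 _ _ Hzt).
    rewrite normal_derivative_log by auto.
    assert (N := outward_normal_eq gamma a b pf Hs Hor t (nu (gamma t)) Ht Hr
      (Hnu t _ Ht (rder_is_derive _ _ _ (proj1 Hr)))).
    rewrite <- Cmult_assoc, <- RtoC_mult. do 2 f_equal.
    set (v := velocity gamma t) in *.
    (* As [Cmod v * nu = - i v], the factor from arc length turns the real part of [nu / (y - z)]
       into the imaginary part of [v / (y - z)]. *)
    transitivity (Re (RtoC (Cmod v) * (nu (gamma t) / (gamma t - z)))%C).
    - replace (RtoC (Cmod v) * (nu (gamma t) / (gamma t - z)))%C with
        (- Ci * (v / (gamma t - z)))%C.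
      + unfold Re, Im, Ci, Copp, Cmult; simpl. ring.
      + transitivity (- Ci * v / (gamma t - z))%C; [field; auto |]. rewrite <- N. field; auto.
    - unfold Re, Cmult, RtoC; simpl. ring. }
  split.
  - now exists (RtoC PI * p z)%C.
  - unfold arc_integral.
    replace (RInt (V := C_R_CompleteNormedModule) (arc_integrand gamma g) a b) with (RtoC PI * p z)%C
      by (symmetry; exact (CI_eq _ _ _ _ I)).
    assert (HPI := PI_RGT_0). rewrite RtoC_div by lra.
    field. intro Q. apply RtoC_inj in Q. lra.
Qed.
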